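(* Let $A\in\mathbb{Z}^{m\times n_x}$ with $\operatorname{rank}(A)=n_x$, $B\in\mathbb{Q}^{m\times n_y}$, $b\in\mathbb{Q}^m$, and $\mathcal{P}=\{(x,y)\in\mathbb{R}^{n_x+n_y}:Ax\le b+By\}$ with $\dim(\mathcal{P})=n_x+n_y$. Assume the $n_y$-dimensional and $(n_y-1)$-dimensional faces of $\mathcal{P}$ are given by lists of the inequalities that hold with equality on the respective face. Then a chamber decomposition of $\mathcal{P}$ can be computed by an algorithm with arithmetic complexity $O^*\bigl((f_{n_y-1})^{n_y}f_{n_y}+(f_{n_y-1})^{2n_y}(\nu+f_{n_y-1})\bigr)$. The total number of chambers is $O\bigl((f_{n_y-1})^{2n_y}\bigr)$ and the number of chambers of dimension $n_y$ is $O\bigl((f_{n_y-1})^{n_y}\bigr)$. For a given point $y\in\Pi(\mathcal{P})$, the chamber $\mathcal{Q}$ with $y\in\operatorname{relint}(\mathcal{Q})$ can be found with $O(n_y f_{n_y-1})$ operations.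
   Context: $\mathcal{P}_y=\{x:(x,y)\in\mathcal{P}\}$ and $\Pi(x,y)=y$. A base of $A$ is a set $\mathcal{B}$ of $n_x$ row indices with $A_{\mathcal{B}}$ nonsingular. A chamber decomposition of $\mathcal{P}$ is a finite collection $\mathcal{Q}\mathcal{S}$ of rational polyhedra in $\mathbb{R}^{n_y}$ whose relative interiors are pairwise disjoint and cover $\Pi(\mathcal{P})$, such that for each $\mathcal{Q}\in\mathcal{Q}\mathcal{S}$ all $\mathcal{P}_y$, $y\in\operatorname{relint}(\mathcal{Q})$, have the same combinatorial type, and there is a set $\operatorname{base}(\mathcal{Q})$ of bases of $A$ with $\operatorname{vert}(\mathcal{P}_y)=\{A_{\mathcal{B}}^{-1}(b_{\mathcal{B}}+B_{\mathcal{B}}y):\mathcal{B}\in\operatorname{base}(\mathcal{Q})\}$ for all $y\in\operatorname{relint}(\mathcal{Q})$ (the algorithm outputs the chambers with these parametric vertices). $f_k$ is the number of $k$-dimensional faces of $\mathcal{P}$; $\nu=\nu(A)=\max_{b'\in\mathbb{Q}^m}|\operatorname{vert}\{x:Ax\le b'\}|$. $O^*(\cdot)$ hides factors polynomial in the input bit-length.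
   Formalization: In all bounds f_{n_y-1} is replaced by max(1, f_{n_y-1}), and the factor n_y in the point-location bound by max(1, n_y); otherwise the claim fails, e.g. P={(x,y): x≤y} has f_0=0 but needs one chamber. *)

(* Defs.v *)
From HB Require Import structures.
From mathcomp Require Import all_boot all_order all_algebra.
From mathcomp Require Import finmap.
From mathcomp Require Import boolp classical_sets functions cardinality reals.

Set Implicit Arguments.
Unset Strict Implicit.
Unset Printing Implicit Defensive.

Import Order.TTheory GRing.Theory Num.Theory.

Local Open Scope ring_scope.
Local Open Scope classical_set_scope.

(** * Polyhedra in R^n *)

Definition polyhedron (R : realType) (k n : nat)
    (G : 'M[R]_(k, n)) (g : 'cV[R]_k) : set 'cV[R]_n :=
  [set x | forall i, (G *m x) i 0 <= g i 0].

Definition rational_polyhedron (R : realType) (n : nat) (Q : set 'cV[R]_n) :=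
  exists (k : nat) (G : 'M[rat]_(k, n)) (g : 'cV[rat]_k),
    Q = polyhedron (map_mx ratr G) (map_mx ratr g).

(* Taking c = 0 shows that the empty set and X itself are faces of X. *)
Definition face (R : realType) (n : nat) (X F : set 'cV[R]_n) :=
  exists (c : 'rV[R]_n) (d : R),
    (forall x, X x -> (c *m x) 0 0 <= d) /\
    F = [set x | X x /\ (c *m x) 0 0 = d].

Definition faces (R : realType) (n : nat) (X : set 'cV[R]_n) :
    set (set 'cV[R]_n) :=
  [set F | face X F].

Definition vert (R : realType) (n : nat) (X : set 'cV[R]_n) : set 'cV[R]_n :=
  [set v | face X [set v]].

Definition aff_indep (R : realType) (n k : nat) (p : 'M[R]_(n, k)) : bool :=
  \rank (col_mx p (const_mx 1 : 'rV[R]_k)) == k.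

(* dim X = d, where k = d + 1 is the largest number of affinely independent
   points of X; in particular the empty set has dimension -1. *)
Definition has_dim (R : realType) (n : nat) (X : set 'cV[R]_n) (d : int) :=
  exists k : nat,
    [/\ d = k%:Z - 1,
        exists2 p : 'M[R]_(n, k), (forall j, X (col j p)) & aff_indep p
      & forall p : 'M[R]_(n, k.+1), (forall j, X (col j p)) -> ~~ aff_indep p].

Definition aff_hull (R : realType) (n : nat) (X : set 'cV[R]_n) :
    set 'cV[R]_n :=
  [set z | exists (k : nat) (p : 'M[R]_(n, k)) (w : 'cV[R]_k),
    [/\ forall j, X (col j p), \sum_j w j 0 = 1 & z = p *m w]].

Definition relint (R : realType) (n : nat) (X : set 'cV[R]_n) : set 'cV[R]_n :=
  [set x | X x /\ exists2 e : R, 0 < e &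
    forall z, aff_hull X z -> (forall i, `|z i 0 - x i 0| < e) -> X z].

(* Isomorphism of face lattices. *)
Definition same_combinatorial_type (R : realType) (n : nat)
    (X Y : set 'cV[R]_n) :=
  exists phi : set 'cV[R]_n -> set 'cV[R]_n,
    set_bij (faces X) (faces Y) phi /\
    forall F G, face X F -> face X G -> (F `<=` G <-> phi F `<=` phi G).

Definition nfaces (R : realType) (n : nat) (X : set 'cV[R]_n) (d : int) : nat :=
  #|` fset_set [set F | face X F /\ has_dim F d]|%fset.

Definition nvert (R : realType) (n : nat) (X : set 'cV[R]_n) : nat :=
  #|` fset_set (vert X)|%fset.

(** * The parametric polyhedron A x <= b + B y *)

Definition intmx (R : realType) (m n : nat) (A : 'M[int]_(m, n)) :
    'M[R]_(m, n) := map_mx intr A.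
Definition ratmx (R : realType) (m n : nat) (B : 'M[rat]_(m, n)) :
    'M[R]_(m, n) := map_mx ratr B.
Arguments intmx R {m n} A.
Arguments ratmx R {m n} B.

Definition param_poly (R : realType) (m nx ny : nat) (A : 'M[int]_(m, nx))
    (B : 'M[rat]_(m, ny)) (b : 'cV[rat]_m) : set 'cV[R]_(nx + ny) :=
  [set z | forall i, (intmx R A *m usubmx z) i 0
                     <= (ratmx R b + ratmx R B *m dsubmx z) i 0].
Arguments param_poly R {m nx ny} A B b.

Definition fiber (R : realType) (nx ny : nat) (P : set 'cV[R]_(nx + ny))
    (y : 'cV[R]_ny) : set 'cV[R]_nx :=
  [set x | P (col_mx x y)].

Definition proj_y (R : realType) (nx ny : nat) (P : set 'cV[R]_(nx + ny)) :
    set 'cV[R]_ny :=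
  @dsubmx R nx ny 1 @` P.

(* nu(A), the maximum over rational right-hand sides *)
Definition nu (R : realType) (m nx : nat) (A : 'M[int]_(m, nx)) : nat :=
  xget 0%N [set v |
    (exists b' : 'cV[rat]_m, nvert (polyhedron (intmx R A) (ratmx R b')) = v) /\
    (forall b' : 'cV[rat]_m,
       (nvert (polyhedron (intmx R A) (ratmx R b')) <= v)%N)].
Arguments nu R {m nx} A.

Definition tight (R : realType) (m nx ny : nat) (A : 'M[int]_(m, nx))
    (B : 'M[rat]_(m, ny)) (b : 'cV[rat]_m) (F : set 'cV[R]_(nx + ny))
    (i : 'I_m) :=
  forall z, F z -> (intmx R A *m usubmx z) i 0
                   = (ratmx R b + ratmx R B *m dsubmx z) i 0.

(* L enumerates without repetition, in any order, the d-dimensional faces of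
   the polyhedron; the entry of a face lists, in any order, the indices of the
   inequalities that hold with equality on that face. *)
Definition lists_faces (R : realType) (m nx ny : nat) (A : 'M[int]_(m, nx))
    (B : 'M[rat]_(m, ny)) (b : 'cV[rat]_m) (d : int) (L : seq (seq 'I_m)) :=
  [/\ all uniq L,
      uniq [seq [set:: l]%SET | l <- L]
    & forall J : {set 'I_m}, J \in [seq [set:: l]%SET | l <- L] <->
        exists F, [/\ face (param_poly R A B b) F, has_dim F d
                    & forall i, i \in J <-> tight A B b F i]].
Arguments lists_faces R {m nx ny} A B b d L.

(* M_J, the rows of M indexed by J in increasing order; meaningful only when
   #|J| = k (conform_mx returns 0 otherwise). *)
Definition subrows (R : realType) (m n k : nat) (M : 'M[R]_(m, n))
    (J : {set 'I_m}) : 'M[R]_(k, n) :=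
  conform_mx 0 (rowsub (fun i : 'I_#|J| => enum_val i) M).
Arguments subrows {R m n} k M J.

Definition is_base (R : realType) (m nx : nat) (A : 'M[int]_(m, nx))
    (J : {set 'I_m}) : bool :=
  (#|J| == nx) && (subrows nx (intmx R A) J \in unitmx).
Arguments is_base R {m nx} A J.

Definition base_point (R : realType) (m nx ny : nat) (A : 'M[int]_(m, nx))
    (B : 'M[rat]_(m, ny)) (b : 'cV[rat]_m) (J : {set 'I_m}) (y : 'cV[R]_ny) :
    'cV[R]_nx :=
  invmx (subrows nx (intmx R A) J) *m
    (subrows nx (ratmx R b) J + subrows nx (ratmx R B) J *m y).

Definition chamber_decomposition (R : realType) (m nx ny : nat)
    (A : 'M[int]_(m, nx)) (B : 'M[rat]_(m, ny)) (b : 'cV[rat]_m)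
    (N : nat) (Q : 'I_N -> set 'cV[R]_ny) (base : 'I_N -> {set {set 'I_m}}) :=
  let P := param_poly R A B b in
  [/\ forall i, rational_polyhedron (Q i),
      forall i j, i != j -> relint (Q i) `&` relint (Q j) = set0,
      forall y, proj_y P y -> exists i, relint (Q i) y,
      forall i y y', relint (Q i) y -> relint (Q i) y' ->
        same_combinatorial_type (fiber P y) (fiber P y')
    & forall i,
        (forall J, J \in base i -> is_base R A J) /\
        (forall y, relint (Q i) y ->
           vert (fiber P y) =
             [set x | exists2 J, J \in base i & x = base_point A B b J y])].

(** * A real RAM

   The machine has two memories, one holding natural numbers (counters and
   addresses) and one holding real numbers; each is split into arrays numbered
   by nat.  A program names arrays by constants and computes the indices of cells.
   There is no conversion from reals to naturals.  Every arithmetic operation, memory access, test and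
   assignment has unit cost. *)

Inductive nexp :=
  | NConst of nat
  | NGet of nat & nexp
  | NAdd of nexp & nexp
  | NSub of nexp & nexp
  | NMul of nexp & nexp.

Inductive rexp :=
  | RNat of nexp
  | RGet of nat & nexp
  | RAdd of rexp & rexp
  | RSub of rexp & rexp
  | RMul of rexp & rexp
  | RDiv of rexp & rexp.

Inductive bexp :=
  | BNle of nexp & nexp
  | BRle of rexp & rexp
  | BNot of bexp
  | BAnd of bexp & bexp.

Inductive cmd :=
  | Skip
  | NSet of nat & nexp & nexp
  | RSet of nat & nexp & rexp
  | Seq of cmd & cmd
  | If of bexp & cmd & cmd
  | While of bexp & cmd.

Record state (R : realType) := State {
  nmem : nat -> nat -> nat;
  rmem : nat -> nat -> R
}.

Fixpoint neval (R : realType) (s : state R) (e : nexp) : nat :=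
  match e with
  | NConst c => c
  | NGet a i => nmem s a (neval s i)
  | NAdd e1 e2 => (neval s e1 + neval s e2)%N
  | NSub e1 e2 => (neval s e1 - neval s e2)%N
  | NMul e1 e2 => (neval s e1 * neval s e2)%N
  end.

Fixpoint reval (R : realType) (s : state R) (e : rexp) : R :=
  match e with
  | RNat i => (neval s i)%:R
  | RGet a i => rmem s a (neval s i)
  | RAdd e1 e2 => reval s e1 + reval s e2
  | RSub e1 e2 => reval s e1 - reval s e2
  | RMul e1 e2 => reval s e1 * reval s e2
  | RDiv e1 e2 => reval s e1 / reval s e2
  end.

Fixpoint beval (R : realType) (s : state R) (e : bexp) : bool :=
  match e with
  | BNle e1 e2 => (neval s e1 <= neval s e2)%N
  | BRle e1 e2 => reval s e1 <= reval s e2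
  | BNot e1 => ~~ beval s e1
  | BAnd e1 e2 => beval s e1 && beval s e2
  end.

Fixpoint ncost (e : nexp) : nat :=
  match e with
  | NConst _ => 1
  | NGet _ i => (ncost i).+1
  | NAdd e1 e2 | NSub e1 e2 | NMul e1 e2 => (ncost e1 + ncost e2).+1
  end.

Fixpoint rcost (e : rexp) : nat :=
  match e with
  | RNat i | RGet _ i => (ncost i).+1
  | RAdd e1 e2 | RSub e1 e2 | RMul e1 e2 | RDiv e1 e2 =>
      (rcost e1 + rcost e2).+1
  end.

Fixpoint bcost (e : bexp) : nat :=
  match e with
  | BNle e1 e2 => (ncost e1 + ncost e2).+1
  | BRle e1 e2 => (rcost e1 + rcost e2).+1
  | BNot e1 => (bcost e1).+1
  | BAnd e1 e2 => (bcost e1 + bcost e2).+1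
  end.

Definition upd (T : Type) (mem : nat -> nat -> T) (a i : nat) (v : T) :
    nat -> nat -> T :=
  fun a' i' => if (a' == a) && (i' == i) then v else mem a' i'.

(* exec c s s' t: from s, c terminates in s' after t steps. *)
Inductive exec (R : realType) : cmd -> state R -> state R -> nat -> Prop :=
  | exec_skip s : exec Skip s s 1
  | exec_nset s a i e :
      exec (NSet a i e) s
        (State (upd (nmem s) a (neval s i) (neval s e)) (rmem s))
        (ncost i + ncost e).+1
  | exec_rset s a i e :
      exec (RSet a i e) s
        (State (nmem s) (upd (rmem s) a (neval s i) (reval s e)))
        (ncost i + rcost e).+1
  | exec_seq c1 c2 s s1 s2 t1 t2 :
      exec c1 s s1 t1 -> exec c2 s1 s2 t2 -> exec (Seq c1 c2) s s2 (t1 + t2)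
  | exec_if e c1 c2 s s1 t :
      exec (if beval s e then c1 else c2) s s1 t ->
      exec (If e c1 c2) s s1 (bcost e + t)
  | exec_while_stop e c s :
      ~~ beval s e -> exec (While e c) s s (bcost e)
  | exec_while_step e c s s1 s2 t1 t2 :
      beval s e -> exec c s s1 t1 -> exec (While e c) s1 s2 t2 ->
      exec (While e c) s s2 (bcost e + t1 + t2).

(** * Input and output conventions *)

(* row-major order *)
Definition mxseq (T : Type) (m n : nat) (M : 'M[T]_(m, n)) : seq T :=
  [seq M i j | i <- enum 'I_m, j <- enum 'I_n].

Definition enc_lists (m : nat) (L : seq (seq 'I_m)) : seq nat :=
  flatten [seq size l :: map val l | l <- L].

(* L is the list of n_y-dimensional faces, L' that of (n_y - 1)-dimensional
   ones.  All cells not set here initially contain 0. *)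
Definition input_state (R : realType) (m nx ny : nat) (A : 'M[int]_(m, nx))
    (B : 'M[rat]_(m, ny)) (b : 'cV[rat]_m) (L L' : seq (seq 'I_m)) : state R :=
  State
    (fun a i => match a with
       | 0 => nth 0%N [:: m; nx; ny; size L; size L'] i
       | 1 => nth 0%N (enc_lists L) i
       | 2 => nth 0%N (enc_lists L') i
       | _ => 0%N
       end)
    (fun a i => match a with
       | 0 => nth 0 (mxseq (intmx R A)) i
       | 1 => nth 0 (mxseq (ratmx R B)) i
       | 2 => nth 0 (mxseq (ratmx R b)) i
       | _ => 0
       end).
Arguments input_state R {m nx ny} A B b L L'.

(* A chamber as it is output: the polyhedron G y <= g and a list of bases. *)
Record chamber (m ny : nat) := Chamber {
  ch_size : nat;
  ch_G : 'M[rat]_(ch_size, ny);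
  ch_g : 'cV[rat]_ch_size;
  ch_bases : seq {set 'I_m}
}.

Definition chamber_set (R : realType) (m ny : nat) (c : chamber m ny) :
    set 'cV[R]_ny :=
  polyhedron (ratmx R (ch_G c)) (ratmx R (ch_g c)).
Arguments chamber_set R {m ny} c.

Definition chamber_base (m ny : nat) (c : chamber m ny) : {set {set 'I_m}} :=
  [set:: ch_bases c]%SET.

(* The coefficients (A_J^-1 B_J | A_J^-1 b_J) of the parametric vertex
   y |-> A_J^-1 (b_J + B_J y). *)
Definition param_vertex (R : realType) (m nx ny : nat) (A : 'M[int]_(m, nx))
    (B : 'M[rat]_(m, ny)) (b : 'cV[rat]_m) (J : {set 'I_m}) :
    'M[R]_(nx, ny + 1) :=
  invmx (subrows nx (intmx R A) J) *m
    row_mx (subrows nx (ratmx R B) J) (subrows nx (ratmx R b) J).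
Arguments param_vertex R {m nx ny} A B b J.

Definition stores (T : Type) (arr : nat -> T) (l : seq T) :=
  forall x0 i, (i < size l)%N -> arr i = nth x0 l i.

(* Array 3 of the nat memory holds the number of chambers and, for each of
   them, the number of inequalities, the number of bases and the indices
   forming each base; array 4 of the real memory holds, for each chamber, its
   inequalities (G | g) and the coefficients of its parametric vertices. *)
Definition outputs (R : realType) (m nx ny : nat) (A : 'M[int]_(m, nx))
    (B : 'M[rat]_(m, ny)) (b : 'cV[rat]_m) (s : state R)
    (N : nat) (D : 'I_N -> chamber m ny) :=
  [/\ forall i, uniq (ch_bases (D i)),
      stores (nmem s 3%N)
        (N :: flatten [seq
           [:: ch_size (D i), size (ch_bases (D i)) &
              flatten [seq map val (enum J) | J : {set 'I_m} <- ch_bases (D i)]]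
           | i <- enum 'I_N])
    & stores (rmem s 4%N)
        (flatten [seq
           mxseq (row_mx (ratmx R (ch_G (D i))) (ratmx R (ch_g (D i)))) ++
             flatten [seq mxseq (param_vertex R A B b J) | J <- ch_bases (D i)]
           | i <- enum 'I_N])].

(* A query point is passed in array 3 of the real memory, the index of the
   chamber found is returned in cell 0 of array 4 of the nat memory. *)
Definition load_query (R : realType) (ny : nat) (s : state R) (y : 'cV[R]_ny) :
    state R :=
  State (nmem s)
    (fun a i => if a == 3%N then nth 0 (mxseq y) i else rmem s a i).

Definition query_result (R : realType) (s : state R) : nat := nmem s 4%N 0%N.

(** * Input bit-length *)

(* up_log 2 n is the rounded-up binary logarithm of n. *)
Definition bits_int (z : int) : nat := (1 + up_log 2 (`|z|%N + 1))%N.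
Definition bits_rat (r : rat) : nat :=
  (1 + up_log 2 (`|numq r|%N + 1) + up_log 2 (`|denq r|%N + 1))%N.

Definition bitlen (m nx ny : nat) (A : 'M[int]_(m, nx)) (B : 'M[rat]_(m, ny))
    (b : 'cV[rat]_m) : nat :=
  (\sum_i \sum_j bits_int (A i j) + \sum_i \sum_j bits_rat (B i j)
   + \sum_i \sum_j bits_rat (b i j))%N.

(* Main.v *)
Require Import Defs.
From HB Require Import structures.
From mathcomp Require Import all_boot all_order all_algebra.
From mathcomp Require Import boolp classical_sets functions cardinality reals.
From mathcomp Require Import zify ring lra fintype finset.

(**
  The parametric vertices of P_y are the graphs over y of the n_y-dimensional faces of P, and the
  feasibility of such a graph can only change across the projection of an (n_y - 1)-dimensional
  face.  Each projection of dimension n_y - 1 spans a hyperplane, found by eliminating x from the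
  equalities of the face; the chambers are the cells of the arrangement of these at most
  f_{n_y - 1} hyperplanes, so the zero sets, hence the tight constraints and the face lattice of
  P_y, are constant on a relatively open cell.  Every cell is reached by at most n_y choices of a
  hyperplane and a sign (stay on it, or move slightly to one of its sides), which gives
  (3 f_{n_y - 1})^{n_y} candidate points; repetitions are detected with a trie of sign vectors,
  which also answers the point location queries.  The number of cells of an arrangement is bounded
  by the usual recursion T(f + 1, n + 1) = T(f, n + 1) + 2 T(f, n).
*)

Set Implicit Arguments.
Unset Strict Implicit.
Unset Printing Implicit Defensive.

Import Order.TTheory GRing.Theory Num.Theory.

Local Open Scope ring_scope.

(** * Reasoning about programs *)

(** The delicate point is that feasibility of a parametric vertex must be constant on a cell. Along
    an arbitrary segment several residuals may vanish together, and their common zero then belongs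
    to a face of dimension below n_y - 1, about which the input says nothing. The start of the
    segment is therefore perturbed until residuals that vanish together at the first crossing are
    proportional; the tight set there is that of a face of dimension exactly n_y - 1. The same
    crossing argument, applied inside a flat, shows that no cell is missed: the boundary of a cell
    can be reached through a single hyperplane. Degenerate vertices raise the analogous issue for
    n_y-dimensional faces and are treated with a generic direction in parameter space.

    The cells cover the whole parameter space; over a cell outside the projection of P the list of
    bases is empty. A cell is written only when its sign vector is new, so the n_y-dimensional faces
    are charged per cell and the hyperplanes per candidate. The recursion bounds the number of all
    cells by 3 f^(n_y). *)

Section Framework.
Variable R : realType.
Implicit Types (s : state R) (Q : state R -> nat -> Prop).

Definition setn s a i v : state R := State (upd (nmem s) a i v) (rmem s).
Definition setr s a i v : state R := State (nmem s) (upd (rmem s) a i v).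

(** Total correctness with cost: termination and the step count belong to the judgement.
    Postconditions are nested as continuations, so a proof about a sequence of commands executes the
    program forwards from a known state. *)
Definition ht c s Q := exists s' t, exec c s s' t /\ Q s' t.

Lemma ht_mono c s Q Q' : (forall s' t, Q s' t -> Q' s' t) -> ht c s Q -> ht c s Q'.
Proof. by move=> h [s' [t [e q]]]; exists s', t; split => //; apply: h. Qed.

Lemma ht_skip s Q : Q s 1%N -> ht Skip s Q.
Proof. by move=> q; exists s, 1%N; split => //; constructor. Qed.

Lemma ht_nset s a i e Q :
  Q (setn s a (neval s i) (neval s e)) (ncost i + ncost e).+1 -> ht (NSet a i e) s Q.
Proof. by move=> q; eexists; eexists; split; [constructor|exact: q]. Qed.

Lemma ht_rset s a i e Q :
  Q (setr s a (neval s i) (reval s e)) (ncost i + rcost e).+1 -> ht (RSet a i e) s Q.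
Proof. by move=> q; eexists; eexists; split; [constructor|exact: q]. Qed.

Lemma ht_seq c1 c2 s Q :
  ht c1 s (fun s1 t1 => ht c2 s1 (fun s2 t2 => Q s2 (t1 + t2)%N)) -> ht (Seq c1 c2) s Q.
Proof.
move=> [s1 [t1 [e1 [s2 [t2 [e2 q]]]]]]; exists s2, (t1 + t2)%N; split => //.
exact: exec_seq e1 e2.
Qed.

Lemma ht_if e c1 c2 s Q :
  ht (if beval s e then c1 else c2) s (fun s' t => Q s' (bcost e + t)%N) ->
  ht (If e c1 c2) s Q.
Proof.
move=> [s' [t [ex q]]]; exists s', (bcost e + t)%N; split => //.
exact: exec_if.
Qed.

Definition gv x := NGet x (NConst 0).

(** The bound [e] is evaluated again before every pass, so the rules below ask the invariant to fix
    its value; the body has to leave the counter [i] as it found it. *)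
Definition For i e c :=
  Seq (NSet i (NConst 0) (NConst 0))
    (While (BNle (NAdd (gv i) (NConst 1)) e)
       (Seq c (NSet i (NConst 0) (NAdd (gv i) (NConst 1))))).

(** The test costs [ncost e + 5] and the increment 6, whence [ncost e + 11] per pass; the last test
    and the initial assignment of cost 3 give [ncost e + 8]. Time is an argument of the invariant,
    which permits amortised bounds. *)
Lemma ht_for i e c s0 n (J : nat -> state R -> nat -> Prop) Q :
  J 0%N (setn s0 i 0 0) 0%N ->
  (forall k s t, J k s t -> neval s e = n) ->
  (forall k s t, (k < n)%N -> J k s t -> nmem s i 0%N = k ->
     ht c s (fun s1 t1 => nmem s1 i 0%N = k /\
       J k.+1 (setn s1 i 0 k.+1) (t + t1 + (ncost e + 11))%N)) ->
  (forall s t, J n s t -> nmem s i 0%N = n -> Q s (t + (ncost e + 8))%N) ->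
  ht (For i e c) s0 Q.
Proof.
move=> J0 Jn Jc JQ; apply: ht_seq; apply: ht_nset => /=.
have H d : forall k s t, (k + d = n)%N -> J k s t -> nmem s i 0%N = k ->
  ht (While (BNle (NAdd (gv i) (NConst 1)) e)
       (Seq c (NSet i (NConst 0) (NAdd (gv i) (NConst 1))))) s
    (fun s' t' => Q s' (t + t' + 3)%N).
  elim: d => [|d IH] k s t kd Jk ik.
    exists s, (bcost (BNle (NAdd (gv i) (NConst 1)) e)); split.
      apply: exec_while_stop; rewrite /= ik (Jn _ _ _ Jk); lia.
    have -> : (t + bcost (BNle (NAdd (gv i) (NConst 1)) e) + 3 = t + (ncost e + 8))%N.
      by rewrite /=; lia.
    rewrite addn0 in kd; rewrite kd in Jk ik.
    exact: JQ.
  have kn : (k < n)%N by lia.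
  have [s1 [t1 [e1 [i1 J1]]]] := Jc _ _ _ kn Jk ik.
  have [||s2 [t2 [e2 q]]] := IH k.+1 _ _ _ J1; first by lia.
    by rewrite /= /upd !eqxx.
  exists s2, (bcost (BNle (NAdd (gv i) (NConst 1)) e) + (t1 + 6) + t2)%N; split.
    apply: (exec_while_step (s1 := setn s1 i 0 k.+1)) e2.
      by rewrite /= ik (Jn _ _ _ Jk); lia.
    apply: exec_seq e1 _.
    have := exec_nset s1 i (NConst 0) (NAdd (gv i) (NConst 1)).
    by rewrite /= i1 addn1.
  by move: q; congr Q; rewrite /=; lia.
have := H n 0%N (setn s0 i 0 0) 0%N erefl J0.
rewrite /= /upd !eqxx => /(_ erefl); apply: ht_mono => s' t.
by congr Q; lia.
Qed.

Lemma ht_forT i e c s0 n T (J : nat -> state R -> Prop) Q :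
  J 0%N (setn s0 i 0 0) ->
  (forall k s, J k s -> neval s e = n) ->
  (forall k s, (k < n)%N -> J k s -> nmem s i 0%N = k ->
     ht c s (fun s1 t1 => [/\ (t1 <= T)%N, nmem s1 i 0%N = k &
       J k.+1 (setn s1 i 0 k.+1)])) ->
  (forall s t, J n s -> nmem s i 0%N = n ->
     (t <= n * (T + ncost e + 11) + (ncost e + 8))%N -> Q s t) ->
  ht (For i e c) s0 Q.
Proof.
move=> J0 Jn Jc JQ.
apply: (@ht_for _ _ _ _ n (fun k s t => J k s /\ (t <= k * (T + ncost e + 11))%N)) => //.
- by move=> k s t [/Jn].
- move=> k s t kn [Jk tk] ik; apply: ht_mono (Jc _ _ kn Jk ik) => s1 t1 [t1T i1 J1].
  by split => //; split => //; rewrite mulSn; lia.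
- by move=> s t [Jk tk] ik; apply: JQ => //; lia.
Qed.

(** Programs name arrays by constants, so separation is by array number: [ns] and [rs] list the
    arrays of naturals and of reals that may change. *)
Definition frame (ns rs : seq nat) s s' :=
  (forall a, a \notin ns -> nmem s' a = nmem s a) /\
  (forall a, a \notin rs -> rmem s' a = rmem s a).

Lemma frame_trans ns rs s1 s2 s3 :
  frame ns rs s1 s2 -> frame ns rs s2 s3 -> frame ns rs s1 s3.
Proof.
move=> [n1 r1] [n2 r2]; split => a h; first by rewrite n2 // n1.
by rewrite r2 // r1.
Qed.

Lemma frame_sub ns rs ns' rs' s s' :
  all (mem ns') ns -> all (mem rs') rs -> frame ns rs s s' -> frame ns' rs' s s'.
Proof.
move=> /allP hn /allP hr [n r]; split => a h.
  by apply: n; apply: contra h => /hn.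
by apply: r; apply: contra h => /hr.
Qed.

Lemma frame_setn ns rs s s' a i v :
  a \in ns -> frame ns rs s s' -> frame ns rs s (setn s' a i v).
Proof.
move=> an [n r]; split => // a' h; rewrite -n //=.
by apply/funext => j; rewrite /upd; case: eqP => // E; rewrite E an in h.
Qed.

Lemma frame_setr ns rs s s' a i v :
  a \in rs -> frame ns rs s s' -> frame ns rs s (setr s' a i v).
Proof.
move=> an [n r]; split => // a' h; rewrite -r //=.
by apply/funext => j; rewrite /upd; case: eqP => // E; rewrite E an in h.
Qed.

(** The obligation for pass [k] hands over the fact that cells not yet written keep their initial
    contents, because some loops compute in place from the array that they fill. *)
Lemma ht_fillr ci e a pos x s n b0 (f : nat -> R) Q :
  (forall s', frame [:: ci] [:: a] s s' -> neval s' e = n) ->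
  (forall s' k, (k < n)%N -> frame [:: ci] [:: a] s s' -> nmem s' ci 0%N = k ->
     (forall j, (j < b0)%N || (b0 + k <= j)%N -> rmem s' a j = rmem s a j) ->
     neval s' pos = (b0 + k)%N /\ reval s' x = f k) ->
  (forall s' t, frame [:: ci] [:: a] s s' ->
     (forall k, (k < n)%N -> rmem s' a (b0 + k)%N = f k) ->
     (forall j, (j < b0)%N || (b0 + n <= j)%N -> rmem s' a j = rmem s a j) ->
     (t <= n * (ncost e + ncost pos + rcost x + 12) + (ncost e + 8))%N -> Q s' t) ->
  ht (For ci e (RSet a pos x)) s Q.
Proof.
move=> he hb hQ.
apply: (@ht_forT _ _ _ _ n (ncost pos + rcost x).+1 (fun k s' => [/\ frame [:: ci] [:: a] s s',
  forall j, (j < k)%N -> rmem s' a (b0 + j)%N = f j &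
  forall j, (j < b0)%N || (b0 + k <= j)%N -> rmem s' a j = rmem s a j])).
- by split => //; apply: frame_setn; rewrite ?inE.
- by move=> k s' [/he].
- move=> k s' kn [fr h1 h2] ik; apply: ht_rset.
  have [pe xe] := hb _ _ kn fr ik h2.
  split => //; split.
  + by apply: frame_setn; rewrite ?inE //; apply: frame_setr; rewrite ?inE.
  + move=> j; rewrite ltnS leq_eqVlt => /orP[/eqP->|jk] /=.
      by rewrite /upd eqxx pe eqxx xe.
    by rewrite /upd eqxx pe eqn_add2l ltn_eqF //= h1.
  + move=> j hj /=; rewrite /upd eqxx pe /=.
    have -> : (j == b0 + k)%N = false by lia.
    by apply: h2; lia.
- move=> s' t [fr h1 h2] _ ht'; apply: hQ => //.
  by apply: leq_trans ht' _; rewrite leq_add2r leq_mul2l; lia.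
Qed.

Lemma ht_filln ci e a pos x s n b0 (f : nat -> nat) Q :
  ci != a ->
  (forall s', frame [:: ci; a] [::] s s' -> neval s' e = n) ->
  (forall s' k, (k < n)%N -> frame [:: ci; a] [::] s s' -> nmem s' ci 0%N = k ->
     (forall j, (j < b0)%N || (b0 + k <= j)%N -> nmem s' a j = nmem s a j) ->
     neval s' pos = (b0 + k)%N /\ neval s' x = f k) ->
  (forall s' t, frame [:: ci; a] [::] s s' ->
     (forall k, (k < n)%N -> nmem s' a (b0 + k)%N = f k) ->
     (forall j, (j < b0)%N || (b0 + n <= j)%N -> nmem s' a j = nmem s a j) ->
     (t <= n * (ncost e + ncost pos + ncost x + 12) + (ncost e + 8))%N -> Q s' t) ->
  ht (For ci e (NSet a pos x)) s Q.
Proof.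
move=> cia he hb hQ.
apply: (@ht_forT _ _ _ _ n (ncost pos + ncost x).+1 (fun k s' => [/\ frame [:: ci; a] [::] s s',
  forall j, (j < k)%N -> nmem s' a (b0 + j)%N = f j &
  forall j, (j < b0)%N || (b0 + k <= j)%N -> nmem s' a j = nmem s a j])).
- split => //; first by apply: frame_setn; rewrite ?inE ?eqxx.
  by move=> j _; rewrite /= /upd eq_sym (negbTE cia).
- by move=> k s' [/he].
- move=> k s' kn [fr h1 h2] ik; apply: ht_nset.
  have [pe xe] := hb _ _ kn fr ik h2.
  split => //; first by rewrite /= /upd (negbTE cia).
  split.
  + by apply: frame_setn; rewrite ?inE ?eqxx //; apply: frame_setn; rewrite ?inE ?eqxx ?orbT.
  + move=> j; rewrite ltnS leq_eqVlt => /orP[/eqP->|jk] /=.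
      by rewrite /upd eq_sym (negbTE cia) /= eqxx pe eqxx xe.
    by rewrite /upd eq_sym (negbTE cia) /= eqxx pe eqn_add2l ltn_eqF //= h1.
  + move=> j hj /=; rewrite /upd eq_sym (negbTE cia) /= eqxx pe /=.
    have -> : (j == b0 + k)%N = false by lia.
    by apply: h2; lia.
- move=> s' t [fr h1 h2] _ ht'; apply: hQ => //.
  by apply: leq_trans ht' _; rewrite leq_add2r leq_mul2l; lia.
Qed.

(** Only the current cell is promised to be intact. This is what an in-place matrix update needs
    when its other operands are kept in other arrays. *)
Lemma ht_fill2 ci ck e1 e2 a pos x s n1 n2 b0 (f : nat -> nat -> R) Q :
  ci != ck ->
  (forall s', frame [:: ci; ck] [:: a] s s' -> neval s' e1 = n1) ->
  (forall s', frame [:: ci; ck] [:: a] s s' -> neval s' e2 = n2) ->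
  (forall s' i k, (i < n1)%N -> (k < n2)%N -> frame [:: ci; ck] [:: a] s s' ->
     nmem s' ci 0%N = i -> nmem s' ck 0%N = k ->
     rmem s' a (b0 + i * n2 + k)%N = rmem s a (b0 + i * n2 + k)%N ->
     neval s' pos = (b0 + i * n2 + k)%N /\ reval s' x = f i k) ->
  (forall s' t, frame [:: ci; ck] [:: a] s s' ->
     (forall i k, (i < n1)%N -> (k < n2)%N -> rmem s' a (b0 + i * n2 + k)%N = f i k) ->
     (forall j, (j < b0)%N || (b0 + n1 * n2 <= j)%N -> rmem s' a j = rmem s a j) ->
     (t <= n1 * (n2 * (ncost e2 + ncost pos + rcost x + 12) + ncost e1 + ncost e2 + 19)
        + (ncost e1 + 8))%N -> Q s' t) ->
  ht (For ci e1 (For ck e2 (RSet a pos x))) s Q.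
Proof.
move=> cik he1 he2 hb hQ.
apply: (@ht_forT _ _ _ _ n1 (n2 * (ncost e2 + ncost pos + rcost x + 12) + (ncost e2 + 8))%N
  (fun i s' => [/\ frame [:: ci; ck] [:: a] s s',
  forall i' k, (i' < i)%N -> (k < n2)%N -> rmem s' a (b0 + i' * n2 + k)%N = f i' k &
  forall j, (j < b0)%N || (b0 + i * n2 <= j)%N -> rmem s' a j = rmem s a j])).
- by split => //; apply: frame_setn; rewrite ?inE ?eqxx.
- by move=> k s' [/he1].
- move=> i s' iN [fr h1 h2] ii.
  have sub u : frame [:: ck] [:: a] s' u -> frame [:: ci; ck] [:: a] s u.
    by move=> h; apply: frame_trans fr _; apply: frame_sub h; rewrite /= ?inE ?eqxx ?orbT.
  apply: (@ht_fillr _ _ _ _ _ _ n2 (b0 + i * n2) (f i)).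
  + by move=> u /sub /he2.
  + move=> u k kn fu ik hj; apply: hb => //; first exact: sub.
      by rewrite fu.1 // inE.
    by rewrite hj ?h2 //; lia.
  + move=> u t fu g1 g2 tt; split => //; first by rewrite fu.1 // inE.
    split; first by apply: frame_setn; rewrite ?inE ?eqxx //; apply: sub.
      move=> i' k; rewrite ltnS leq_eqVlt => /orP[/eqP->|i'i] kn /=; first exact: g1.
      rewrite g2 ?h1 //.
      have : (i'.+1 * n2 <= i * n2)%N by rewrite leq_mul2r i'i orbT.
      by rewrite mulSn; lia.
    move=> j hj /=; rewrite g2 ?h2 //; move: hj; rewrite mulSn; lia.
- move=> s' t [fr h1 h2] _ ht'; apply: hQ => //.
  by apply: leq_trans ht' _; rewrite leq_add2r leq_mul2l; lia.
Qed.

Definition Sum acc cs e x :=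
  Seq (RSet acc (NConst 0) (RNat (NConst 0)))
    (For cs e (RSet acc (NConst 0) (RAdd (RGet acc (NConst 0)) x))).

Lemma ht_sum acc cs e x s n (f : nat -> R) Q :
  (forall s', frame [:: cs] [:: acc] s s' -> neval s' e = n) ->
  (forall s' k, (k < n)%N -> frame [:: cs] [:: acc] s s' -> nmem s' cs 0%N = k ->
     reval s' x = f k) ->
  (forall s' t, frame [:: cs] [:: acc] s s' -> rmem s' acc 0%N = \sum_(0 <= k < n) f k ->
     (t <= n * (ncost e + rcost x + 16) + (ncost e + 12))%N -> Q s' t) ->
  ht (Sum acc cs e x) s Q.
Proof.
move=> he hx hQ; apply: ht_seq; apply: ht_rset => /=.
apply: (@ht_forT _ _ _ _ n (rcost x + 5)%N (fun k s' => frame [:: cs] [:: acc] s s' /\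
  rmem s' acc 0%N = \sum_(0 <= i < k) f i)).
- split; last by rewrite /= /upd !eqxx big_geq.
  by apply: frame_setn; rewrite ?inE ?eqxx //; apply: frame_setr; rewrite ?inE.
- by move=> k s' [/he].
- move=> k s' kn [fr hs] ik; apply: ht_rset; split => //=; first by lia.
  split; last by rewrite /= /upd !eqxx big_nat_recr //= hs (hx s' k).
  by apply: frame_setn; rewrite ?inE ?eqxx //; apply: frame_setr; rewrite ?inE.
- move=> s' t [fr hs] _ ht'; apply: hQ => //.
  have : (n * (rcost x + 5 + ncost e + 11) <= n * (ncost e + rcost x + 16))%N.
    by rewrite leq_mul2l; lia.
  lia.
Qed.

End Framework.

Ltac hset := first [apply: ht_nset | apply: ht_rset | apply: ht_skip]; cbv beta.
Ltac hseq := apply: ht_seq.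

(** * Elimination of one equation *)

Notation "a ;; b" := (Seq a b) (at level 70, right associativity).

Notation cI := 10%N (only parsing).
Notation cK := 11%N (only parsing).
Notation cS := 12%N (only parsing).
Notation cQ := 13%N (only parsing).
Notation cT := 14%N (only parsing).
Notation cD := 15%N (only parsing).
Notation cJ := 16%N (only parsing).
Notation cU := 17%N (only parsing).
Notation vp := 20%N (only parsing).
Notation ve := 21%N (only parsing).
Notation vpv := 23%N (only parsing).
Notation vpc := 24%N (only parsing).
Notation rAcc := 10%N (only parsing).
Notation rFa := 20%N (only parsing).
Notation rFe := 21%N (only parsing).
Notation rV := 22%N (only parsing).
Notation rR := 23%N (only parsing).
Notation rU := 24%N (only parsing).

(** The array [rV] holds a matrix with [vp] rows and [vp + ve] columns, read as the affine solution
    set z = V_l t + V_r w of the equations treated so far: [t] is free and [w] stands for the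
    parameters on the right-hand side. Elimination of x uses w = (y, 1); flats in parameter space
    use w = 1. *)
Definition eW := NAdd (gv vp) (gv ve).
Definition eVik i k := RGet rV (NAdd (NMul (gv i) eW) k).

Definition Row : cmd :=
  For cK eW
    (Sum rAcc cS (gv vp) (RMul (RGet rFa (gv cS)) (eVik cS (gv cK))) ;;
     RSet rR (gv cK) (RGet rAcc (NConst 0))) ;;
  For cK (gv ve)
    (RSet rR (NAdd (gv vp) (gv cK))
       (RSub (RGet rR (NAdd (gv vp) (gv cK))) (RGet rFe (gv cK)))).

Definition BRzero x := BAnd (BRle x (RNat (NConst 0))) (BRle (RNat (NConst 0)) x).

Definition Pivot : cmd :=
  NSet vpv (NConst 0) (NConst 0) ;;
  For cK (gv vp)
    (If (BRzero (RGet rR (gv cK))) Skip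
       (NSet vpv (NConst 0) (NConst 1) ;; NSet vpc (NConst 0) (gv cK))).

(** The pivot column is overwritten while it is still needed, hence the scaled copy in [rU]. That
    copy is also the direction along which sample points are later moved off a hyperplane. *)
Definition Update : cmd :=
  For cK (gv vp) (RSet rU (gv cK) (RDiv (eVik cK (gv vpc)) (RGet rR (gv vpc)))) ;;
  For cU (gv vp)
    (For cK eW
      (RSet rV (NAdd (NMul (gv cU) eW) (gv cK))
         (RSub (eVik cU (gv cK)) (RMul (RGet rU (gv cU)) (RGet rR (gv cK)))))).

Definition Elim : cmd :=
  Row ;; Pivot ;; If (BNle (NConst 1) (gv vpv)) Update Skip.

Section Elim.
Variable R : realType.
Implicit Types (s : state R) (Q : state R -> nat -> Prop).

Definition marr p q (arr : nat -> R) : 'M[R]_(p, q) := \matrix_(i, j) arr (i * q + j)%N.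
Definition rarr q (arr : nat -> R) : 'rV[R]_q := \row_j arr j.
Definition carr q (arr : nat -> R) : 'cV[R]_q := \col_j arr j.

(** Substituting z = V_l t + V_r w into the equation a z = x w gives the row [rowm a x V], to be
    applied to (t, w). *)
Definition rowm p e (a : 'rV[R]_p) (x : 'rV[R]_e) (V : 'M[R]_(p, p + e)) : 'rV[R]_(p + e) :=
  a *m V - row_mx 0 x.

(** The choice of the pivot is left open, so nothing proved from this relation depends on it. The
    matrix keeps its shape and the pivot column of its left block becomes zero. If the substituted
    equation has no part in [t], nothing changes. *)
Definition elim_rel p e (a : 'rV[R]_p) (x : 'rV[R]_e) (V : 'M[R]_(p, p + e))
    (act : bool) (U : 'cV[R]_p) (V' : 'M[R]_(p, p + e)) :=
  let r := rowm a x V in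
  if act then exists c : 'I_p, [/\ r 0 (lshift e c) != 0,
     U = (r 0 (lshift e c))^-1 *: col (lshift e c) V & V' = V - U *m r]
  else (forall c, r 0 (lshift e c) = 0) /\ V' = V.

Lemma row_ok p e s :
  nmem s vp 0%N = p -> nmem s ve 0%N = e ->
  ht Row s (fun s' t => [/\ frame [:: cK; cS] [:: rAcc; rR] s s',
    (t <= 300 * (p + e).+1 ^ 2)%N &
    rarr (p + e) (rmem s' rR) =
      rowm (rarr p (rmem s rFa)) (rarr e (rmem s rFe)) (marr p (p + e) (rmem s rV))]).
Proof.
move=> hp he; pose f k := \sum_(0 <= i < p) rmem s rFa i * rmem s rV (i * (p + e) + k)%N.
apply: ht_seq.
apply: (@ht_forT _ _ _ _ _ (p + e) (p * 60 + 60) (fun k s' =>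
  frame [:: cK; cS] [:: rAcc; rR] s s' /\ forall j, (j < k)%N -> rmem s' rR j = f j)).
- by split => //; apply: frame_setn.
- by move=> k s' [fr _] /=; rewrite !fr.1 // hp he.
- move=> k s' kn [fr h] ik; apply: ht_seq.
  apply: (@ht_sum _ _ _ _ _ _ p (fun i => rmem s rFa i * rmem s rV (i * (p + e) + k)%N)).
  + by move=> u fu /=; rewrite fu.1 // fr.1.
  + move=> u i ip fu iu /=; rewrite iu !fu.1 ?fu.2 // ik !fr.1 ?fr.2 //.
    by rewrite hp he.
  + move=> u t fu hu tt; apply: ht_rset; split.
    * by move: tt; rewrite /=; lia.
    * by rewrite /= fu.1.
    split.
      apply: frame_setn => //; apply: frame_setr => //.
      by apply: frame_trans fr _; apply: frame_sub fu.
    move=> j; rewrite ltnS leq_eqVlt /= /upd /= !fu.1 // ik => /orP[/eqP->|jk].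
      by rewrite eqxx hu.
    by rewrite ltn_eqF //= fu.2 // h.
- move=> s1 t1 [fr h] _ tt1.
  apply: (@ht_fillr _ _ _ _ _ _ _ e p (fun k => f (p + k)%N - rmem s rFe k)).
  + by move=> u fu /=; rewrite fu.1 // fr.1.
  + move=> u k ke fu ik hj /=; rewrite ik fu.1 // fr.1 // hp; split => //.
    by rewrite hj ?h ?fu.2 ?fr.2 //; lia.
  + move=> u t fu g1 g2 tt; split.
    * by apply: frame_trans fr _; apply: frame_sub fu.
    * move: tt1 tt; rewrite /=; nia.
    apply/rowP => j; rewrite /rowm !mxE.
    have fE q : f q = \sum_(i < p) rmem s rFa i * rmem s rV (i * (p + e) + q)%N.
      by rewrite /f big_mkord.
    have E : \sum_(i < p) (rarr p (rmem s rFa)) 0 i * (marr p (p + e) (rmem s rV)) i j = f j.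
      by rewrite fE; apply: eq_bigr => i _; rewrite !mxE.
    rewrite E; case: (splitP j) => k jk; rewrite ?mxE jk.
      by rewrite subr0 g2 ?h //; case: k jk => /= *; lia.
    by rewrite g1.
Qed.

Lemma rzeroE s x : beval s (BRzero x) = (reval s x == 0).
Proof. by rewrite /= eq_le. Qed.

Lemma pivot_ok p e s :
  nmem s vp 0%N = p ->
  ht Pivot s (fun s' t => [/\ frame [:: cK; vpv; vpc] [::] s s',
    (t <= 300 * (p + e).+1)%N &
    (nmem s' vpv 0%N = 0%N /\ forall c, (c < p)%N -> rmem s rR c = 0) \/
    (nmem s' vpv 0%N = 1%N /\ (nmem s' vpc 0%N < p)%N /\ rmem s rR (nmem s' vpc 0%N) != 0)]).
Proof.
move=> hp; hseq; hset.
apply: (@ht_forT _ _ _ _ _ p 30 (fun k s' =>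
  frame [:: cK; vpv; vpc] [::] s s' /\ ((nmem s' vpv 0%N = 0%N /\ forall c, (c < k)%N -> rmem s rR c = 0) \/
   (nmem s' vpv 0%N = 1%N /\ (nmem s' vpc 0%N < p)%N /\ rmem s rR (nmem s' vpc 0%N) != 0)))).
- split; last by left.
  by apply: frame_setn => //; apply: frame_setn.
- by move=> k s' [fr _] /=; rewrite !fr.1.
- move=> k s' kp [fr h] ik; apply: ht_if; rewrite rzeroE /= ik fr.2 //.
  case: eqP => [r0|/eqP r0].
    apply: ht_skip; split => //; split; first by apply: frame_setn.
    case: h => [[pv h]|h]; [left|right => //]; split => // c; rewrite ltnS leq_eqVlt.
    by case/orP => [/eqP->|/h].
  hseq; hset; hset; split => //; split.
    by do 3!apply: frame_setn => //.
  by right; rewrite /= /upd /= ik.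
- move=> s' t [fr h] _ tt; split => //.
  by move: tt; rewrite /=; nia.
Qed.

Lemma update_ok p e s :
  nmem s vp 0%N = p -> nmem s ve 0%N = e -> (nmem s vpc 0%N < p)%N ->
  let c := nmem s vpc 0%N in
  ht Update s (fun s' t => [/\ frame [:: cK; cU] [:: rU; rV] s s',
    (t <= 300 * (p + e).+1 ^ 2)%N,
    (forall i, (i < p)%N -> rmem s' rU i = rmem s rV (i * (p + e) + c)%N / rmem s rR c) &
    forall i k, (i < p)%N -> (k < p + e)%N -> rmem s' rV (i * (p + e) + k)%N =
      rmem s rV (i * (p + e) + k)%N -
        rmem s rV (i * (p + e) + c)%N / rmem s rR c * rmem s rR k]).
Proof.
move=> hp he cp c; apply: ht_seq.
apply: (@ht_fillr _ _ _ _ _ _ _ p 0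
  (fun i => rmem s rV (i * (p + e) + c)%N / rmem s rR c)).
- by move=> u fu /=; rewrite !fu.1.
- move=> u k ke fu ik hj /=; rewrite ik !fu.1 // !fu.2 //.
  by rewrite hp he.
move=> s1 t1 fr g1 _ tt1.
apply: (@ht_fill2 _ _ _ _ _ _ _ _ _ p (p + e) 0 (fun i k =>
   rmem s rV (i * (p + e) + k)%N -
        rmem s rV (i * (p + e) + c)%N / rmem s rR c * rmem s rR k)) => //.
- by move=> u fu /=; rewrite !fu.1 // fr.1.
- by move=> u fu /=; rewrite !fu.1 // !fr.1 // hp he.
- move=> u i k ip kp fu ii ik hj /=; rewrite ii ik !fu.1 // !fr.1 // hp he; split => //.
  by move: hj; rewrite add0n => ->; rewrite !fu.2 // g1 // !fr.2.
move=> u t fu h1 _ tt; split => //.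
- apply: (@frame_trans _ _ _ _ s1); first by apply: frame_sub fr.
  by apply: frame_sub fu.
- move: tt1 tt; rewrite /=; nia.
- by move=> i ip; rewrite fu.2 // -(g1 i).
Qed.

Lemma elim_ok p e s :
  nmem s vp 0%N = p -> nmem s ve 0%N = e ->
  ht Elim s (fun s' t => [/\ frame [:: cK; cS; cU; vpv; vpc] [:: rAcc; rR; rU; rV] s s',
    (t <= 900 * (p + e).+1 ^ 2)%N,
    (nmem s' vpv 0%N <= 1)%N &
    elim_rel (rarr p (rmem s rFa)) (rarr e (rmem s rFe)) (marr p (p + e) (rmem s rV))
      (nmem s' vpv 0%N == 1%N) (carr p (rmem s' rU)) (marr p (p + e) (rmem s' rV))]).
Proof.
move=> hp he; apply: ht_seq; apply: ht_mono (row_ok hp he) => s1 t1 [f1 tt1 r1].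
apply: ht_seq; have hp1 : nmem s1 vp 0%N = p by rewrite f1.1.
apply: ht_mono (pivot_ok e hp1) => s2 t2 [f2 tt2 r2].
have f12 : frame [:: cK; cS; cU; vpv; vpc] [:: rAcc; rR; rU; rV] s s2.
  by apply: (@frame_trans _ _ _ _ s1); [apply: frame_sub f1|apply: frame_sub f2].
have rE j : (rowm (rarr p (rmem s rFa)) (rarr e (rmem s rFe)) (marr p (p + e) (rmem s rV))) 0 j
   = rmem s1 rR j by rewrite -r1 mxE.
have VE : marr p (p + e) (rmem s2 rV) = marr p (p + e) (rmem s rV).
  by rewrite f2.2 // f1.2.
apply: ht_if; rewrite /=; case: r2 => [[pv r0]|[pv [cp rc]]]; rewrite pv /=.
  apply: ht_skip; split => //.
  - by nia.
  - by rewrite pv.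
  rewrite pv /elim_rel /=; split => [c|]; first by rewrite rE r0 /= ?ltn_ord.
  by rewrite VE.
have hp2 : nmem s2 vp 0%N = p by rewrite f12.1.
have he2 : nmem s2 ve 0%N = e by rewrite f12.1.
apply: ht_mono (update_ok hp2 he2 cp) => s3 t3 [f3 tt3 U3 V3].
split.
- by apply: (frame_trans f12); apply: frame_sub f3.
- by nia.
- by rewrite f3.1 // pv.
rewrite f3.1 // pv /elim_rel /=; exists (Ordinal cp).
have s2R : rmem s2 rR = rmem s1 rR by rewrite f2.2.
have s2V : rmem s2 rV = rmem s rV by rewrite f2.2 // f1.2.
split.
- by rewrite rE /=.
- by apply/colP => i; rewrite rE !mxE U3 //= s2R s2V mulrC.
- apply/matrixP => i k; rewrite [in LHS]mxE V3 // s2R s2V [in RHS]mxE [in X in _ = X + _]mxE.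
  congr (_ + _); rewrite [in RHS]mxE [in RHS]mxE big_ord1 rE mxE U3 // s2R s2V.
  by [].
Qed.

End Elim.

(** * Elimination as projection onto the kernel of the equations *)

Section ElimMath.
Variable R : realType.

(** Chambers have to be rational polyhedra while the machine computes in [R], so the hyperplanes
    that it finds have to be shown to have rational coefficients. *)
Definition is_rat (x : R) := exists q : rat, x = ratr q.
Definition rat_mx m n (M : 'M[R]_(m, n)) := forall i j, is_rat (M i j).

Lemma is_ratr q : is_rat (ratr q). Proof. by exists q. Qed.
Lemma is_rat0 : is_rat 0. Proof. by exists 0; rewrite rmorph0. Qed.
Lemma is_rat1 : is_rat 1. Proof. by exists 1; rewrite rmorph1. Qed.
Lemma is_ratD x y : is_rat x -> is_rat y -> is_rat (x + y).
Proof. by move=> [p ->] [q ->]; exists (p + q); rewrite rmorphD. Qed.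
Lemma is_ratN x : is_rat x -> is_rat (- x).
Proof. by move=> [p ->]; exists (- p); rewrite rmorphN. Qed.
Lemma is_ratM x y : is_rat x -> is_rat y -> is_rat (x * y).
Proof. by move=> [p ->] [q ->]; exists (p * q); rewrite rmorphM. Qed.
Lemma is_ratV x : is_rat x -> is_rat x^-1.
Proof. by move=> [p ->]; exists (p^-1); rewrite fmorphV. Qed.

Lemma rat_mxB m n (M N : 'M[R]_(m, n)) : rat_mx M -> rat_mx N -> rat_mx (M - N).
Proof. by move=> h k i j; rewrite !mxE; apply: is_ratD => //; apply: is_ratN. Qed.

Lemma rat_mxM m n p (M : 'M[R]_(m, n)) (N : 'M[R]_(n, p)) :
  rat_mx M -> rat_mx N -> rat_mx (M *m N).
Proof.
move=> h k i j; rewrite !mxE.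
elim/big_ind: _ => [|x y|l _]; [exact: is_rat0|exact: is_ratD|exact: is_ratM].
Qed.

Lemma rat_row_mx m n p (M : 'M[R]_(m, n)) (N : 'M[R]_(m, p)) :
  rat_mx M -> rat_mx N -> rat_mx (row_mx M N).
Proof. by move=> h k i j; rewrite !mxE; case: splitP => l _. Qed.

Lemma rat_mx0 m n : rat_mx (0 : 'M[R]_(m, n)).
Proof. by move=> i j; rewrite mxE; exact: is_rat0. Qed.

Lemma rat_mx1 n : rat_mx (1%:M : 'M[R]_n).
Proof. by move=> i j; rewrite mxE; case: eqP => _; [exact: is_rat1|exact: is_rat0]. Qed.

Variables p e : nat.
Implicit Types (a : 'rV[R]_p) (x : 'rV[R]_e) (V : 'M[R]_(p, p + e)).

Lemma rat_rowm a x V : rat_mx a -> rat_mx x -> rat_mx V -> rat_mx (rowm a x V).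
Proof.
move=> ha hx hV; apply: rat_mxB; first exact: rat_mxM.
by apply: rat_row_mx => //; exact: rat_mx0.
Qed.

Lemma rat_elim a x V act U V' :
  rat_mx a -> rat_mx x -> rat_mx V -> elim_rel a x V act U V' -> rat_mx V'.
Proof.
move=> ha hx hV; rewrite /elim_rel; case: act => [[c [rc -> ->]]|[_ ->]] //.
have hr := rat_rowm ha hx hV.
apply: rat_mxB => //; apply: rat_mxM => // i j; rewrite mxE.
by apply: is_ratM; [apply: is_ratV; apply: hr|rewrite mxE].
Qed.

Lemma lsub_mul k l q (M : 'M[R]_(k, l)) (N : 'M[R]_(l, p + q)) : lsubmx (M *m N) = M *m lsubmx N.
Proof. by apply/matrixP => i j; rewrite !mxE; apply: eq_bigr => c _; rewrite !mxE. Qed.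

Lemma rsub_mul k l q (M : 'M[R]_(k, l)) (N : 'M[R]_(l, p + q)) : rsubmx (M *m N) = M *m rsubmx N.
Proof. by apply/matrixP => i j; rewrite !mxE; apply: eq_bigr => c _; rewrite !mxE. Qed.

Lemma lsub_rowm a x V : lsubmx (rowm a x V) = a *m lsubmx V.
Proof. by rewrite /rowm linearB /= row_mxKl subr0 lsub_mul. Qed.

Lemma rsub_rowm a x V : rsubmx (rowm a x V) = a *m rsubmx V - x.
Proof. by rewrite /rowm linearB /= row_mxKr rsub_mul. Qed.

Lemma rowm_lr a x V : rowm a x V = row_mx (a *m lsubmx V) (a *m rsubmx V - x).
Proof. by rewrite -(lsub_rowm a x) -rsub_rowm hsubmxK. Qed.

Section Step.
Variables (a : 'rV[R]_p) (x : 'rV[R]_e) (V : 'M[R]_(p, p + e)) (U : 'cV[R]_p) (V' : 'M[R]_(p, p + e)).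
Hypothesis E : elim_rel a x V true U V'.

Lemma elim_V' : V' = V - U *m rowm a x V.
Proof. by have [c [_ _ ->]] := E. Qed.

(** [U] is the pivot column divided by the value that [a] takes on it. *)
Lemma elim_aU : a *m U = 1%:M.
Proof.
have [c [rc -> _]] := E; apply/matrixP => i j; rewrite !ord1.
have h : (a *m col (lshift e c) V) 0 0 = rowm a x V 0 (lshift e c).
  have := lsub_rowm a x V => /rowP/(_ c); rewrite mxE => ->; rewrite !mxE.
  by apply: eq_bigr => k _; rewrite !mxE.
by rewrite -scalemxAr mxE h mulVf // mxE.
Qed.

(** [U] lies in the column space of the left block, which every earlier equation annihilates;
    subtracting multiples of [U] therefore preserves those equations. *)
Lemma elim_a'U k (a' : 'M[R]_(k, p)) : a' *m lsubmx V = 0 -> a' *m U = 0.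
Proof.
have [c [rc -> _]] := E => h; rewrite -scalemxAr.
have -> : col (lshift e c) V = col c (lsubmx V) by apply/colP => i; rewrite !mxE.
by rewrite colE mulmxA h mul0mx scaler0.
Qed.

Lemma elim_rowm_new : rowm a x V' = 0.
Proof.
by rewrite {1}/rowm elim_V' mulmxBr mulmxA elim_aU mul1mx addrAC -/(rowm a x V) subrr.
Qed.

Lemma elim_lsub : lsubmx V' = lsubmx V - U *m (a *m lsubmx V).
Proof.
by rewrite elim_V' linearB /= lsub_mul lsub_rowm.
Qed.

Lemma elim_rowm_old (a' : 'rV_p) (x' : 'rV_e) : rowm a' x' V = 0 -> rowm a' x' V' = 0.
Proof.
move=> h; have h' : a' *m lsubmx V = 0 by rewrite -(lsub_rowm a' x') h linear0.
by move: h; rewrite /rowm elim_V' mulmxBr mulmxA elim_a'U // mul0mx subr0.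
Qed.

Lemma elim_lsub_old k (a' : 'M[R]_(k, p)) : a' *m lsubmx V = 0 -> a' *m lsubmx V' = 0.
Proof. by move=> h; rewrite elim_lsub mulmxBr h (mulmxA a' U) elim_a'U // mul0mx subrr. Qed.

Lemma elim_fix k (z : 'M[R]_(p, k)) : lsubmx V *m z = z -> a *m z = 0 -> lsubmx V' *m z = z.
Proof. by move=> h h'; rewrite elim_lsub mulmxBl h -!mulmxA h h' mulmx0 subr0. Qed.

End Step.
End ElimMath.

(** * Maximal independent subsystems of the equalities of a face *)

Section RedMath.
Variables (R : realType) (m nx e : nat) (A : 'M[R]_(m, nx)) (BB : 'M[R]_(m, e)).

(** [PM] collects the rows that supplied a pivot, a basis of the rows of [A] indexed by [I]. By
    [ri_eq] and [ri_fix] the left block of [V] is the projection onto the common kernel of the rows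
    in [PM], and by [ri_ker] the other rows of [I] vanish there too. The residuals of these other
    rows are the equations in the parameters that the equalities of the face imply. *)
Record red_inv (I PM : {set 'I_m}) (V : 'M[R]_(nx, nx + e)) : Prop := RedInv {
  ri_sub : PM \subset I;
  ri_eq : forall i, i \in PM -> rowm (row i A) (row i BB) V = 0;
  ri_fix : forall z : 'cV_nx, (forall i, i \in PM -> row i A *m z = 0) -> lsubmx V *m z = z;
  ri_ker : forall i, i \in I -> row i A *m lsubmx V = 0;
  ri_ind : forall l : 'rV_m, (forall i, i \notin PM -> l 0 i = 0) -> l *m A = 0 -> l = 0;
  ri_rat : rat_mx A -> rat_mx BB -> rat_mx V }.

Lemma red_inv0 : red_inv set0 set0 (row_mx 1%:M 0).
Proof.
split => //; rewrite ?sub0set //.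
- by move=> i; rewrite inE.
- by move=> z _; rewrite row_mxKl mul1mx.
- by move=> i; rewrite inE.
- by move=> l h _; apply/rowP => i; rewrite mxE h // inE.
- by move=> _ _; apply: rat_row_mx; [exact: rat_mx1|exact: rat_mx0].
Qed.

Lemma rat_mx_row p q (M : 'M[R]_(p, q)) i : rat_mx M -> rat_mx (row i M).
Proof. by move=> h j k; rewrite mxE. Qed.

Lemma red_inv_step I PM V i act U V' : red_inv I PM V -> i \notin I ->
  elim_rel (row i A) (row i BB) V act U V' ->
  red_inv (i |: I) (if act then i |: PM else PM) V'.
Proof.
move=> [h1 h2 h3 h4 h5 h6] iI E.
have hr : rat_mx A -> rat_mx BB -> rat_mx V'.
  by move=> rA rB; apply: rat_elim E; [exact: rat_mx_row|exact: rat_mx_row|exact: h6].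
case: act E => E; last first.
  have [r0 VV'] := E; rewrite VV' in hr *; split => //.
  - exact: subset_trans h1 (subsetUr _ _).
  - move=> j; rewrite in_setU1 => /orP[/eqP->|/h4] //.
    by rewrite -(lsub_rowm _ (row i BB)); apply/rowP => c; rewrite !mxE; have := r0 c; rewrite !mxE.
have new := elim_rowm_new E.
split => //.
- exact: setUS.
- move=> j; rewrite in_setU1 => /orP[/eqP-> //|jP]; apply: (elim_rowm_old E); exact: h2.
- move=> z hz; apply: (elim_fix E); last by apply: hz; rewrite setU11.
  by apply: h3 => j jP; apply: hz; rewrite in_setU1 jP orbT.
- move=> j; rewrite in_setU1 => /orP[/eqP->|/h4]; last exact: (elim_lsub_old E).
  by rewrite -(lsub_rowm _ (row i BB)) new linear0.
- move=> l hl lA.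
  have iPM : i \notin PM by apply: contra iI => /(subsetP h1).
  have li : l 0 i = 0.
    (* Multiplying the dependency by [U] isolates the new coefficient: the new row takes the value 1
       on [U], the rows in [PM] take the value 0. *)
    have : l *m A *m U = 0 by rewrite lA mul0mx.
    rewrite -mulmxA => /rowP/(_ 0); rewrite mxE (bigD1 i) //= big1 => [|j ji].
      rewrite addr0 [X in _ = X]mxE; have -> : (A *m U) i 0 = (row i A *m U) 0 0.
        by rewrite -row_mul [RHS]mxE.
      by rewrite (elim_aU E) mxE mulr1.
    have [jP|jP] := boolP (j \in PM); last by rewrite hl ?mul0r // in_setU1 negb_or ji.
    have -> : (A *m U) j 0 = (row j A *m U) 0 0 by rewrite -row_mul [RHS]mxE.
    rewrite (elim_a'U E) ?mxE ?mulr0 //.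
    by apply: h4; apply: (subsetP h1).
  apply: h5 lA => j jP; have [->//|ji] := eqVneq j i.
  by apply: hl; rewrite in_setU1 negb_or ji.
Qed.

End RedMath.

(** * Reducing the equalities of a face *)

Notation vcnt := 25%N (only parsing).
Notation vptr := 26%N (only parsing).
Notation vlen := 27%N (only parsing).
Notation aMark := 50%N (only parsing).
Notation aPM := 51%N (only parsing).

Definition em := NGet 0 (NConst 0).
Definition enx := NGet 0 (NConst 1).
Definition eny := NGet 0 (NConst 2).
Definition sv x e := NSet x (NConst 0) e.

(** Truncated subtraction turns 1 - ((i - k) + (k - i)) into the Kronecker delta, so the block
    matrix (1 | 0) is written without a test. *)
Definition InitV : cmd :=
  For cU (gv vp) (For cK eW
    (RSet rV (NAdd (NMul (gv cU) eW) (gv cK))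
       (RNat (NSub (NConst 1) (NAdd (NSub (gv cU) (gv cK)) (NSub (gv cK) (gv cU))))))).

Definition LoadRow : cmd :=
  For cK enx (RSet rFa (gv cK) (RGet 0 (NAdd (NMul (gv cI) enx) (gv cK)))) ;;
  For cK eny (RSet rFe (gv cK) (RGet 1 (NAdd (NMul (gv cI) eny) (gv cK)))) ;;
  RSet rFe eny (RGet 2 (gv cI)).

(** The list becomes an indicator array, so the order of its entries does not matter. *)
Definition Read enc : cmd :=
  For cK em (NSet aMark (gv cK) (NConst 0)) ;;
  sv vlen (NGet enc (gv vptr)) ;;
  sv vptr (NAdd (gv vptr) (NConst 1)) ;;
  For cK (gv vlen)
    (NSet aMark (NGet enc (NAdd (gv vptr) (gv cK))) (NConst 1)) ;;
  sv vptr (NAdd (gv vptr) (gv vlen)).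

Definition Reduce : cmd :=
  sv vp enx ;; sv ve (NAdd eny (NConst 1)) ;; sv vcnt (NConst 0) ;; InitV ;;
  For cI em
    (NSet aPM (gv cI) (NConst 0) ;;
     If (BNle (NConst 1) (NGet aMark (gv cI)))
       (LoadRow ;; Elim ;;
        If (BNle (NConst 1) (gv vpv))
          (NSet aPM (gv cI) (NConst 1) ;; sv vcnt (NAdd (gv vcnt) (NConst 1))) Skip) Skip).

Section Red.
Variable R : realType.
Implicit Types (s : state R) (Q : state R -> nat -> Prop).

Lemma initV_ok p e s :
  nmem s vp 0%N = p -> nmem s ve 0%N = e ->
  ht InitV s (fun s' t => [/\ frame [:: cK; cU] [:: rV] s s',
    (t <= 300 * (p + e).+1 ^ 2)%N & marr p (p + e) (rmem s' rV) = row_mx 1%:M 0]).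
Proof.
move=> hp he.
apply: (@ht_fill2 _ _ _ _ _ _ _ _ _ p (p + e) 0 (fun i k => (i == k)%:R)) => //.
- by move=> u fu /=; rewrite fu.1.
- by move=> u fu /=; rewrite !fu.1 // hp he.
- move=> u i k ip kp fu ii ik _ /=; rewrite ii ik !fu.1 // hp he; split => //.
  by congr (_%:R); case: eqP => [->|]; lia.
move=> u t fu h1 _ tt; split => //.
- by apply: frame_sub fu.
- move: tt; rewrite /=; nia.
apply/matrixP => i j; rewrite mxE -[X in rmem _ _ X]add0n addnA h1 //.
rewrite mxE; case: (splitP j) => k jk; rewrite !mxE jk //.
by rewrite ltn_eqF // ltn_addr.
Qed.

Section Data.
Variables (m nx ny : nat) (A : 'M[R]_(m, nx)) (B : 'M[R]_(m, ny)) (b : 'cV[R]_m).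
Variables (L L' : seq (seq 'I_m)).

Record data s : Prop := Data {
  d_m : nmem s 0%N 0%N = m;
  d_nx : nmem s 0%N 1%N = nx;
  d_ny : nmem s 0%N 2%N = ny;
  d_L : nmem s 0%N 3%N = size L;
  d_L' : nmem s 0%N 4%N = size L';
  d_eL : forall i, nmem s 1%N i = nth 0%N (enc_lists L) i;
  d_eL' : forall i, nmem s 2%N i = nth 0%N (enc_lists L') i;
  d_A : forall (i : 'I_m) (j : 'I_nx), rmem s 0%N (i * nx + j)%N = A i j;
  d_B : forall (i : 'I_m) (j : 'I_ny), rmem s 1%N (i * ny + j)%N = B i j;
  d_b : forall i : 'I_m, rmem s 2%N i = b i 0 }.

(** The input occupies the arrays 0, 1 and 2 of both memories, so it survives every command whose
    frame starts at 3. *)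
Lemma data_frame ns rs s s' : all (leq 3) ns -> all (leq 3) rs ->
  frame ns rs s s' -> data s -> data s'.
Proof.
move=> /allP hn /allP hr [f1 f2].
have e1 a : (a < 3)%N -> nmem s' a = nmem s a.
  by move=> a3; apply: f1; apply/negP => /hn /=; lia.
have e2 a : (a < 3)%N -> rmem s' a = rmem s a.
  by move=> a3; apply: f2; apply/negP => /hr /=; lia.
by case=> *; split; rewrite ?e1 ?e2.
Qed.

Lemma loadRow_ok s (i : 'I_m) : data s -> nmem s cI 0%N = i ->
  ht LoadRow s (fun s' t => [/\ frame [:: cK] [:: rFa; rFe] s s',
    (t <= 100 * (nx + ny).+1)%N, rarr nx (rmem s' rFa) = row i A &
    rarr (ny + 1) (rmem s' rFe) = row i (row_mx B b)]).
Proof.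
move=> d hi; hseq.
apply: (@ht_fillr _ _ _ _ _ _ _ nx 0 (fun k => rmem s 0%N (i * nx + k)%N)).
- by move=> u fu /=; rewrite !fu.1 // d.(d_nx).
- by move=> u k kn fu ik _ /=; rewrite ik !fu.1 // hi d.(d_nx) fu.2.
move=> s1 t1 f1 h1 _ tt1; hseq.
have d1 : data s1 by apply: data_frame f1 d.
apply: (@ht_fillr _ _ _ _ _ _ _ ny 0 (fun k => rmem s 1%N (i * ny + k)%N)).
- by move=> u fu /=; rewrite !fu.1 // d1.(d_ny).
- by move=> u k kn fu ik _ /=; rewrite ik !fu.1 // !f1.1 // hi d.(d_ny) fu.2 // f1.2.
move=> s2 t2 f2 h2 _ tt2; hset.
have d2 : data s2 by apply: data_frame f2 d1.
have f12 : frame [:: cK] [:: rFa; rFe] s s2.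
  by apply: (@frame_trans _ _ _ _ s1); [apply: frame_sub f1|apply: frame_sub f2].
split.
- by apply: frame_setr.
- by move: tt1 tt2; rewrite /=; lia.
- apply/rowP => j; rewrite !mxE -d.(d_A) /= /upd /= f2.2 //; exact: h1.
- apply/rowP => j; rewrite !mxE /= /upd /= d2.(d_ny) f12.1 // hi f12.2 //.
  case: splitP => k jk; rewrite jk.
    by rewrite ltn_eqF // -d.(d_B); apply: h2.
  by rewrite !ord1 addn0 eqxx d.(d_b).
Qed.

Definition off (LL : seq (seq 'I_m)) q := size (enc_lists (take q LL)).

Lemma enc_lists_cat (L1 L2 : seq (seq 'I_m)) :
  enc_lists (L1 ++ L2) = enc_lists L1 ++ enc_lists L2.
Proof. by rewrite /enc_lists map_cat flatten_cat. Qed.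

Lemma off_split (LL : seq (seq 'I_m)) q : (q < size LL)%N -> let l := nth [::] LL q in
  enc_lists LL = enc_lists (take q LL) ++ size l :: map val l ++ enc_lists (drop q.+1 LL).
Proof.
move=> qs l; rewrite -{1}(cat_take_drop q LL) enc_lists_cat (drop_nth [::]) //.
Qed.

Lemma offS (LL : seq (seq 'I_m)) q : (q < size LL)%N -> off LL q.+1 = (off LL q + (size (nth [::] LL q)).+1)%N.
Proof.
move=> qs; rewrite /off (take_nth [::]) // -cats1 enc_lists_cat size_cat; congr (_ + _)%N.
by rewrite /enc_lists /= cats0 size_map.
Qed.

Lemma read_ok enc (LL : seq (seq 'I_m)) q s : data s -> (enc < 3)%N ->
  (forall i, nmem s enc i = nth 0%N (enc_lists LL) i) -> (q < size LL)%N ->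
  uniq (nth [::] LL q) ->
  nmem s vptr 0%N = off LL q ->
  ht (Read enc) s (fun s' t => [/\ frame [:: cK; aMark; vlen; vptr] [::] s s',
    (t <= 100 * m.+1)%N, nmem s' vptr 0%N = off LL q.+1 &
    forall i : 'I_m, nmem s' aMark i = (i \in nth [::] LL q)]).
Proof.
move=> d e3 henc qs ul hptr; set l := nth [::] LL q in ul *.
have em1 u : frame [:: cK; aMark; vlen; vptr] [::] s u -> forall i, nmem u enc i = nth 0%N (enc_lists LL) i.
  by move=> fu i; rewrite fu.1 // !inE; case: enc e3 {henc} => [|[|[|]]].
(* A list without repetition has at most [m] entries, which keeps the time linear in [m]. *)
have sl : (size l <= m)%N by rewrite -[X in (_ <= X)%N]card_ord -(card_uniqP ul) max_card.
have e0 : nth 0%N (enc_lists LL) (off LL q) = size l.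
  by rewrite (off_split qs) nth_cat ltnn subnn.
have eS k : (k < size l)%N -> nth 0%N (enc_lists LL) (off LL q + 1 + k)%N = nth 0%N (map val l) k.
  move=> kl; rewrite (off_split qs) nth_cat -addnA -[X in (_ + _ < X)%N]addn0 ltn_add2l /=.
  by rewrite addKn add1n /= nth_cat size_map kl.
hseq; apply: (@ht_filln _ _ _ _ _ _ _ m 0 (fun=> 0%N)) => //.
- by move=> u fu /=; rewrite fu.1 // d.(d_m).
move=> s1 t1 f1 h1 _ tt1.
have F1 : frame [:: cK; aMark; vlen; vptr] [::] s s1 by apply: frame_sub f1.
hseq; hset; hseq; hset; rewrite /=.
set s2 := setn _ vlen _ _; set s3 := setn _ vptr _ _.
have p3 : nmem s3 vptr 0%N = (off LL q + 1)%N by rewrite /= /upd /= f1.1 // hptr.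
have l3 : nmem s3 vlen 0%N = size l.
  by rewrite /= /upd /= (f1.1 vptr) // hptr em1.
have F3 : frame [:: cK; aMark; vlen; vptr] [::] s s3 by do 2!apply: frame_setn => //.
have m3 i : (i < m)%N -> nmem s3 aMark i = 0%N.
  by move=> im; have := h1 i im; rewrite add0n /= /upd.
clearbody s3; clear s2.
hseq; apply: (@ht_forT _ _ _ _ _ (size l) 20 (fun k u =>
   [/\ frame [:: cK; aMark] [::] s3 u, frame [:: cK; aMark; vlen; vptr] [::] s u &
   forall i : 'I_m, nmem u aMark i = (i \in take k l)])).
- split; [by apply: frame_setn|by apply: frame_setn|].
  by move=> i; rewrite take0 in_nil /= /upd /= m3.
- by move=> k u [fu _ _] /=; rewrite fu.1.
- move=> k u kl [fu Fu hu] ik; hset; split => //.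
  split; [by do 2!apply: frame_setn => //|by do 2!apply: frame_setn => //|].
  move=> i; rewrite /= /upd /= (fu.1 vptr) // p3 ik em1 // eS // (take_nth i) //.
  rewrite mem_rcons in_cons (nth_map i) // val_eqE.
  by case: eqP => //= _; rewrite hu.
move=> s4 t4 [f4 F4 h4] _ tt4; hset; split.
- by apply: frame_setn.
- by move: tt1 tt4; rewrite /=; lia.
- by rewrite /= /upd /= !f4.1 // p3 l3 offS // -addnA add1n.
- by move=> i; have := h4 i; rewrite take_size /= /upd.
Qed.

Definition BB := row_mx B b.
Definition nsRed := [:: cK; cS; cU; cI; vp; ve; vcnt; vpv; vpc; aPM].
Definition rsRed := [:: rAcc; rR; rU; rV; rFa; rFe].
(** The single size in which polynomial factors are expressed; for m > 0 it is at most 2 ([bitlen] +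
    1). *)
Definition dimW := (m + nx + ny + 2)%N.

Lemma dimW_gt0 : (0 < dimW)%N. Proof. by rewrite /dimW addn2. Qed.

Lemma dimW_sq : (dimW <= dimW ^ 2)%N.
Proof. by rewrite -{1}[dimW]expn1 leq_pexp2l // dimW_gt0. Qed.

Lemma dimW_elim : ((nx + (ny + 1)).+1 ^ 2 <= dimW ^ 2)%N.
Proof. by rewrite leq_exp2r // /dimW; lia. Qed.

Lemma dimW_row : ((nx + ny).+1 <= dimW ^ 2)%N.
Proof. by apply: leq_trans dimW_sq; rewrite /dimW; lia. Qed.

Lemma dimW_loop : (m * dimW ^ 2 + dimW ^ 2 <= dimW ^ 3)%N.
Proof. by rewrite (expnS dimW 2) -{2}[(dimW ^ 2)%N]mul1n -mulnDl leq_mul2r /dimW; lia. Qed.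

Lemma reduce_ok s (I : {set 'I_m}) : data s -> (forall i : 'I_m, nmem s aMark i = (i \in I)) ->
  ht Reduce s (fun s' t => [/\ frame nsRed rsRed s s', (t <= 3000 * dimW ^ 3)%N,
    nmem s' vp 0%N = nx /\ nmem s' ve 0%N = (ny + 1)%N &
    exists PM V, [/\ red_inv A BB I PM V, forall i : 'I_m, nmem s' aPM i = (i \in PM),
      nmem s' vcnt 0%N = #|PM| & marr nx (nx + (ny + 1)) (rmem s' rV) = V]]).
Proof.
move=> d hI; hseq; hset; hseq; hset; hseq; hset; rewrite /=.
set s1 := setn _ vcnt _ _.
have f1 : frame nsRed rsRed s s1 by do 3!apply: frame_setn => //.
have p1 : nmem s1 vp 0%N = nx by rewrite /= /upd /= d.(d_nx).
have e1 : nmem s1 ve 0%N = (ny + 1)%N by rewrite /= /upd /= d.(d_ny).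
have c1 : nmem s1 vcnt 0%N = 0%N by [].
clearbody s1; hseq; apply: ht_mono (initV_ok p1 e1) => s2 t2 [f2 tt2 V2].
have d1 : data s1 by apply: data_frame f1 d.
apply: (@ht_forT _ _ _ _ _ m (2000 * dimW ^ 2) (fun k u =>
  [/\ frame nsRed rsRed s u, nmem u vp 0%N = nx, nmem u ve 0%N = (ny + 1)%N &
    exists PM V, [/\ red_inv A BB [set i in I | (i < k)%N] PM V,
      forall i : 'I_m, (i < k)%N -> nmem u aPM i = (i \in PM),
      nmem u vcnt 0%N = #|PM| & marr nx (nx + (ny + 1)) (rmem u rV) = V]])).
- split.
  + by apply: frame_setn => //; apply: (frame_trans f1); apply: frame_sub f2.
  + by rewrite /= /upd /= f2.1.
  + by rewrite /= /upd /= f2.1.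
  exists set0, (row_mx 1%:M 0); split => //.
  + have -> : [set i in I | (i < 0)%N] = set0 by apply/setP => i; rewrite !inE andbF.
    exact: red_inv0.
  + by rewrite cards0 /= /upd /= f2.1.
- by move=> k u [fu *] /=; rewrite fu.1 // d.(d_m).
- move=> k u km [fu pu eu [PM [V [ri hPM hc hV]]]] ik.
  have [i ki] : exists i : 'I_m, k = i by exists (Ordinal km).
  rewrite ki in km ik ri hPM *; clear ki k.
  have du : data u by apply: data_frame fu d.
  have setE : [set j in I | (j < i.+1)%N] =
     (if i \in I then i |: [set j in I | (j < i)%N] else [set j in I | (j < i)%N]).
    apply/setP => j; rewrite [in LHS]inE ltnS leq_eqVlt val_eqE.
    by case: ifP => iI; rewrite !inE; case: eqP => //= ->; rewrite iI.
  have iPM : i \notin PM.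
    by apply/negP => /(subsetP ri.(ri_sub)); rewrite inE ltnn andbF.
  hseq; hset; rewrite /= ik.
  set v := setn u aPM _ _.
  have fv : frame nsRed rsRed s v by apply: frame_setn.
  have dv : data v by apply: data_frame fv d.
  have PMv (j : 'I_m) : (j < i.+1)%N -> nmem v aPM j = (j \in PM).
    rewrite ltnS leq_eqVlt /= /upd /= => /orP[ji|ji].
      by rewrite ji; move: ji; rewrite val_eqE => /eqP->; rewrite (negbTE iPM).
    by rewrite (ltn_eqF ji) hPM.
  have iv : nmem v cI 0%N = i by [].
  have cv : nmem v vcnt 0%N = #|PM| by [].
  have pv : nmem v vp 0%N = nx by [].
  have ev : nmem v ve 0%N = (ny + 1)%N by [].
  have Vv : marr nx (nx + (ny + 1)) (rmem v rV) = V by [].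
  clearbody v; apply: ht_if; rewrite /= iv fv.1 // hI.
  rewrite setE lt0b; case: ifP => iI; last first.
    hset; split => //; first by move: dimW_gt0 dimW_sq; lia.
    by split => //; [apply: frame_setn|exists PM, V; split].
  hseq; apply: ht_mono (loadRow_ok dv iv) => w tw [fw ttw aw xw].
  have pw : nmem w vp 0%N = nx by rewrite fw.1.
  have ew : nmem w ve 0%N = (ny + 1)%N by rewrite fw.1.
  hseq; apply: ht_mono (elim_ok pw ew) => x tx [fx ttx act ex].
  rewrite aw xw -/BB in ex; rewrite fw.2 // Vv in ex.
  have := red_inv_step ri _ ex; rewrite inE ltnn andbF => /(_ isT) ri'.
  have fwx : frame nsRed rsRed v x.
    by apply: (@frame_trans _ _ _ _ w); [apply: frame_sub fw|apply: frame_sub fx].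
  have fsx : frame nsRed rsRed s x by apply: frame_trans fv fwx.
  have cx : nmem x vcnt 0%N = #|PM| by rewrite fx.1 // fw.1.
  have ix : nmem x cI 0%N = i by rewrite fx.1 // fw.1.
  have PMx : nmem x aPM = nmem v aPM by rewrite fx.1 // fw.1.
  have px : nmem x vp 0%N = nx by rewrite fx.1.
  have ex' : nmem x ve 0%N = (ny + 1)%N by rewrite fx.1.
  apply: ht_if; rewrite /=.
  move: act ri'; case E : (nmem x vpv 0%N) => [|[|//]] _ /= ri'.
    hset; split; [by move: ttw ttx dimW_gt0 dimW_sq dimW_elim dimW_row; rewrite /=; move: (_ ^ 2)%N (_ ^ 2)%N => X Y; lia|by []|].
    split; [by apply: frame_setn|by []|by []|].
    exists PM, (marr nx (nx + (ny + 1)) (rmem x rV)); split => // j ji.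
    by rewrite /= /upd /= PMx PMv.
  hseq; hset; hset; split.
  + by move: ttw ttx dimW_gt0 dimW_sq dimW_elim dimW_row; rewrite /=; move: (_ ^ 2)%N (_ ^ 2)%N => X Y; lia.
  + by rewrite /= /upd.
  split.
  + by do 3!apply: frame_setn => //.
  + by rewrite /= /upd.
  + by rewrite /= /upd.
  exists (i |: PM), (marr nx (nx + (ny + 1)) (rmem x rV)); split => //.
  + move=> j ji; rewrite /= /upd /= ix in_setU1 val_eqE.
    by case: eqP => //= _; rewrite PMx PMv.
  + by rewrite /= /upd /= cx cardsU1 iPM addnC.
- move=> u t [fu pu eu [PM [V [ri hPM hc hV]]]] _ tt; split => //.
    move: tt tt2 dimW_gt0 dimW_sq dimW_elim dimW_loop; rewrite /=.
    move: (_ ^ 2)%N (dimW ^ 2)%N (dimW ^ 3)%N => X Y Z tt tt2 g1 g2 g3 g4.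
    have : (m * (2000 * Y + 2 + 11) <= m * (2013 * Y))%N by rewrite leq_mul2l; lia.
    rewrite (mulnCA m 2013); lia.
  exists PM, V; split => // [|i]; last exact: hPM.
  by move: ri; have -> : [set i in I | (i < m)%N] = I by apply/setP => i; rewrite inE ltn_ord andbT.
Qed.

Lemma rowcalc_ok s (i : 'I_m) : data s -> nmem s cI 0%N = i ->
  nmem s vp 0%N = nx -> nmem s ve 0%N = (ny + 1)%N ->
  ht (LoadRow ;; Row) s (fun s' t => [/\ frame [:: cK; cS] [:: rFa; rFe; rAcc; rR] s s',
    (t <= 500 * dimW ^ 2)%N &
    rarr (nx + (ny + 1)) (rmem s' rR) =
      rowm (row i A) (row i BB) (marr nx (nx + (ny + 1)) (rmem s rV))]).
Proof.
move=> d hi hp he; hseq; apply: ht_mono (loadRow_ok d hi) => w tw [fw ttw aw xw].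
have pw : nmem w vp 0%N = nx by rewrite fw.1.
have ew : nmem w ve 0%N = (ny + 1)%N by rewrite fw.1.
apply: ht_mono (row_ok pw ew) => x tx [fx ttx rx]; split.
- by apply: (@frame_trans _ _ _ _ w); [apply: frame_sub fw|apply: frame_sub fx].
- by move: ttw ttx dimW_gt0 dimW_sq dimW_elim dimW_row; rewrite /=; move: (_ ^ 2)%N (_ ^ 2)%N => X Y; lia.
- by rewrite rx aw xw fw.2.
Qed.

End Data.
End Red.

(** * The hyperplanes of the arrangement *)

Notation vH := 28%N (only parsing).
Notation vfound := 40%N (only parsing).
Notation vnz := 41%N (only parsing).
Notation rHyp := 27%N (only parsing).

Definition eL := NGet 0 (NConst 3).
Definition eL' := NGet 0 (NConst 4).
Definition eny1 := NAdd eny (NConst 1).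
Definition BFull := BAnd (BNle (gv vcnt) enx) (BNle enx (gv vcnt)).

(** Once the equalities of a face determine x as a function of y, each remaining one becomes an
    equation in y alone. One with nonzero linear part is kept per face: a later find overwrites an
    earlier one in the same slot, as [vH] advances only after the search. *)
Definition Find : cmd :=
  sv vfound (NConst 0) ;;
  For cI em
    (If (BNle (NConst 1) (NGet aMark (gv cI)))
      ((LoadRow ;; Row) ;; sv vnz (NConst 0) ;;
       For cK eny (If (BRzero (RGet rR (NAdd enx (gv cK)))) Skip (sv vnz (NConst 1))) ;;
       If (BNle (NConst 1) (gv vnz))
         (For cK eny1 (RSet rHyp (NAdd (NMul (gv vH) eny1) (gv cK)) (RGet rR (NAdd enx (gv cK)))) ;;
          sv vfound (NConst 1)) Skip) Skip).

(** A face whose equalities do not determine x contains a direction with zero y-part in its affine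
    hull, so its projection has dimension less than n_y - 1 and gives no hyperplane. *)
Definition Hyps : cmd :=
  sv vptr (NConst 0) ;; sv vH (NConst 0) ;;
  For cQ eL'
    (Read 2 ;; Reduce ;;
     If BFull (Find ;; sv vH (NAdd (gv vH) (gv vfound))) Skip).

Section Hyp.
Variable R : realType.
Implicit Types (s : state R) (Q : state R -> nat -> Prop).
Variables (m nx ny : nat) (A : 'M[R]_(m, nx)) (B : 'M[R]_(m, ny)) (b : 'cV[R]_m).
Variables (L L' : seq (seq 'I_m)).
Hypothesis uL' : all uniq L'.
Notation data := (data A B b L L').
Notation W := (dimW m nx ny).
Notation BB := (BB B b).

Definition hrow (V : 'M[R]_(nx, nx + (ny + 1))) (i : 'I_m) : 'rV[R]_(ny + 1) :=
  rsubmx (rowm (row i A) (row i BB) V).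

Lemma hrowE V i u (k : 'I_(ny + 1)) :
  rarr (nx + (ny + 1)) (rmem u rR) = rowm (row i A) (row i BB) V ->
  rmem u rR (nx + k)%N = hrow V i 0 k.
Proof. by rewrite /hrow => <-; rewrite !mxE. Qed.

(** This is all that the geometry uses about one face. The last alternative keeps the specification
    of the program independent of whether [I] comes from a face; it is refuted where a hyperplane is
    needed. *)
Definition hyp_cover (I : {set 'I_m}) (hs : seq 'rV[R]_(ny + 1)) :=
  exists PM V, red_inv A BB I PM V /\ (#|PM| = nx ->
    (exists i, [/\ i \in I, lsubmx (hrow V i) != 0 & hrow V i \in hs]) \/
    (forall i, i \in I -> lsubmx (hrow V i) = 0)).

Definition nsFind := [:: cK; cS; cI; vfound; vnz].
Definition rsFind := [:: rFa; rFe; rAcc; rR; rHyp].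

Lemma find_ok s (I : {set 'I_m}) V H : data s -> nmem s vp 0%N = nx -> nmem s ve 0%N = (ny + 1)%N ->
  (forall i : 'I_m, nmem s aMark i = (i \in I)) ->
  marr nx (nx + (ny + 1)) (rmem s rV) = V -> nmem s vH 0%N = H ->
  ht Find s (fun s' t => [/\ frame nsFind rsFind s s', (t <= 1000 * W ^ 3)%N,
    forall j, (j < H * (ny + 1))%N -> rmem s' rHyp j = rmem s rHyp j &
    (nmem s' vfound 0%N = 0%N /\ forall i, i \in I -> lsubmx (hrow V i) = 0) \/
    (nmem s' vfound 0%N = 1%N /\ exists i, [/\ i \in I, lsubmx (hrow V i) != 0 &
       forall k : 'I_(ny + 1), rmem s' rHyp (H * (ny + 1) + k)%N = hrow V i 0 k])]).
Proof.
move=> d hp he hI hV hH; hseq; hset.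
apply: (@ht_forT _ _ _ _ _ m (700 * W ^ 2) (fun q u => [/\ frame nsFind rsFind s u,
  forall j, (j < H * (ny + 1))%N -> rmem u rHyp j = rmem s rHyp j &
    (nmem u vfound 0%N = 0%N /\ forall i : 'I_m, (i < q)%N -> i \in I -> lsubmx (hrow V i) = 0) \/
    (nmem u vfound 0%N = 1%N /\ exists i, [/\ i \in I, lsubmx (hrow V i) != 0 &
       forall k : 'I_(ny + 1), rmem u rHyp (H * (ny + 1) + k)%N = hrow V i 0 k])])).
- by split => //; [do 2!apply: frame_setn => //|left].
- by move=> k u [fu *] /=; rewrite fu.1 // d.(d_m).
- move=> q u qm [fu hu1 hu2] iq.
  have [i qi] : exists i : 'I_m, q = i by exists (Ordinal qm).
  rewrite qi in qm iq hu2 *; clear qi q.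
  have du : data u by apply: data_frame fu d.
  have pu : nmem u vp 0%N = nx by rewrite fu.1.
  have eu : nmem u ve 0%N = (ny + 1)%N by rewrite fu.1.
  have Vu : marr nx (nx + (ny + 1)) (rmem u rV) = V by rewrite fu.2.
  apply: ht_if; rewrite /= iq fu.1 // hI lt0b; case: ifP => iI; last first.
    hset; split => //; first by move: (dimW_gt0 m nx ny) (dimW_sq m nx ny); lia.
    split => //; first by apply: frame_setn.
    case: hu2 => [[h1 h2]|h]; [left|by right]; split => // j.
    by rewrite ltnS leq_eqVlt val_eqE => /orP[/eqP->|/h2 //]; rewrite iI.
  hseq; apply: ht_mono (rowcalc_ok du iq pu eu) => w tw [fw ttw rw].
  rewrite Vu in rw; hseq; hset; hseq.
  apply: (@ht_forT _ _ _ _ _ ny 30 (fun k v => [/\ frame [:: cK; vnz] [::] w v &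
    (nmem v vnz 0%N = 0%N /\ forall j : 'I_ny, (j < k)%N -> lsubmx (hrow V i) 0 j = 0) \/
    (nmem v vnz 0%N = 1%N /\ lsubmx (hrow V i) != 0)])).
  + by split; [do 2!apply: frame_setn => //|left].
  + by move=> k v [fv _] /=; rewrite fv.1 // fw.1 // du.(d_ny).
  + move=> k v kn [fv hv] ik; apply: ht_if; rewrite rzeroE /= ik fv.2 // fv.1 // fw.1 // du.(d_nx).
    have := hrowE (lshift 1 (Ordinal kn)) rw; rewrite /= => ->.
    have -> : hrow V i 0 (lshift 1 (Ordinal kn)) = lsubmx (hrow V i) 0 (Ordinal kn) by rewrite [RHS]mxE.
    case: eqP => h0; hset.
      split => //; split; first by apply: frame_setn.
      case: hv => [[h1 h2]|h]; [left|by right]; split => // j.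
      rewrite ltnS leq_eqVlt => /orP[/eqP jk|/h2 //].
      by rewrite -[RHS]h0; congr (lsubmx _ _ _); apply: val_inj.
    split => //; split; first by do 2!apply: frame_setn => //.
    by right; split => //; apply: contra_not_neq h0 => ->; rewrite mxE.
  move=> v tv [fv hv] _ ttv; apply: ht_if; rewrite /=.
  have Fv : frame nsFind rsFind s v.
    apply: (frame_trans fu); apply: (@frame_trans _ _ _ _ w); first by apply: frame_sub fw.
    by apply: frame_sub fv.
  have vq : nmem v cI 0%N = i by rewrite fv.1 // fw.1.
  have vR : rmem v rR = rmem w rR by rewrite fv.2.
  have vHyp : rmem v rHyp = rmem u rHyp by rewrite fv.2 // fw.2.
  have dv : data v by apply: data_frame Fv d.
  have vF : nmem v vfound = nmem u vfound by rewrite fv.1 // fw.1.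
  have vHH : nmem v vH 0%N = H by rewrite Fv.1.
  move: (dimW_gt0 m nx ny) (dimW_sq m nx ny) (dimW_row m nx ny) => g1 g2 g3.
  case: hv => [[-> h0]|[-> h0]] /=.
    hset; split => //; first by move: ttw ttv; rewrite /=; lia.
    split; [by apply: frame_setn|by rewrite /= /upd /= vHyp|].
    rewrite /= /upd /= vHyp vF; case: hu2 => [[h1 h2]|h]; [left|by right]; split => // j.
    rewrite ltnS leq_eqVlt val_eqE => /orP[/eqP->|/h2 //] _.
    by apply/rowP => c; rewrite h0 // [RHS]mxE.
  hseq; apply: (@ht_fillr _ _ _ _ _ _ _ (ny + 1) (H * (ny + 1)) (fun k => rmem w rR (nx + k)%N)).
  + by move=> x fx /=; rewrite fx.1 // dv.(d_ny).
  + move=> x k kn fx ik _ /=; rewrite ik !fx.1 // dv.(d_ny) dv.(d_nx) fx.2 // vHH; split => //.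
    by rewrite vR.
  move=> x tx fx hx1 hx2 ttx; hset; split.
  + by move: ttw ttv ttx; rewrite /=; lia.
  + by rewrite /= /upd /= fx.1.
  split.
  + by do 2!apply: frame_setn => //; apply: (frame_trans Fv); apply: frame_sub fx.
  + by move=> j jH; rewrite /= /upd /= hx2 ?jH // vHyp hu1.
  right; split => //; exists i; split => // k.
  by rewrite /= /upd /= hx1 // (hrowE _ rw).
- move=> u t [fu hu1 hu2] _ tt; split => //.
    move: tt (dimW_gt0 m nx ny) (dimW_sq m nx ny) (dimW_loop m nx ny); rewrite /=.
    move: (W ^ 2)%N (W ^ 3)%N => Y Z tt g1 g2 g4.
    have : (m * (700 * Y + 2 + 11) <= m * (713 * Y))%N by rewrite leq_mul2l; lia.
    rewrite (mulnCA m 713); lia.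
  case: hu2 => [[h1 h2]|h]; [left|by right]; split => // i; exact: h2.
Qed.

Definition holds_hs (hs : seq 'rV[R]_(ny + 1)) s :=
  nmem s vH 0%N = size hs /\
  forall j (k : 'I_(ny + 1)), (j < size hs)%N ->
    rmem s rHyp (j * (ny + 1) + k)%N = (nth 0 hs j) 0 k.

Definition nsHyps := [:: cQ; vH; vlen; vptr; aMark; vfound; vnz] ++ nsRed.
Definition rsHyps := rHyp :: rsRed.

Lemma hyps_ok s : data s -> rat_mx A -> rat_mx BB ->
  ht Hyps s (fun s' t => [/\ frame nsHyps rsHyps s s', (t <= size L' * (4500 * W ^ 3) + 30)%N &
    exists hs, [/\ holds_hs hs s', (size hs <= size L')%N,
      forall h, h \in hs -> rat_mx h & forall l, l \in L' -> hyp_cover [set:: l] hs]]).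
Proof.
move=> d rA rB; hseq; hset; hseq; hset.
apply: (@ht_forT _ _ _ _ _ (size L') (4400 * W ^ 3) (fun q u =>
  [/\ frame nsHyps rsHyps s u, nmem u vptr 0%N = off L' q &
    exists hs, [/\ holds_hs hs u, (size hs <= q)%N,
      forall h, h \in hs -> rat_mx h & forall l, l \in take q L' -> hyp_cover [set:: l] hs]])).
- split; [by do 3!apply: frame_setn => //|by rewrite /off take0|].
  by exists [::]; split => // l; rewrite take0.
- by move=> q u [fu _ _] /=; rewrite fu.1 // d.(d_L').
- move=> q u qL [fu pu [hs [[hH hs1] hs2 hs3 hs4]]] iq.
  have du : data u by apply: data_frame fu d.
  have ul : uniq (nth [::] L' q) by apply: (allP uL'); rewrite mem_nth.
  hseq; apply: ht_mono (read_ok (enc := 2) du isT du.(d_eL') qL ul pu) => v tv [fv ttv pv mv].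
  have dv : data v by apply: data_frame fv du.
  set I := [set:: nth [::] L' q].
  have mI (i : 'I_m) : nmem v aMark i = (i \in I) by rewrite mv inE.
  hseq; apply: ht_mono (reduce_ok dv mI) => w tw [fw ttw [pw ew] [PM [V [ri hPM hc hV]]]].
  have dw : data w by apply: data_frame fw dv.
  have Fw : frame nsHyps rsHyps s w.
    apply: (frame_trans fu); apply: (@frame_trans _ _ _ _ v); first by apply: frame_sub fv.
    by apply: frame_sub fw.
  have iw : nmem w cQ 0%N = q by rewrite fw.1 // fv.1.
  have ppw : nmem w vptr 0%N = off L' q.+1 by rewrite fw.1.
  have wH : nmem w vH 0%N = size hs by rewrite fw.1 // fv.1.
  have whs : rmem w rHyp = rmem u rHyp by rewrite fw.2 // fv.2.
  have T1 : (tv + tw <= 3200 * W ^ 3)%N.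
    move: ttv ttw (dimW_gt0 m nx ny) (dimW_sq m nx ny) (dimW_loop m nx ny).
    have : (m.+1 <= W)%N by rewrite /dimW; lia.
    move: (W ^ 2)%N (W ^ 3)%N => Y Z; lia.
  have W3 : (1 <= W ^ 3)%N by rewrite expn_gt0 dimW_gt0.
  apply: ht_if; have -> : beval w BFull = (#|PM| == nx).
    by rewrite /= hc dw.(d_nx) eqn_leq.
  have cov0 hs' : {subset hs <= hs'} -> forall l, l \in take q L' -> hyp_cover [set:: l] hs'.
    move=> sub l lq; have [PM' [V' [h1 h2]]] := hs4 l lq; exists PM', V'; split => // /h2.
    by case=> [[i [i1 i2 /sub i3]]|]; [left; exists i|right].
  have tk : take q.+1 L' = rcons (take q L') (nth [::] L' q) by rewrite (take_nth [::]).
  case: eqP => cPM; last first.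
    hset; split; [by rewrite /=; lia|by []|].
    split; [by apply: frame_setn|by []|].
    exists hs; split => //; [by split => //= j k jh; rewrite whs hs1|exact: leqW|].
    move=> l; rewrite tk mem_rcons in_cons => /orP[/eqP->|]; last exact: cov0.
    by exists PM, V.
  hseq; apply: ht_mono (find_ok dw pw ew _ hV wH) => [|i]; last by rewrite fw.1.
  move=> x tx [fx ttx hx1 hx2]; hset.
  have Fx : frame nsHyps rsHyps s x by apply: (frame_trans Fw); apply: frame_sub fx.
  have xH : nmem x vH 0%N = size hs by rewrite fx.1.
  split.
  + by move: ttx T1; rewrite /=; lia.
  + by rewrite /= /upd /= fx.1.
  split.
  + by do 2!apply: frame_setn => //.
  + by rewrite /= /upd /= fx.1.
  have hold_old j (k : 'I_(ny + 1)) : (j < size hs)%N -> rmem x rHyp (j * (ny + 1) + k)%N = (nth 0 hs j) 0 k.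
    move=> jh; rewrite hx1 ?whs ?hs1 //.
    have : (j.+1 * (ny + 1) <= size hs * (ny + 1))%N by rewrite leq_mul2r jh orbT.
    by rewrite mulSn; case: k => /= *; lia.
  case: hx2 => [[fnd h0]|[fnd [i [i1 i2 i3]]]].
    exists hs; split => //; [split => /=|exact: leqW|].
    + by rewrite /upd /= xH fnd addn0.
    + by move=> j k jh; rewrite hold_old.
    move=> l; rewrite tk mem_rcons in_cons => /orP[/eqP->|]; last exact: cov0.
    by exists PM, V; split => // _; right.
  exists (rcons hs (hrow V i)); split.
  + split => /=; first by rewrite /upd /= xH fnd size_rcons addn1.
    move=> j k; rewrite size_rcons ltnS leq_eqVlt => /orP[/eqP->|jh].
      by rewrite nth_rcons ltnn eqxx i3.
    by rewrite nth_rcons jh hold_old.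
  + by rewrite size_rcons.
  + move=> h; rewrite mem_rcons in_cons => /orP[/eqP->|/hs3 //] c1 c2.
    rewrite /hrow mxE; apply: rat_rowm; [exact: rat_mx_row|exact: rat_mx_row|].
    exact: ri.(ri_rat).
  move=> l; rewrite tk mem_rcons in_cons => /orP[/eqP->|]; last first.
    by apply: cov0 => h hh; rewrite mem_rcons in_cons hh orbT.
  exists PM, V; split => // _; left; exists i; split => //.
  by rewrite mem_rcons in_cons eqxx.
- move=> u t [fu pu [hs [h1 h2 h3 h4]]] _ tt; split => //; last first.
    by exists hs; split => //; rewrite take_size in h4.
  have W3 : (1 <= W ^ 3)%N by rewrite expn_gt0 dimW_gt0.
  have : (size L' * (4400 * W ^ 3 + ncost eL' + 11) <= size L' * (4500 * W ^ 3))%N.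
    by rewrite leq_mul2l /=; apply/orP; right; lia.
  by move: tt; rewrite /=; lia.
Qed.

End Hyp.

(** * Sample points *)

Notation vD := 29%N (only parsing).
Notation vi := 30%N (only parsing).
Notation aDj := 52%N (only parsing).
Notation aDs := 53%N (only parsing).
Notation aAct := 55%N (only parsing).
Notation rUs := 25%N (only parsing).
Notation rP := 26%N (only parsing).
Notation rEps := 11%N (only parsing).
Notation rAl := 12%N (only parsing).
Notation rQ := 13%N (only parsing).

Definition eHyp j k := RGet rHyp (NAdd (NMul j eny1) k).
Definition rv x := RGet x (NConst 0).

Definition Eval pa : cmd :=
  Sum rAcc cS eny (RMul (eHyp (gv cJ) (gv cS)) (RGet pa (gv cS))) ;;
  RSet rAl (NConst 0) (RAdd (rv rAcc) (eHyp (gv cJ) eny)).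

(** The affine subspaces cut out by the successively chosen hyperplanes are parametrised by the same
    elimination, now in parameter space. A hyperplane that is constant on the current subspace is
    marked inactive in [aAct]. *)
Definition Flat : cmd :=
  sv vp eny ;; sv ve (NConst 1) ;; InitV ;;
  For cD (gv vD)
    (For cK eny (RSet rFa (gv cK) (eHyp (NGet aDj (gv cD)) (gv cK))) ;;
     RSet rFe (NConst 0) (RSub (RNat (NConst 0)) (eHyp (NGet aDj (gv cD)) eny)) ;;
     Elim ;; NSet aAct (gv cD) (gv vpv) ;;
     For cK eny (RSet rUs (NAdd (NMul (gv cD) eny) (gv cK)) (RGet rU (gv cK)))).

(** With a the value of a hyperplane at the point and b its change along the direction, a^2 / (1 +
    a^2 + b^2) is a safe step length that needs neither absolute values nor a division by a possibly
    vanishing b. *)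
Definition Eps : cmd :=
  RSet rEps (NConst 0) (RNat (NConst 1)) ;;
  For cJ (gv vH)
    (Eval rP ;;
     Sum rAcc cS eny (RMul (eHyp (gv cJ) (gv cS)) (RGet rUs (NAdd (NMul (gv vi) eny) (gv cS)))) ;;
     RSet rAl (NConst 0) (RMul (rv rAl) (rv rAl)) ;;
     RSet rQ (NConst 0)
       (RDiv (rv rAl) (RAdd (RAdd (RNat (NConst 1)) (rv rAl)) (RMul (rv rAcc) (rv rAcc)))) ;;
     If (BAnd (BNot (BRle (rv rAl) (RNat (NConst 0)))) (BRle (rv rQ) (rv rEps)))
       (RSet rEps (NConst 0) (rv rQ)) Skip).

(** The subspaces are unwound from the smallest outwards: starting at a point of the last one, the
    point moves along each stored direction by a step that keeps all nonzero signs. The side digit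
    minus one is the sign of the move, so 1 means that the point stays on the hyperplane. *)
Definition Perturb : cmd :=
  For cK eny (RSet rP (gv cK) (RGet rV (NAdd (NMul (gv cK) eny1) eny))) ;;
  For cD (gv vD)
    (sv vi (NSub (NSub (gv vD) (NConst 1)) (gv cD)) ;;
     If (BNle (NConst 1) (NGet aAct (gv vi)))
       (Eps ;;
        For cK eny (RSet rP (gv cK) (RAdd (RGet rP (gv cK))
          (RMul (RMul (RSub (RNat (NGet aDs (gv vi))) (RNat (NConst 1))) (rv rEps))
             (RGet rUs (NAdd (NMul (gv vi) eny) (gv cK))))))) Skip).

Definition Sample : cmd := Flat ;; Perturb.

Section Smp.
Variable R : realType.
Implicit Types (s : state R).

Section Rel.
Variables (ny : nat) (hs : seq 'rV[R]_(ny + 1)).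

Definition hval (h : 'rV[R]_(ny + 1)) (y : 'cV[R]_ny) : R := (lsubmx h *m y) 0 0 + rsubmx h 0 0.

(** A sample run as a relation: pivots and step lengths are left open, so that completeness of the
    enumeration is proved for every admissible choice. *)
Fixpoint smp (V : 'M[R]_(ny, ny + 1)) (ds : seq (nat * nat)) (p : 'cV[R]_ny) : Prop :=
  if ds is (j, sg) :: ds' then
    let h := nth 0 hs j in
    exists act U V', elim_rel (lsubmx h) (- rsubmx h) V act U V' /\
      (if act then exists p' eps, [/\ smp V' ds' p', 0 < eps,
         forall h', h' \in hs -> hval h' p' != 0 ->
           eps * `|(lsubmx h' *m U) 0 0| < `|hval h' p'| &
         p = p' + ((sg%:R - 1) * eps) *: U]
       else smp V' ds' p)
  else p = rsubmx V.
End Rel.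

Section Data.
Variables (m nx ny : nat) (A : 'M[R]_(m, nx)) (B : 'M[R]_(m, ny)) (b : 'cV[R]_m).
Variables (L L' : seq (seq 'I_m)).
Notation data := (data A B b L L').
Variable hs : seq 'rV[R]_(ny + 1).
Notation W := (dimW m nx ny).
Notation H := (size hs).

Lemma holds_frame ns rs s s' : vH \notin ns -> rHyp \notin rs -> frame ns rs s s' ->
  holds_hs hs s -> holds_hs hs s'.
Proof. by move=> h1 h2 [f1 f2] [g1 g2]; split => [|j k jh]; rewrite ?f1 ?f2 // g2. Qed.

Lemma eval_ok pa s j : nmem s 0%N 2%N = ny -> holds_hs hs s -> nmem s cJ 0%N = j -> (j < H)%N ->
  pa != rAcc -> 
  ht (Eval pa) s (fun s' t => [/\ frame [:: cS] [:: rAcc; rAl] s s',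
    (t <= 100 * ny.+1)%N & rmem s' rAl 0%N = hval (nth 0 hs j) (carr ny (rmem s pa))]).
Proof.
move=> dny hh hj jH pa10; hseq.
apply: (@ht_sum _ _ _ _ _ _ ny (fun k => rmem s rHyp (j * (ny + 1) + k)%N * rmem s pa k)).
- by move=> u fu /=; rewrite fu.1.
- by move=> u k kn fu ik; rewrite /= ik !fu.1 // hj dny !fu.2 // inE.
move=> u t fu hu tt; hset; split.
- by apply: frame_setr => //; apply: frame_sub fu.
- by move: tt; rewrite /=; lia.
rewrite /= /upd /= hu !fu.1 // hj dny fu.2 // big_mkord /hval; congr (_ + _).
  rewrite mxE; apply: eq_bigr => k _; rewrite !mxE; congr (_ * _).
  exact: (hh.2 j (lshift 1 k) jH).
have := hh.2 j (rshift ny ord0) jH; rewrite /= addn0 => ->.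
by rewrite [RHS]mxE; congr (_ _ _ _); rewrite ?ord1.
Qed.

Definition nsFlat := [:: cK; cS; cU; cD; vp; ve; vpv; vpc; aAct].
Definition rsFlat := [:: rAcc; rR; rU; rV; rFa; rFe; rUs].

Lemma flat_ok s D : data s -> holds_hs hs s -> nmem s vD 0%N = D -> (D <= ny)%N ->
  (forall i, (i < D)%N -> (nmem s aDj i < H)%N) ->
  ht Flat s (fun s' t => [/\ frame nsFlat rsFlat s s', (t <= 3000 * W ^ 3)%N,
    forall i, (i < D)%N -> (nmem s' aAct i <= 1)%N &
    exists Vs : nat -> 'M[R]_(ny, ny + 1), [/\ Vs 0%N = row_mx 1%:M 0,
      marr ny (ny + 1) (rmem s' rV) = Vs D &
      forall i, (i < D)%N -> let h := nth 0 hs (nmem s aDj i) in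
       elim_rel (lsubmx h) (- rsubmx h) (Vs i) (nmem s' aAct i == 1%N)
         (carr ny (fun c => rmem s' rUs (i * ny + c)%N)) (Vs i.+1)]]).
Proof.
move=> d hh hD Dny hdj; hseq; hset; hseq; hset; rewrite /=.
set s1 := setn _ ve _ _.
have f1 : frame nsFlat rsFlat s s1 by do 2!apply: frame_setn => //.
have p1 : nmem s1 vp 0%N = ny by rewrite /= /upd /= d.(d_ny).
have e1 : nmem s1 ve 0%N = 1%N by rewrite /= /upd.
clearbody s1; hseq; apply: ht_mono (initV_ok p1 e1) => s2 t2 [f2 tt2 V2].
have g1 : ((ny + 1).+1 ^ 2 <= W ^ 2)%N by rewrite leq_exp2r // /dimW; lia.
have g2 : (ny.+1 <= W)%N by rewrite /dimW; lia.
have g3 := dimW_sq m nx ny; have g0 := dimW_gt0 m nx ny.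
apply: (@ht_forT _ _ _ _ _ D (1300 * W ^ 2) (fun k u =>
  [/\ frame nsFlat rsFlat s u, nmem u vp 0%N = ny /\ nmem u ve 0%N = 1%N,
    forall i, (i < k)%N -> (nmem u aAct i <= 1)%N &
    exists Vs : nat -> 'M[R]_(ny, ny + 1), [/\ Vs 0%N = row_mx 1%:M 0,
      marr ny (ny + 1) (rmem u rV) = Vs k &
      forall i, (i < k)%N -> let h := nth 0 hs (nmem s aDj i) in
       elim_rel (lsubmx h) (- rsubmx h) (Vs i) (nmem u aAct i == 1%N)
         (carr ny (fun c => rmem u rUs (i * ny + c)%N)) (Vs i.+1)]])).
- split => //.
  + by apply: frame_setn => //; apply: (frame_trans f1); apply: frame_sub f2.
  + by rewrite /= /upd /= !f2.1.
  by exists (fun=> row_mx 1%:M 0).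
- by move=> k u [fu *] /=; rewrite fu.1 // hD.
- move=> k u kD [fu [pu eu] au [Vs [V0 Vk VS]]] ik.
  have du : data u by apply: data_frame fu d.
  have hu : holds_hs hs u by apply: holds_frame fu hh.
  have ju : nmem u aDj k = nmem s aDj k by rewrite fu.1.
  have jH := hdj k kD; set j := nmem s aDj k in ju jH; set h := nth 0 hs j.
  hseq; apply: (@ht_fillr _ _ _ _ _ _ _ ny 0 (fun c => rmem u rHyp (j * (ny + 1) + c)%N)).
  + by move=> v fv /=; rewrite fv.1 // du.(d_ny).
  + by move=> v c cn fv ic _ /=; rewrite ic !fv.1 // ik ju du.(d_ny) fv.2.
  move=> v tv fv hv1 _ ttv; hseq; hset; rewrite /=.
  set w := setr v _ _ _.
  have fw : frame [:: cK] [:: rFa; rFe] u w by apply: frame_setr => //; apply: frame_sub fv.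
  have wa : rarr ny (rmem w rFa) = lsubmx h.
    apply/rowP => c; rewrite !mxE /= /upd /=.
    by rewrite -[X in rmem _ _ X]add0n hv1 // (hu.2 j (lshift 1 c) jH).
  have we : rarr 1 (rmem w rFe) = - rsubmx h.
    apply/rowP => c; rewrite (ord1 c) !mxE /= /upd /= !fv.1 // ik ju du.(d_ny) sub0r fv.2 //; congr (- _).
    have := hu.2 j (rshift ny ord0) jH; rewrite /= addn0 => ->.
    by congr (_ _ _ _); rewrite ?ord1.
  clearbody w.
  have pw : nmem w vp 0%N = ny by rewrite fw.1.
  have ew : nmem w ve 0%N = 1%N by rewrite fw.1.
  hseq; apply: ht_mono (elim_ok pw ew) => x tx [fx ttx ax ex].
  rewrite wa we fw.2 // Vk in ex.
  have Fx : frame nsFlat rsFlat u x.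
    by apply: (@frame_trans _ _ _ _ w); [apply: frame_sub fw|apply: frame_sub fx].
  have kx : nmem x cD 0%N = k by rewrite fx.1 // fw.1.
  have acx : nmem x aAct = nmem u aAct by rewrite fx.1 // fw.1.
  have Usx : rmem x rUs = rmem u rUs by rewrite fx.2 // fw.2.
  have px : nmem x vp 0%N = ny by rewrite fx.1.
  have exx : nmem x ve 0%N = 1%N by rewrite fx.1.
  have dx : data x by apply: data_frame Fx du.
  hseq; hset; rewrite /= kx; set y := setn x _ _ _.
  have fy : frame [:: aAct] [::] x y by apply: frame_setn.
  have ya : nmem y aAct k = nmem x vpv 0%N by rewrite /= /upd /= eqxx.
  have ya' i : (i < k)%N -> nmem y aAct i = nmem u aAct i.
    by move=> ik'; rewrite /= /upd /= ltn_eqF // acx.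
  clearbody y.
  apply: (@ht_fillr _ _ _ _ _ _ _ ny (k * ny) (fun c => rmem x rU c)).
  + by move=> z fz /=; rewrite fz.1 // fy.1 // dx.(d_ny).
  + by move=> z c cn fz ic _ /=; rewrite ic !fz.1 // !fy.1 // kx dx.(d_ny) fz.2 // fy.2.
  move=> z tz fz hz1 hz2 ttz; split.
  + by move: ttv ttx ttz g1 g3; rewrite /=; move: ((ny + 1).+1 ^ 2)%N (W ^ 2)%N => X Y; lia.
  + by rewrite fz.1 // fy.1.
  split.
  + apply: frame_setn => //; apply: (frame_trans fu); apply: (frame_trans Fx).
    by apply: (@frame_trans _ _ _ _ y); [apply: frame_sub fy|apply: frame_sub fz].
  + by rewrite /= /upd /= !fz.1 // !fy.1.
  + move=> i; rewrite ltnS leq_eqVlt /= /upd /= fz.1 // => /orP[/eqP->|ik'].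
      by rewrite ya.
    by rewrite ya' // au.
  exists (fun i => if i == k.+1 then marr ny (ny + 1) (rmem x rV) else Vs i); split.
  + by rewrite V0.
  + by rewrite eqxx /= fz.2 // fy.2.
  move=> i; rewrite ltnS leq_eqVlt eqSS => /orP[/eqP->|ik'].
    rewrite eqxx ltn_eqF //= /upd /= fz.1 // ya.
    rewrite (_ : carr _ _ = carr ny (rmem x rU)) //.
    by apply/colP => c; rewrite !mxE hz1.
  rewrite (ltn_eqF ik') ltn_eqF; last exact: ltn_trans ik' _.
  rewrite /= /upd /= fz.1 // ya' //.
  rewrite (_ : carr _ _ = carr ny (fun c => rmem u rUs (i * ny + c)%N)); first exact: VS.
  apply/colP => c; rewrite !mxE hz2 ?fy.2 ?Usx //.
  have : (i.+1 * ny <= k * ny)%N by rewrite leq_mul2r ik' orbT.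
  by rewrite mulSn; case: c => /= *; lia.
- move=> u t [fu _ au [Vs [V0 Vk VS]]] _ tt; split => //; last by exists Vs.
  have : (D * (1300 * W ^ 2 + 2 + 11) <= ny * (1313 * W ^ 2))%N by apply: leq_mul => //; lia.
  have : ((ny + 1) * W ^ 2 <= W ^ 3)%N by rewrite (expnS W 2) leq_mul2r addn1 g2 orbT.
  move: tt tt2 g1 g3; rewrite /=; move: ((ny + 1).+1 ^ 2)%N (W ^ 2)%N (W ^ 3)%N => X Y Z.
  rewrite (mulnCA ny) mulnDl; lia.
Qed.

Lemma denom_gt0 (al be : R) : 0 < 1 + al * al + be * be.
Proof. by rewrite -!expr2 -addrA ltr_pwDl // addr_ge0 // sqr_ge0. Qed.

(** With x = |al| and y = |be|, the inequality x y <= x^2 + y^2 gives x (x y) < x (1 + x^2 +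
    y^2). *)
Lemma eps_bound (al be : R) : al != 0 -> al * al / (1 + al * al + be * be) * `|be| < `|al|.
Proof.
move=> a0; have h := denom_gt0 al be.
rewrite mulrAC ltr_pdivrMr // -!expr2 -(real_normK (num_real al)) -(real_normK (num_real be)).
have : 0 < `|al| by rewrite normr_gt0.
have : 0 <= `|be| by [].
move: (`|al|) (`|be|) => x y hy hx.
have h1 : x * y <= x ^+ 2 + y ^+ 2 by have := sqr_ge0 (x - y); have := mulr_ge0 (ltW hx) hy; rewrite sqrrB mulr2n; lra.
have -> : x ^+ 2 * y = x * (x * y) by rewrite expr2 mulrA.
by rewrite ltr_pM2l //; lra.
Qed.

Lemma eps_ok s i : data s -> holds_hs hs s -> nmem s vi 0%N = i ->
  let p := carr ny (rmem s rP) in let U := carr ny (fun c => rmem s rUs (i * ny + c)%N) in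
  ht Eps s (fun s' t => [/\ frame [:: cS; cJ] [:: rAcc; rAl; rEps; rQ] s s',
    (t <= H.+1 * (400 * W))%N, 0 < rmem s' rEps 0%N &
    forall h', h' \in hs -> hval h' p != 0 ->
      rmem s' rEps 0%N * `|(lsubmx h' *m U) 0 0| < `|hval h' p|]).
Proof.
move=> d hh hi p U; hseq; hset.
have g0 : (ny + 2 <= W)%N by rewrite /dimW; lia.
apply: (@ht_forT _ _ _ _ _ H (350 * W) (fun k u => [/\ frame [:: cS; cJ] [:: rAcc; rAl; rEps; rQ] s u,
   0 < rmem u rEps 0%N & forall j, (j < k)%N -> hval (nth 0 hs j) p != 0 ->
      rmem u rEps 0%N * `|(lsubmx (nth 0 hs j) *m U) 0 0| < `|hval (nth 0 hs j) p|])).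
- split; [by apply: frame_setn => //; apply: frame_setr|by rewrite /= /upd /= ltr01|by []].
- by move=> k u [fu _ _] /=; rewrite fu.1 // hh.1.
- move=> k u kH [fu eu hu] ik.
  have du : data u by apply: data_frame fu d.
  have hhu : holds_hs hs u by apply: holds_frame fu hh.
  hseq; apply: ht_mono (eval_ok (pa := rP) du.(d_ny) hhu ik kH isT) => v tv [fv ttv av].
  rewrite fu.2 // -/p in av.
  hseq; apply: (@ht_sum _ _ _ _ _ _ ny (fun c => rmem u rHyp (k * (ny + 1) + c)%N * rmem u rUs (i * ny + c)%N)).
  + by move=> x fx /=; rewrite fx.1 // fv.1 // du.(d_ny).
  + move=> x c cn fx ic /=; rewrite ic !fx.1 // !fv.1 // ik du.(d_ny) !fx.2 // !fv.2 //.
    by rewrite (fu.1 vi) // hi.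
  move=> x tx fx hx ttx.
  have hb : rmem x rAcc 0%N = (lsubmx (nth 0 hs k) *m U) 0 0.
    rewrite hx big_mkord mxE; apply: eq_bigr => c _; rewrite !mxE (hhu.2 k (lshift 1 c) kH).
    by rewrite (fu.2 rUs).
  have ha : rmem x rAl 0%N = hval (nth 0 hs k) p by rewrite fx.2.
  have Fx : frame [:: cS; cJ] [:: rAcc; rAl; rEps; rQ] u x.
    by apply: (@frame_trans _ _ _ _ v); [apply: frame_sub fv|apply: frame_sub fx].
  have ex : rmem x rEps = rmem u rEps by rewrite fx.2 // fv.2.
  have ikx : nmem x cJ 0%N = k by rewrite fx.1 // fv.1.
  hseq; hset; hseq; hset; apply: ht_if; rewrite /= /upd /= ha hb ex.
  set al := hval _ p in av ha *; set be := (_ *m U) 0 0 in hb *.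
  have T : (tv + (tx + 100) <= 350 * W)%N by move: ttv ttx; rewrite /=; lia.
  have Fu : frame [:: cS; cJ] [:: rAcc; rAl; rEps; rQ] s x by apply: frame_trans fu Fx.
  have al2 : (al * al <= 0) = (al == 0).
    by rewrite -expr2 (le_eqVlt (al ^+ 2)) sqrf_eq0 ltNge sqr_ge0 orbF.
  rewrite al2; case: ifP => [/andP[al0 qe]|qe].
    hset; split; [by rewrite /=; lia|by rewrite /= /upd|].
    split.
    + by apply: frame_setn => //; do 3!apply: frame_setr => //.
    + rewrite /= /upd /=; apply: divr_gt0; last exact: denom_gt0.
      by rewrite lt_def -expr2 sqr_ge0 sqrf_eq0 al0.
    move=> j; rewrite ltnS leq_eqVlt /= /upd /= => /orP[/eqP-> _|jk j0].
      exact: eps_bound.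
    by apply: le_lt_trans (hu j jk j0); apply: ler_wpM2r.
  hset; split; [by rewrite /=; lia|by rewrite /= /upd|].
  split.
  + by apply: frame_setn => //; do 2!apply: frame_setr => //.
  + by rewrite /= /upd /= ex.
  move=> j; rewrite ltnS leq_eqVlt /= /upd /= ex => /orP[/eqP-> al0|jk j0]; last exact: hu.
  apply: le_lt_trans (eps_bound be al0); apply: ler_wpM2r => //.
  by move: qe; rewrite al0 /= => /negbT; rewrite -ltNge => /ltW.
- move=> u t [fu eu hu] _ tt; split => //; first by move: tt; rewrite /=; nia.
  by move=> h' /(nthP 0)[j jH <-]; apply: hu.
Qed.

Definition digs s D := [seq (nmem s aDj i, nmem s aDs i) | i <- iota 0 D].

Definition nsSmp := [:: cJ; vi] ++ nsFlat.
Definition rsSmp := [:: rP; rEps; rAl; rQ] ++ rsFlat.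

Lemma sample_ok s D : data s -> holds_hs hs s -> nmem s vD 0%N = D -> (D <= ny)%N ->
  (forall i, (i < D)%N -> (nmem s aDj i < H)%N) ->
  ht Sample s (fun s' t => [/\ frame nsSmp rsSmp s s', (t <= H.+1 * (4000 * W ^ 3))%N &
    smp hs (row_mx 1%:M 0) (digs s D) (carr ny (rmem s' rP))]).
Proof.
move=> d hh hD Dny hdj; hseq.
apply: ht_mono (flat_ok d hh hD Dny hdj) => s1 t1 [f1 tt1 a1 [Vs [V0 VD VS]]].
have d1 : data s1 by apply: data_frame f1 d.
have h1 : holds_hs hs s1 by apply: holds_frame f1 hh.
have F1 : frame nsSmp rsSmp s s1 by apply: frame_sub f1.
hseq; apply: (@ht_fillr _ _ _ _ _ _ _ ny 0 (fun c => rmem s1 rV (c * (ny + 1) + ny)%N)).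
- by move=> u fu /=; rewrite fu.1 // d1.(d_ny).
- by move=> u c cn fu ic _ /=; rewrite ic !fu.1 // d1.(d_ny) fu.2.
move=> s2 t2 f2 p2 _ tt2.
have g0 : (ny + 2 <= W)%N by rewrite /dimW; lia.
pose ds := digs s D.
have sds : size ds = D by rewrite size_map size_iota.
(* After [k] passes the last [k] digits have been realised: the parametrisations [Vs] were produced
   in forward order and are used backwards. *)
apply: (@ht_forT _ _ _ _ _ D (H.+1 * (600 * W)) (fun k u => [/\ frame nsSmp rsSmp s s2 /\ frame [:: cK; cD; vi; cS; cJ] [:: rP; rAcc; rAl; rEps; rQ] s2 u, (k <= D)%N &
  smp hs (Vs (D - k)%N) (drop (D - k) ds) (carr ny (rmem u rP))])).
- split => //.
    by split; [apply: (frame_trans F1); apply: frame_sub f2|apply: frame_setn].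
  by rewrite subn0 drop_oversize ?sds //= -VD; apply/colP => c; rewrite !mxE /= -[X in rmem _ _ X]add0n p2 // addn0.
- by move=> k u [[fs2 fu] _ _] /=; rewrite fu.1 // fs2.1 // hD.
- move=> k u kD [[fs2 fu] _ hu] ik.
  hseq; hset; rewrite /= ik (fu.1 vD) // (fs2.1 vD) // hD.
  set i := (D - 1 - k)%N.
  have iD : (i < D)%N by rewrite /i; lia.
  have Dk : (D - k = i.+1)%N by rewrite /i; lia.
  have Dk1 : (D - k.+1 = i)%N by rewrite /i; lia.
  rewrite Dk in hu; rewrite Dk1.
  set v := setn u vi 0 i.
  have fv : frame [:: cK; cD; vi; cS; cJ] [:: rP; rAcc; rAl; rEps; rQ] s2 v by apply: frame_setn.
  have Fv : frame nsSmp rsSmp s v by apply: (frame_trans fs2); apply: frame_sub fv.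
  have dv : data v by apply: data_frame Fv d.
  have hv : holds_hs hs v by apply: holds_frame Fv hh.
  have iv : nmem v vi 0%N = i by [].
  have kv : nmem v cD 0%N = k by [].
  have pv : rmem v rP = rmem u rP by [].
  clearbody v.
  have acv : nmem v aAct = nmem s1 aAct by rewrite fv.1 // f2.1.
  have dsv : nmem v aDs = nmem s aDs by rewrite Fv.1.
  have Usv : rmem v rUs = rmem s1 rUs by rewrite fv.2 // f2.2.
  have dE : drop i ds = (nmem s aDj i, nmem s aDs i) :: drop i.+1 ds.
    rewrite (drop_nth (0, 0)%N) ?sds //; congr (_ :: _).
    by rewrite (nth_map 0%N) ?size_iota // nth_iota.
  apply: ht_if; rewrite /= iv acv; have := VS i iD; have := a1 i iD.
  case E : (nmem s1 aAct i) => [|[|//]] _ /= el.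
    hset; split; [by rewrite /=; nia|by []|]; split; [by split => //; apply: frame_setn|by []|].
    rewrite dE /=; exists false, (carr ny (fun c => rmem s1 rUs (i * ny + c)%N)), (Vs i.+1); split => //.
    by rewrite pv.
  hseq; apply: ht_mono (eps_ok dv hv iv) => w tw [fw ttw ew hw].
  have dw : data w by apply: data_frame fw dv.
  pose sg := nmem s aDs i.
  apply: (@ht_fillr _ _ _ _ _ _ _ ny 0 (fun c => rmem v rP c +
      (sg%:R - 1) * rmem w rEps 0%N * rmem s1 rUs (i * ny + c)%N)).
  + by move=> x fx /=; rewrite fx.1 // dw.(d_ny).
  + move=> x c cn fx ic hx /=; rewrite ic !fx.1 // !(fw.1 vi) // iv dw.(d_ny) hx; last by rewrite leqnn orbT.
    by rewrite !fx.2 // (fw.2 rP) // (fw.2 rUs) // Usv (fw.1 aDs) // dsv.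
  move=> x tx fx hx _ ttx.
  split.
  + by move: ttw ttx; rewrite /=; nia.
  + by rewrite fx.1 // fw.1.
  split => //.
    split => //; apply: frame_setn => //; apply: (frame_trans fv).
    by apply: (@frame_trans _ _ _ _ w); [apply: frame_sub fw|apply: frame_sub fx].
  rewrite dE /=; exists true, (carr ny (fun c => rmem s1 rUs (i * ny + c)%N)), (Vs i.+1); split => //.
  exists (carr ny (rmem u rP)), (rmem w rEps 0%N); split => //.
  + by rewrite -pv -Usv.
  + by apply/colP => c; rewrite !mxE -[X in rmem _ _ X]add0n hx // pv.
- move=> u t [[fs2 fu] _ hu] _ tt; split.
  + by apply: (frame_trans fs2); apply: frame_sub fu.
  + have W3 : (W * W <= W ^ 3)%N by rewrite mulnn leq_pexp2l // dimW_gt0.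
    have : (D * (H.+1 * (600 * W) + 2 + 11) <= W * (H.+1 * (613 * W)))%N.
      apply: leq_mul; first by lia.
      have : (W <= H.+1 * W)%N by rewrite leq_pmull.
      by rewrite !(mulnCA H.+1); lia.
    rewrite (mulnCA W) (mulnCA W 613).
    have : (H.+1 * (613 * (W * W)) <= H.+1 * (613 * W ^ 3))%N by do 2!apply: leq_mul => //.
    have : (W ^ 3 <= H.+1 * W ^ 3)%N by rewrite leq_pmull.
    have : (W <= W ^ 3)%N by rewrite -{1}[W]expn1 leq_pexp2l // dimW_gt0.
    move: tt tt1 tt2; rewrite /= !(mulnCA H.+1); move: (W ^ 3)%N => Z; lia.
  + by move: hu; rewrite subnn drop0 V0.
Qed.

End Data.
End Smp.

(** * Point location *)

Notation vnode := 33%N (only parsing).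
Notation vncnt := 34%N (only parsing).
Notation vtmp := 43%N (only parsing).
Notation aTr := 56%N (only parsing).
Notation aLf := 57%N (only parsing).
Notation aSg := 58%N (only parsing).

Section TrieMath.

(** [nodes] lists the words of the nodes in order of creation, so a node number is a position in
    this list. Node k has its three child cells at 3k, 3k + 1 and 3k + 2; the value 0 can mean
    absence because the root is nobody's child. *)
Record trie (T : nat -> nat) (nodes : seq (seq nat)) : Prop := Trie {
  tr_uniq : uniq nodes;
  tr_root : nth [::] nodes 0 = [::] /\ (0 < size nodes)%N;
  tr_closed : forall w d, rcons w d \in nodes -> w \in nodes;
  tr_child : forall k d, (k < size nodes)%N -> (d < 3)%N ->
    T (3 * k + d)%N = let x := rcons (nth [::] nodes k) d in
                      if x \in nodes then index x nodes else 0%N;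
  tr_out : forall k, (3 * size nodes <= k)%N -> T k = 0%N }.

Lemma trie0 : trie (fun=> 0%N) [:: [::]].
Proof.
split => //.
- by move=> w d; rewrite inE => /eqP; case: w.
- by move=> [|//] d _ _.
Qed.

Lemma trie_child_gt0 T nodes k d : trie T nodes -> (k < size nodes)%N -> (d < 3)%N ->
  (0 < T (3 * k + d))%N = (rcons (nth [::] nodes k) d \in nodes).
Proof.
move=> tr kn dn; rewrite tr.(tr_child) //=; case: ifP => // xn.
rewrite lt0n; apply/negP => /eqP i0; have := nth_index [::] xn; rewrite i0.
by rewrite tr.(tr_root).1; case: (nth _ _ k).
Qed.

Definition updT (T : nat -> nat) i v := fun i' => if i' == i then v else T i'.

Lemma trie_add T nodes k d : trie T nodes -> (k < size nodes)%N -> (d < 3)%N ->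
  rcons (nth [::] nodes k) d \notin nodes ->
  trie (updT T (3 * k + d) (size nodes)) (rcons nodes (rcons (nth [::] nodes k) d)).
Proof.
move=> tr kn dn; set w := nth [::] nodes k; set x := rcons w d => xn.
have [r0 n0] := tr.(tr_root).
split.
- by rewrite rcons_uniq xn tr.(tr_uniq).
- by rewrite size_rcons nth_rcons n0.
- move=> v c; rewrite !mem_rcons !in_cons => /orP[/eqP/rcons_inj[-> _]|/tr.(tr_closed)->]; last by rewrite orbT.
  by rewrite mem_nth // orbT.
- move=> k' d'; rewrite size_rcons ltnS leq_eqVlt => /orP[/eqP->|k'n] d'n; rewrite /updT /=.
    have -> : (3 * size nodes + d' == 3 * k + d)%N = false by lia.
    rewrite tr.(tr_out); last by lia.
    rewrite nth_rcons ltnn eqxx mem_rcons in_cons ifN //.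
    rewrite negb_or; apply/andP; split.
      by apply/eqP => /(congr1 size); rewrite size_rcons; lia.
    by apply: contra xn => /tr.(tr_closed).
  rewrite nth_rcons k'n mem_rcons in_cons.
  case: (eqVneq (3 * k' + d')%N (3 * k + d)%N) => [E|E].
    have -> : k' = k by lia.
    have -> : d' = d by lia.
    by rewrite -/w -/x eqxx /= -cats1 index_cat (negbTE xn) /= eqxx addn0.
  rewrite (negbTE (_ : rcons (nth [::] nodes k') d' != x)) /=; last first.
    apply: contra E => /eqP/rcons_inj[/eqP]; rewrite nth_uniq ?tr.(tr_uniq) // => /eqP-> ->.
    by [].
  by rewrite tr.(tr_child) //=; case: ifP => // h; rewrite -(cats1 nodes) index_cat h.
- by move=> j; rewrite size_rcons /updT => hj; rewrite ifN ?tr.(tr_out) //; lia.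
Qed.

(** Chamber numbers are stored increased by one, so a cell that is still zero means that no chamber
    ends at the node. *)
Definition leaf (F : nat -> nat) (nodes svs : seq (seq nat)) :=
  {subset svs <= nodes} /\
  forall k, F k = if (k < size nodes)%N && (nth [::] nodes k \in svs)
                  then (index (nth [::] nodes k) svs).+1 else 0%N.

Lemma leaf_add F nodes svs x : leaf F nodes svs -> x \notin nodes -> leaf F (rcons nodes x) svs.
Proof.
move=> [sub h] xn; split => [w /sub|k]; first by rewrite mem_rcons in_cons => ->; rewrite orbT.
rewrite h size_rcons ltnS nth_rcons; case: ltngtP => //= _.
by rewrite ifN //; apply: contra xn => /sub.
Qed.

Lemma leaf_new F nodes svs k : leaf F nodes svs -> uniq nodes -> (k < size nodes)%N ->
  nth [::] nodes k \notin svs ->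
  leaf (updT F k (size svs).+1) nodes (rcons svs (nth [::] nodes k)).
Proof.
move=> [sub h] un kn xn; split => [w|k'].
  by rewrite mem_rcons in_cons => /orP[/eqP->|/sub //]; rewrite mem_nth.
rewrite /updT; case: eqP => [->|/eqP kk].
  by rewrite kn mem_rcons in_cons eqxx /= -cats1 index_cat (negbTE xn) /= eqxx addn0.
rewrite h; case: (ltnP k' _) => //= k'n; rewrite mem_rcons in_cons nth_uniq // (negbTE kk) /=.
by case: ifP => // hh; rewrite -cats1 index_cat hh.
Qed.

End TrieMath.

Definition Insert : cmd :=
  sv vnode (NConst 0) ;;
  For cJ (gv vH)
    (Eval rP ;;
     If (BRle (rv rAl) (RNat (NConst 0)))
       (If (BRle (RNat (NConst 0)) (rv rAl))
          (NSet aSg (gv cJ) (NConst 1)) (NSet aSg (gv cJ) (NConst 0)))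
       (NSet aSg (gv cJ) (NConst 2)) ;;
     sv vtmp (NAdd (NMul (NConst 3) (gv vnode)) (NGet aSg (gv cJ))) ;;
     If (BNle (NGet aTr (gv vtmp)) (NConst 0))
       (sv vncnt (NAdd (gv vncnt) (NConst 1)) ;; NSet aTr (gv vtmp) (gv vncnt)) Skip ;;
     sv vnode (NGet aTr (gv vtmp))).

Definition Query : cmd :=
  sv vnode (NConst 0) ;;
  For cJ (gv vH)
    (Eval 3 ;;
     If (BRle (rv rAl) (RNat (NConst 0)))
       (If (BRle (RNat (NConst 0)) (rv rAl)) (sv vtmp (NConst 1)) (sv vtmp (NConst 0)))
       (sv vtmp (NConst 2)) ;;
     sv vnode (NGet aTr (NAdd (NMul (NConst 3) (gv vnode)) (gv vtmp)))) ;;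
  sv 4 (NSub (NGet aLf (gv vnode)) (NConst 1)).

Section Trie.
Variable R : realType.
Implicit Types (s : state R).
Variables (ny : nat) (hs : seq 'rV[R]_(ny + 1)).
Notation H := (size hs).

(** The digits 0, 1, 2 for negative, zero and positive serve as child numbers in the trie and agree
    with the side digits of the enumeration. *)
Definition sgd (x : R) : nat := if x <= 0 then (if 0 <= x then 1%N else 0%N) else 2%N.

Definition svec (y : 'cV[R]_ny) := [seq sgd (hval h y) | h <- hs].

Lemma sgd_lt3 x : (sgd x < 3)%N. Proof. by rewrite /sgd; do 2?case: ifP. Qed.

Definition nsIns := [:: cS; cJ; vnode; vncnt; vtmp; aTr; aSg].

Lemma take_svecS j y : (j < H)%N ->
  take j.+1 (svec y) = rcons (take j (svec y)) (sgd (hval (nth 0 hs j) y)).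
Proof. by move=> jH; rewrite (take_nth 0%N) ?size_map // (nth_map 0). Qed.

Lemma insert_ok s nodes svs : nmem s 0%N 2%N = ny -> holds_hs hs s ->
  trie (nmem s aTr) nodes -> (nmem s vncnt 0%N).+1 = size nodes -> leaf (nmem s aLf) nodes svs ->
  let v := svec (carr ny (rmem s rP)) in
  ht Insert s (fun s' t => [/\ frame nsIns [:: rAcc; rAl] s s',
    (t <= H.+1 * (200 * ny.+1))%N,
    forall j, (j < H)%N -> nmem s' aSg j = nth 0%N v j &
    exists nodes', [/\ trie (nmem s' aTr) nodes', (nmem s' vncnt 0%N).+1 = size nodes',
      leaf (nmem s' aLf) nodes' svs, (nmem s' vnode 0%N < size nodes')%N &
      nth [::] nodes' (nmem s' vnode 0%N) = v]]).
Proof.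
move=> dny hh tr0 cn0 lf0 v; hseq; hset.
apply: (@ht_forT _ _ _ _ _ H (180 * ny.+1) (fun j u => [/\ frame nsIns [:: rAcc; rAl] s u,
  forall i, (i < j)%N -> nmem u aSg i = nth 0%N v i &
    exists nodes', [/\ trie (nmem u aTr) nodes', (nmem u vncnt 0%N).+1 = size nodes',
      leaf (nmem u aLf) nodes' svs, (nmem u vnode 0%N < size nodes')%N &
      nth [::] nodes' (nmem u vnode 0%N) = take j v]])).
- split => //; first by do 2!apply: frame_setn => //.
  have [r0 n0] := tr0.(tr_root).
  by exists nodes; split => //; rewrite take0.
- by move=> j u [fu _ _] /=; rewrite fu.1 // hh.1.
- move=> j u jH [fu gu [nd [tr cn lf nn nv]]] ij.
  have hu : holds_hs hs u by apply: holds_frame fu hh.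
  have du : nmem u 0%N 2%N = ny by rewrite fu.1.
  hseq; apply: ht_mono (eval_ok (pa := rP) du hu ij jH isT) => w tw [fw ttw aw].
  rewrite fu.2 // in aw.
  set d := sgd (hval (nth 0 hs j) (carr ny (rmem s rP))).
  have d3 : (d < 3)%N by apply: sgd_lt3.
  have Fw : frame nsIns [:: rAcc; rAl] s w by apply: (frame_trans fu); apply: frame_sub fw.
  have iw : nmem w cJ 0%N = j by rewrite fw.1.
  have dv : d = nth 0%N v j by rewrite (nth_map 0).
  hseq; apply: (@ht_mono _ _ _ (fun x t => x = setn w aSg j d /\ (t <= 20)%N)).
    2:{ apply: ht_if; rewrite /= aw; case: ifP => h1; last first.
          by hset; rewrite /= iw; split => //; rewrite /d /sgd h1.
        apply: ht_if; rewrite /= aw; case: ifP => h2.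
          by hset; rewrite /= iw; split => //; rewrite /d /sgd h1 h2.
        by hset; rewrite /= iw; split => //; rewrite /d /sgd h1 h2. }
  move=> _ tx [-> ttx]; hseq; hset; rewrite /= /upd /= iw eqxx /=.
  set k := nmem u vnode 0%N in nn nv.
  have kw : nmem w vnode 0%N = k by rewrite fw.1.
  rewrite kw; set x := setn _ vtmp _ _.
  have Fx : frame nsIns [:: rAcc; rAl] s x by do 2!apply: frame_setn => //.
  have trx : nmem x aTr = nmem u aTr by rewrite -(fw.1 aTr).
  have cnx : nmem x vncnt 0%N = nmem u vncnt 0%N by rewrite -(fw.1 vncnt).
  have lfx : nmem x aLf = nmem u aLf by rewrite -(fw.1 aLf).
  have jx : nmem x cJ 0%N = j by [].
  have tmpx : nmem x vtmp 0%N = (3 * k + d)%N by [].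
  have sgx i : (i < j.+1)%N -> nmem x aSg i = nth 0%N v i.
    rewrite ltnS leq_eqVlt /= /upd /= => /orP[/eqP->|ij']; first by rewrite eqxx.
    by rewrite ltn_eqF // fw.1 // gu.
  clearbody x.
  hseq; apply: (@ht_mono _ _ _ (fun y t => [/\ frame [:: vncnt; aTr] [::] x y, (t <= 40)%N &
    exists nodes', [/\ trie (nmem y aTr) nodes', (nmem y vncnt 0%N).+1 = size nodes',
      leaf (nmem y aLf) nodes' svs, (nmem y aTr (3 * k + d)%N < size nodes')%N &
      nth [::] nodes' (nmem y aTr (3 * k + d)%N) = take j.+1 v]])); last first.
    have tv : take j.+1 v = rcons (nth [::] nd k) d by rewrite nv take_svecS.
    apply: ht_if; rewrite /= tmpx trx leqNgt (trie_child_gt0 tr) //.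
    case: ifP => hx.
      hseq; hset; hset; split => //; first by do 2!apply: frame_setn => //.
      exists (rcons nd (rcons (nth [::] nd k) d)).
      rewrite /= /upd /= tmpx eqxx cnx addn1 size_rcons ltnS cn leqnn; split => //.
      + have := trie_add tr nn d3 hx; congr (trie _ _); apply/funext => i.
        by rewrite /updT trx.
      + by rewrite lfx; apply: leaf_add.
      + by rewrite nth_rcons ltnn eqxx tv.
    move/negbFE: hx => hx; hset; split => //; exists nd; rewrite trx cnx lfx; split => //.
      by rewrite tr.(tr_child) //= hx index_mem.
    by rewrite tr.(tr_child) //= hx nth_index.
  move=> y ty [fy tty [nd' [tr' cn' lf' nn' nv']]]; hset; split.
  + by move: ttw ttx tty; rewrite /=; lia.
  + by rewrite /= /upd /= fy.1.
  split.
  + do 2!apply: frame_setn => //; apply: (frame_trans Fx); by apply: frame_sub fy.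
  + by move=> i ij'; rewrite /= /upd /= fy.1 // sgx.
  by exists nd'; rewrite /= /upd /= (fy.1 vtmp) // tmpx.
- move=> u t [fu gu [nd [tr cn lf nn nv]]] _ tt; split => //.
    by move: tt; rewrite /=; nia.
  exists nd; split => //.
  by move: nv; rewrite take_oversize // size_map.
Qed.

Lemma query_ok s nodes svs y : nmem s 0%N 2%N = ny -> holds_hs hs s ->
  trie (nmem s aTr) nodes -> leaf (nmem s aLf) nodes svs ->
  carr ny (rmem s 3%N) = y -> svec y \in svs ->
  ht Query s (fun s' t => (t <= H.+1 * (200 * ny.+1))%N /\ nmem s' 4%N 0%N = index (svec y) svs).
Proof.
move=> dny hh tr lf yE yS; set v := svec y.
have vn : v \in nodes by apply: lf.1.
(* Every prefix of a stored word is a node, by removing letters from the end; hence the descent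
   never meets a missing child. *)
have tn j : take j v \in nodes.
  have [jH|jH] := leqP (size v) j; first by rewrite take_oversize.
  move: (ltnW jH); have E : (j = size v - (size v - j))%N by lia.
  move: (size v - j)%N E => i -> _ {j jH}.
  elim: i => [|i IH]; first by rewrite subn0 take_size.
  have [h|h] := ltnP i (size v); last by have -> : (size v - i.+1 = size v - i)%N by lia.
  apply: tr.(tr_closed) (nth 0%N v (size v - i.+1)) _; rewrite -take_nth; last by rewrite ltn_subrL /= (leq_ltn_trans _ h).
  by rewrite subnSK.
hseq; hset; hseq.
apply: (@ht_forT _ _ _ _ _ H (180 * ny.+1) (fun j u => [/\
  frame [:: cS; cJ; vnode; vtmp] [:: rAcc; rAl] s u &
  nmem u vnode 0%N = index (take j v) nodes])).
- split; first by do 2!apply: frame_setn => //.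
  rewrite /= /upd /= take0; have [r0 n0] := tr.(tr_root).
  by rewrite -{1}r0 index_uniq // tr.(tr_uniq).
- by move=> j u [fu _] /=; rewrite fu.1 // hh.1.
- move=> j u jH [fu nu] ij.
  have hu : holds_hs hs u by apply: holds_frame fu hh.
  have du : nmem u 0%N 2%N = ny by rewrite fu.1.
  hseq; apply: ht_mono (eval_ok (pa := 3) du hu ij jH isT) => w tw [fw ttw aw].
  rewrite fu.2 // yE in aw.
  set d := sgd (hval (nth 0 hs j) y).
  have d3 : (d < 3)%N by apply: sgd_lt3.
  have Fw : frame [:: cS; cJ; vnode; vtmp] [:: rAcc; rAl] s w by apply: (frame_trans fu); apply: frame_sub fw.
  have iw : nmem w cJ 0%N = j by rewrite fw.1.
  hseq; apply: (@ht_mono _ _ _ (fun x t => x = setn w vtmp 0 d /\ (t <= 20)%N)).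
    2:{ apply: ht_if; rewrite /= aw; case: ifP => h1; last first.
          by hset; rewrite /=; split => //; rewrite /d /sgd h1.
        apply: ht_if; rewrite /= aw; case: ifP => h2.
          by hset; rewrite /=; split => //; rewrite /d /sgd h1 h2.
        by hset; rewrite /=; split => //; rewrite /d /sgd h1 h2. }
  move=> _ tx [-> ttx]; hset; split.
  + by move: ttw ttx; rewrite /=; lia.
  + by rewrite /= /upd.
  split; first by do 3!apply: frame_setn => //.
  rewrite /= /upd /= (fw.1 vnode) // nu (fw.1 aTr) // (fu.1 aTr) // tr.(tr_child) ?index_mem //=.
  by rewrite nth_index // /v -take_svecS // tn.
- move=> u t [fu nu] _ tt; hset; split; first by move: tt; rewrite /=; nia.
  rewrite /= /upd /= nu fu.1 // lf.2 take_oversize ?size_map //.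
  by rewrite index_mem vn nth_index // yS subn1.
Qed.

End Trie.

(** * Output of a chamber *)

Notation vnb := 35%N (only parsing).
Notation vpos := 36%N (only parsing).
Notation vpos0 := 37%N (only parsing).
Notation vrp := 38%N (only parsing).
Notation vN := 39%N (only parsing).
Notation vok := 42%N (only parsing).
Notation vjj := 44%N (only parsing).
Notation rS := 14%N (only parsing).

Definition sr x e := RSet x (NConst 0) e.
Definition rneg1 := RSub (RNat (NConst 0)) (RNat (NConst 1)).
Definition eH2 := NMul (NConst 2) (gv vH).
Definition eOut j k := NAdd (NAdd (gv vrp) (NMul (gv j) eny1)) k.

(** Two rows are written per hyperplane whatever its sign: for sign zero they are opposite
    inequalities, otherwise the same inequality appears twice. Thus every chamber has 2H
    inequalities. *)
Definition Rows : cmd :=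
  For cJ eH2
    (If (BNle (NAdd (gv cJ) (NConst 1)) (gv vH))
       (sv vjj (gv cJ) ;;
        If (BNle (NGet aSg (gv vjj)) (NConst 1)) (sr rS (RNat (NConst 1))) (sr rS rneg1))
       (sv vjj (NSub (gv cJ) (gv vH)) ;;
        If (BNle (NConst 1) (NGet aSg (gv vjj))) (sr rS rneg1) (sr rS (RNat (NConst 1)))) ;;
     For cK eny (RSet 4 (eOut cJ (gv cK)) (RMul (rv rS) (eHyp (gv vjj) (gv cK)))) ;;
     RSet 4 (eOut cJ eny) (RMul (rv rS) (RSub (RNat (NConst 0)) (eHyp (gv vjj) eny)))).

(** Feasibility of a parametric vertex is tested only at the sample point; that the answer holds on
    the whole cell is a property of the arrangement. *)
Definition Check : cmd :=
  sv vok (NConst 1) ;;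
  For cI em
    ((LoadRow ;; Row) ;;
     Sum rAcc cS eny (RMul (RGet rR (NAdd enx (gv cS))) (RGet rP (gv cS))) ;;
     If (BRle (RAdd (rv rAcc) (RGet rR (NAdd enx eny))) (RNat (NConst 0)))
       Skip (sv vok (NConst 0))).

Definition Emit : cmd :=
  For cI em
    (If (BNle (NConst 1) (NGet aPM (gv cI)))
      (NSet 3 (gv vpos) (gv cI) ;; sv vpos (NAdd (gv vpos) (NConst 1))) Skip) ;;
  For cU enx (For cK eny1
    (RSet 4 (eOut cU (gv cK)) (RGet rV (NAdd (NMul (gv cU) eW) (NAdd enx (gv cK)))))) ;;
  sv vrp (NAdd (gv vrp) (NMul enx eny1)) ;; sv vnb (NAdd (gv vnb) (NConst 1)).

Definition Bases : cmd :=
  sv vptr (NConst 0) ;;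
  For cQ eL
    (Read 1 ;; Reduce ;;
     If BFull (Check ;; If (BNle (NConst 1) (gv vok)) Emit Skip) Skip).

(** The number of bases is known only at the end, so its cell is reserved and filled last. *)
Definition Chamb : cmd :=
  NSet 3 (gv vpos) eH2 ;; sv vpos0 (gv vpos) ;; sv vpos (NAdd (gv vpos) (NConst 2)) ;;
  sv vnb (NConst 0) ;; Rows ;; sv vrp (NAdd (gv vrp) (NMul eH2 eny1)) ;; Bases ;;
  NSet 3 (NAdd (gv vpos0) (NConst 1)) (gv vnb).

Section StoresAt.
Variable T : Type.

Definition stores_at (arr : nat -> T) base (l : seq T) :=
  forall x0 i, (i < size l)%N -> arr (base + i)%N = nth x0 l i.

Lemma stores_at_cat arr base l1 l2 :
  stores_at arr base l1 -> stores_at arr (base + size l1) l2 -> stores_at arr base (l1 ++ l2).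
Proof.
move=> h1 h2 x0 i; rewrite size_cat nth_cat => hi; case: ltnP => il; first exact: h1.
by rewrite -h2; [congr arr|]; lia.
Qed.

Lemma stores_at_ext arr arr' base l :
  (forall j, (base <= j < base + size l)%N -> arr' j = arr j) ->
  stores_at arr base l -> stores_at arr' base l.
Proof. by move=> h hs x0 i il; rewrite h; [exact: hs|rewrite leq_addr ltn_add2l]. Qed.

Lemma size_mxseq m n (M : 'M[T]_(m, n)) : size (mxseq M) = (m * n)%N.
Proof. by rewrite size_allpairs !size_enum_ord. Qed.

Lemma nth_mxseq m n (M : 'M[T]_(m, n)) x0 (i : 'I_m) (j : 'I_n) :
  nth x0 (mxseq M) (i * n + j) = M i j.
Proof.
have gen (r : seq 'I_m) k : (k < size r)%N ->
    nth x0 [seq M i j | i <- r, j <- enum 'I_n] (k * n + j) = M (nth i r k) j.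
  elim: r k => //= a r IH [|k] kr.
    by rewrite mul0n add0n nth_cat size_map size_enum_ord ltn_ord (nth_map j) ?size_enum_ord // nth_ord_enum.
  rewrite nth_cat size_map size_enum_ord mulSn -addnA ltnNge leq_addr /= addKn; exact: IH.
by rewrite gen ?size_enum_ord // nth_ord_enum.
Qed.

Lemma stores_mx m n (M : 'M[T]_(m, n)) arr base :
  (forall (i : 'I_m) (j : 'I_n), arr (base + i * n + j)%N = M i j) -> stores_at arr base (mxseq M).
Proof.
move=> h x0 k; rewrite size_mxseq => km.
have n0 : (0 < n)%N by case: n {M h} km => //; rewrite muln0.
have im : (k %/ n < m)%N by rewrite ltn_divLR.
have jn : (k %% n < n)%N by rewrite ltn_mod.
have := h (Ordinal im) (Ordinal jn); rewrite -(nth_mxseq M x0 (Ordinal im) (Ordinal jn)) /=.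
by rewrite -addnA -divn_eq.
Qed.

End StoresAt.

Section Out.
Variable R : realType.
Implicit Types (s : state R).
Variables (m nx ny : nat) (A : 'M[R]_(m, nx)) (B : 'M[R]_(m, ny)) (b : 'cV[R]_m).
Variables (L L' : seq (seq 'I_m)).
Hypothesis uL : all uniq L.
Notation data := (data A B b L L').
Notation BB := (BB B b).
Variable hs : seq 'rV[R]_(ny + 1).
Notation W := (dimW m nx ny).
Notation H := (size hs).

Definition jjf r := if (r < H)%N then r else (r - H)%N.
Definition alpha (v : seq nat) r : R :=
  if (r < H)%N then (if (nth 0%N v r <= 1)%N then 1 else -1)
  else (if (1 <= nth 0%N v (r - H))%N then -1 else 1).
Definition rowsM (v : seq nat) : 'M[R]_(2 * H, ny + 1) :=
  \matrix_(r, k) (alpha v r * (row_mx (lsubmx (nth 0 hs (jjf r))) (- rsubmx (nth 0 hs (jjf r)))) 0 k).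

Lemma rows_ok s v rp : data s -> holds_hs hs s -> nmem s vrp 0%N = rp ->
  (forall j, (j < H)%N -> nmem s aSg j = nth 0%N v j) ->
  ht Rows s (fun s' t => [/\ frame [:: cJ; cK; vjj] [:: rS; 4%N] s s',
    (t <= H.+1 * (200 * W))%N,
    forall j, (j < rp)%N -> rmem s' 4%N j = rmem s 4%N j &
    stores_at (rmem s' 4%N) rp (mxseq (rowsM v))]).
Proof.
move=> d hh hrp hv.
have g0 : (ny + 2 <= W)%N by rewrite /dimW; lia.
apply: (@ht_forT _ _ _ _ _ (2 * H) (90 * W) (fun r u => [/\ frame [:: cJ; cK; vjj] [:: rS; 4%N] s u,
    forall j, (j < rp)%N -> rmem u 4%N j = rmem s 4%N j &
    forall (i : 'I_(2 * H)) (k : 'I_(ny + 1)), (i < r)%N ->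
      rmem u 4%N (rp + i * (ny + 1) + k)%N = rowsM v i k])).
- by split => //; apply: frame_setn.
- by move=> r u [fu _ _] /=; rewrite fu.1 // hh.1.
- move=> r u rH [fu lu gu] ir.
  have du : data u by apply: data_frame fu d.
  have hu : holds_hs hs u by apply: holds_frame fu hh.
  hseq; apply: (@ht_mono _ _ _ (fun w t => [/\ frame [:: vjj] [:: rS] u w, (t <= 50)%N,
     nmem w vjj 0%N = jjf r & rmem w rS 0%N = alpha v r])); last first.
    apply: ht_if; rewrite /= ir addn1 hu.1 /jjf /alpha; case: ifP => rH'.
      hseq; hset; apply: ht_if; rewrite /= ir /upd /= fu.1 // hv //; case: ifP => h; hset.
        by split => //; apply: frame_setr => //; apply: frame_setn.
      split => //; first by apply: frame_setr => //; apply: frame_setn.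
      by rewrite /= /upd /= sub0r.
    have rH2 : (r - H < H)%N by move: rH rH' => /= *; lia.
    hseq; hset; apply: ht_if; rewrite /= ir hu.1 /upd /= fu.1 // hv //; case: ifP => h; hset.
      split => //; first by apply: frame_setr => //; apply: frame_setn.
      by rewrite /= /upd /= sub0r.
    by split => //; apply: frame_setr => //; apply: frame_setn.
  move=> w tw [fw ttw jw aw].
  have jH : (jjf r < H)%N by rewrite /jjf; case: ifP => // rH'; move: rH rH' => /= *; lia.
  set j := jjf r in jw jH; set h := nth 0 hs j.
  have Fw : frame [:: cJ; cK; vjj] [:: rS; 4%N] s w by apply: (frame_trans fu); apply: frame_sub fw.
  have dw : data w by apply: data_frame Fw d.
  have hw : holds_hs hs w by apply: holds_frame Fw hh.
  have rw : nmem w cJ 0%N = r by rewrite fw.1.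
  have rpw : nmem w vrp 0%N = rp by rewrite Fw.1.
  hseq; apply: (@ht_fillr _ _ _ _ _ _ _ ny (rp + r * (ny + 1)) (fun k => alpha v r * rmem w rHyp (j * (ny + 1) + k)%N)).
  + by move=> x fx /=; rewrite fx.1 // dw.(d_ny).
  + by move=> x k kn fx ik _ /=; rewrite ik !fx.1 // rpw rw jw dw.(d_ny) !fx.2 // aw.
  move=> x tx fx hx1 hx2 ttx; hset; split.
  + by move: ttw ttx; rewrite /=; lia.
  + by rewrite /= /upd /= fx.1.
  split.
  + apply: frame_setn => //; apply: frame_setr => //; apply: (frame_trans Fw); by apply: frame_sub fx.
  + move=> i irp; rewrite /= /upd /= !fx.1 // rw rpw dw.(d_ny).
    have -> : (i == rp + r * (ny + 1) + ny)%N = false by lia.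
    by rewrite hx2 ?fw.2 ?lu //; lia.
  move=> i k; rewrite ltnS leq_eqVlt /= /upd /= !fx.1 // rw rpw dw.(d_ny) jw !(fx.2 rHyp) // !(fx.2 rS) // => /orP[/eqP E|ilt].
    rewrite E [RHS]mxE E -/j -/h mxE; case: (splitP k) => l kl; rewrite kl.
      rewrite eqn_add2l ltn_eqF // hx1 // (hw.2 j (lshift 1 l) jH) -/h; congr (_ * _).
      by rewrite mxE.
    rewrite !ord1 addn0 eqxx aw sub0r !mxE; congr (_ * - _).
    have := hw.2 j (rshift ny ord0) jH; rewrite /= addn0 => ->.
    by congr (_ _ _ _); rewrite ?ord1.
  have lt : (rp + i * (ny + 1) + k < rp + r * (ny + 1))%N.
    have : (i.+1 * (ny + 1) <= r * (ny + 1))%N by rewrite leq_mul2r ilt orbT.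
    by rewrite mulSn; case: k => /= *; lia.
  by rewrite ltn_eqF ?hx2 ?lt ?fw.2 ?gu //; lia.
- move=> u t [fu lu gu] _ tt; split => //; first by move: tt; rewrite /=; nia.
  by apply: stores_mx => i k; rewrite gu.
Qed.

Definition okb (p : 'cV[R]_ny) (V : 'M[R]_(nx, nx + (ny + 1))) :=
  [forall i : 'I_m, hval (hrow A B b V i) p <= 0].

Lemma check_ok s V : data s -> nmem s vp 0%N = nx -> nmem s ve 0%N = (ny + 1)%N ->
  marr nx (nx + (ny + 1)) (rmem s rV) = V ->
  ht Check s (fun s' t => [/\ frame [:: cK; cS; cI; vok] [:: rFa; rFe; rAcc; rR] s s',
    (t <= 700 * W ^ 3)%N &
    nmem s' vok 0%N = okb (carr ny (rmem s rP)) V]).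
Proof.
move=> d hp he hV; hseq; hset; set p := carr _ _.
apply: (@ht_forT _ _ _ _ _ m (650 * W ^ 2) (fun q u => [/\ frame [:: cK; cS; cI; vok] [:: rFa; rFe; rAcc; rR] s u &
    nmem u vok 0%N = [forall i : 'I_m, (i < q)%N ==> (hval (hrow A B b V i) p <= 0)] ])).
- split; first by do 2!apply: frame_setn => //.
  by rewrite /= /upd /=; symmetry; apply/eqP; rewrite eqb1; apply/forallP.
- by move=> k u [fu *] /=; rewrite fu.1 // d.(d_m).
- move=> q u qm [fu hu] iq.
  have [i qi] : exists i : 'I_m, q = i by exists (Ordinal qm).
  rewrite qi in qm iq hu *; clear qi q.
  have du : data u by apply: data_frame fu d.
  have pu : nmem u vp 0%N = nx by rewrite fu.1.
  have eu : nmem u ve 0%N = (ny + 1)%N by rewrite fu.1.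
  have Vu : marr nx (nx + (ny + 1)) (rmem u rV) = V by rewrite fu.2.
  hseq; apply: ht_mono (rowcalc_ok du iq pu eu) => w tw [fw ttw rw].
  rewrite Vu in rw.
  have Fw : frame [:: cK; cS; cI; vok] [:: rFa; rFe; rAcc; rR] s w by apply: (frame_trans fu); apply: frame_sub fw.
  have dw : data w by apply: data_frame Fw d.
  hseq; apply: (@ht_sum _ _ _ _ _ _ ny (fun k => rmem w rR (nx + k)%N * rmem s rP k)).
  + by move=> x fx /=; rewrite fx.1 // dw.(d_ny).
  + by move=> x k kn fx ik /=; rewrite ik !fx.1 // dw.(d_nx) !fx.2 // (Fw.2 rP).
  move=> x tx fx hx ttx; apply: ht_if.
  have hv : rmem x rAcc 0%N + rmem x rR (nx + ny)%N = hval (hrow A B b V i) p.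
    rewrite hx big_mkord /hval mxE; congr (_ + _).
      by apply: eq_bigr => c _; rewrite [lsubmx _ _ _]mxE [p _ _]mxE -(hrowE (lshift 1 c) rw).
    rewrite fx.2 //; have := hrowE (rshift ny ord0) rw; rewrite /= addn0 => ->.
    by rewrite [RHS]mxE.
  rewrite /= !fx.1 // dw.(d_nx) dw.(d_ny) hv.
  have allE : [forall j : 'I_m, (j < i.+1)%N ==> (hval (hrow A B b V j) p <= 0)] =
     (hval (hrow A B b V i) p <= 0) && [forall j : 'I_m, (j < i)%N ==> (hval (hrow A B b V j) p <= 0)].
    apply/forallP/andP => [h|[h1 /forallP h2] j].
      split; first by have := h i; rewrite ltnSn.
      by apply/forallP => j; apply/implyP => ji; have := h j; rewrite ltnS (ltnW ji).
    by rewrite ltnS leq_eqVlt val_eqE; case: eqP => [->|_] //=; exact: h2.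
  have Fx : frame [:: cK; cS; cI; vok] [:: rFa; rFe; rAcc; rR] s x by apply: (frame_trans Fw); apply: frame_sub fx.
  have T : (tw + (tx + 20) <= 650 * W ^ 2)%N.
    move: ttw ttx (dimW_gt0 m nx ny) (dimW_sq m nx ny) (dimW_row m nx ny).
    have : (ny + 2 <= W)%N by rewrite /dimW; lia.
    rewrite /=; move: (W ^ 2)%N => Y; lia.
  case: ifP => h; hset.
    split; [by rewrite /=; lia|by rewrite fx.1 // fw.1|split; first by apply: frame_setn].
    by rewrite allE h /= /upd /= fx.1 // fw.1.
  split; [by rewrite /=; lia|by rewrite /= /upd /= fx.1 // fw.1|split; first by do 2!apply: frame_setn => //].
  by rewrite allE h.
- move=> u t [fu hu] _ tt; split => //.
    move: tt (dimW_gt0 m nx ny) (dimW_sq m nx ny) (dimW_loop m nx ny); rewrite /=.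
    move: (W ^ 2)%N (W ^ 3)%N => Y Z tt g1 g2 g4.
    have : (m * (650 * Y + 2 + 11) <= m * (663 * Y))%N by rewrite leq_mul2l; lia.
    rewrite (mulnCA m 663); lia.
  by rewrite hu; congr nat_of_bool; apply: eq_forallb => i; rewrite ltn_ord.
Qed.

Lemma emit_ok s (PM : {set 'I_m}) V pos rp nb : data s -> nmem s vp 0%N = nx -> nmem s ve 0%N = (ny + 1)%N ->
  marr nx (nx + (ny + 1)) (rmem s rV) = V -> (forall i : 'I_m, nmem s aPM i = (i \in PM)) ->
  nmem s vpos 0%N = pos -> nmem s vrp 0%N = rp -> nmem s vnb 0%N = nb ->
  ht Emit s (fun s' t => [/\ [/\ frame [:: cK; cU; cI; vpos; vrp; vnb; 3%N] [:: 4%N] s s',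
    (t <= 300 * W ^ 2)%N, nmem s' vpos 0%N = (pos + #|PM|)%N,
    nmem s' vrp 0%N = (rp + nx * (ny + 1))%N & nmem s' vnb 0%N = nb.+1],
    forall j, (j < pos)%N -> nmem s' 3%N j = nmem s 3%N j,
    forall j, (j < rp)%N -> rmem s' 4%N j = rmem s 4%N j,
    stores_at (nmem s' 3%N) pos (map val (enum PM)) &
    stores_at (rmem s' 4%N) rp (mxseq (rsubmx V))]).
Proof.
move=> d hp he hV hPM hpos hrp hnb.
pose E k := [seq i <- iota 0 k | nmem s aPM i == 1%N].
have EPM : map val (enum PM) = E m.
  rewrite /E -val_enum_ord filter_map; congr map.
  by rewrite {1}enumT; apply: eq_filter => i /=; rewrite hPM eqb1.
hseq; apply: (@ht_forT _ _ _ _ _ m 40 (fun k u => [/\ frame [:: cI; vpos; 3%N] [::] s u,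
   nmem u vpos 0%N = (pos + size (E k))%N, forall j, (j < pos)%N -> nmem u 3%N j = nmem s 3%N j &
   stores_at (nmem u 3%N) pos (E k)])).
- by split => //; [apply: frame_setn|rewrite addn0].
- by move=> k u [fu *] /=; rewrite fu.1 // d.(d_m).
- move=> k u km [fu pu lu su] ik; apply: ht_if; rewrite /= ik fu.1 //.
  have ES : E k.+1 = E k ++ (if nmem s aPM k == 1%N then [:: k] else [::]).
    by rewrite /E -{1}(addn1 k) iotaD filter_cat add0n /=; case: ifP.
  have PMk := hPM (Ordinal km); rewrite /= in PMk.
  rewrite ES PMk eqb1 lt0b; case: ifP => h; last first.
    by hset; split => //; rewrite cats0; split => //; apply: frame_setn.
  hseq; hset; hset; rewrite /= /upd /= pu ik; split => //; split => //.
  + by do 3!apply: frame_setn => //.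
  + by rewrite size_cat addnA.
  + by move=> j jp; rewrite ifN ?lu //; lia.
  apply: stores_at_cat.
    by apply: stores_at_ext su => j hj; rewrite ifN //; lia.
  by move=> x0 [|//] _; rewrite addn0 /= eqxx.
move=> u t [fu pu lu su] _ tt.
have du : data u by apply: data_frame fu d.
hseq; apply: (@ht_fill2 _ _ _ _ _ _ _ _ _ nx (ny + 1) rp (fun i k => rmem s rV (i * (nx + (ny + 1)) + (nx + k))%N)) => //.
- by move=> w fw /=; rewrite fw.1 // du.(d_nx).
- by move=> w fw /=; rewrite fw.1 // du.(d_ny).
- move=> w i k ip kp fw ii ik _ /=; rewrite ii ik !fw.1 // !(fu.1 vrp) // !(fu.1 vp) // !(fu.1 ve) //.
  by rewrite du.(d_nx) du.(d_ny) hrp hp he fw.2 // fu.2.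
move=> w tw fw hw1 hw2 ttw; hseq; hset; hset.
rewrite /= /upd /= !fw.1 // !(fu.1 vrp) // !(fu.1 vnb) // pu du.(d_nx) du.(d_ny) hrp hnb.
have szE : size (E m) = #|PM| by rewrite -EPM size_map -cardE.
split.
- split => //.
  + do 2!apply: frame_setn => //; apply: (@frame_trans _ _ _ _ u); first by apply: frame_sub fu.
    by apply: frame_sub fw.
  + move: tt ttw; rewrite /= => tt ttw.
    have g1 : (m <= W ^ 2)%N by apply: leq_trans (dimW_sq m nx ny); rewrite /dimW; lia.
    have g2 : (nx * (ny + 1) <= W ^ 2)%N by rewrite -mulnn; apply: leq_mul; rewrite /dimW; lia.
    have g3 : (nx <= W ^ 2)%N by apply: leq_trans (dimW_sq m nx ny); rewrite /dimW; lia.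
    have g4 : (1 <= W ^ 2)%N by rewrite expn_gt0 dimW_gt0.
    move: ttw; rewrite !mulnDr !mulnA; move: g2; rewrite mulnDr; lia.
  + by rewrite szE.
  + by rewrite addn1.
- by move=> j jp; rewrite lu.
- by move=> j jp; rewrite /= hw2 ?jp // fu.2.
- by rewrite EPM.
- apply: stores_mx => i k /=; rewrite hw1 // mxE -hV mxE; congr (rmem _ _ _).
Qed.

Definition nsBas := nsRed ++ [:: cQ; vlen; vptr; aMark; vok; vpos; vrp; vnb; 3%N].
Definition rsBas := 4%N :: rsRed.

Definition okx (p : 'cV[R]_ny) (x : {set 'I_m} * 'M[R]_(nx, nx + (ny + 1))) :=
  (#|x.1| == nx) && okb p x.2.

Definition bsel p (res : seq ({set 'I_m} * 'M[R]_(nx, nx + (ny + 1)))) := [seq x <- res | okx p x].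
Definition outB (bs : seq ({set 'I_m} * 'M[R]_(nx, nx + (ny + 1)))) : seq nat :=
  flatten [seq map val (enum J) | J : {set 'I_m} <- [seq x.1 | x <- bs]].
Definition outV (bs : seq ({set 'I_m} * 'M[R]_(nx, nx + (ny + 1)))) : seq R :=
  flatten [seq mxseq (rsubmx x.2) | x <- bs].

(** [res] is ghost data: the faces are reduced anew for each chamber and the results are not kept in
    memory, but they have to be named to state what is written. *)
Definition reds (k : nat) (res : seq ({set 'I_m} * 'M[R]_(nx, nx + (ny + 1)))) :=
  size res = k /\ forall q, (q < k)%N -> red_inv A BB [set:: nth [::] L q] (nth (set0, 0) res q).1 (nth (set0, 0) res q).2.

Lemma bases_ok s pos rp : data s -> nmem s vpos 0%N = pos -> nmem s vrp 0%N = rp ->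
  nmem s vnb 0%N = 0%N ->
  let p := carr ny (rmem s rP) in
  ht Bases s (fun s' t => [/\ frame nsBas rsBas s s', (t <= size L * (4600 * W ^ 3) + 30)%N &
    exists res, let bs := bsel p res in [/\ reds (size L) res,
    [/\ nmem s' vpos 0%N = (pos + size (outB bs))%N,
    nmem s' vrp 0%N = (rp + size (outV bs))%N & nmem s' vnb 0%N = size bs],
    (forall j, (j < pos)%N -> nmem s' 3%N j = nmem s 3%N j) /\
    (forall j, (j < rp)%N -> rmem s' 4%N j = rmem s 4%N j),
    stores_at (nmem s' 3%N) pos (outB bs) &
    stores_at (rmem s' 4%N) rp (outV bs)]]).
Proof.
move=> d hpos hrp hnb p; hseq; hset.
apply: (@ht_forT _ _ _ _ _ (size L) (4500 * W ^ 3) (fun q u => [/\ frame nsBas rsBas s u,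
  nmem u vptr 0%N = off L q &
  exists res, let bs := bsel p res in [/\ reds q res,
    [/\ nmem u vpos 0%N = (pos + size (outB bs))%N,
    nmem u vrp 0%N = (rp + size (outV bs))%N & nmem u vnb 0%N = size bs],
    (forall j, (j < pos)%N -> nmem u 3%N j = nmem s 3%N j) /\
    (forall j, (j < rp)%N -> rmem u 4%N j = rmem s 4%N j),
    stores_at (nmem u 3%N) pos (outB bs) &
    stores_at (rmem u 4%N) rp (outV bs)]])).
- split; [by do 2!apply: frame_setn => //|by rewrite /off take0|].
  by exists [::]; split => //; rewrite !addn0.
- by move=> q u [fu _ _] /=; rewrite fu.1 // d.(d_L).
- move=> q u qL [fu pu [res [rr [n1 n2 n3] [l1 l2] o1 o2]]] iq.
  have du : data u by apply: data_frame fu d.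
  have ul : uniq (nth [::] L q) by apply: (allP uL); rewrite mem_nth.
  hseq; apply: ht_mono (read_ok (enc := 1) du isT du.(d_eL) qL ul pu) => v tv [fv ttv pv mv].
  have dv : data v by apply: data_frame fv du.
  set I := [set:: nth [::] L q].
  have mI (i : 'I_m) : nmem v aMark i = (i \in I) by rewrite mv inE.
  hseq; apply: ht_mono (reduce_ok dv mI) => w tw [fw ttw [pw ew] [PM [V [ri hPM hc hV]]]].
  have dw : data w by apply: data_frame fw dv.
  have Fw : frame nsBas rsBas s w.
    apply: (frame_trans fu); apply: (@frame_trans _ _ _ _ v); first by apply: frame_sub fv.
    by apply: frame_sub fw.
  have iw : nmem w cQ 0%N = q by rewrite fw.1 // fv.1.
  have ppw : nmem w vptr 0%N = off L q.+1 by rewrite fw.1.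
  have T1 : (tv + tw <= 3200 * W ^ 3)%N.
    move: ttv ttw (dimW_gt0 m nx ny) (dimW_sq m nx ny) (dimW_loop m nx ny).
    have : (m.+1 <= W)%N by rewrite /dimW; lia.
    move: (W ^ 2)%N (W ^ 3)%N => Y Z; lia.
  have W3 : (1 <= W ^ 3)%N by rewrite expn_gt0 dimW_gt0.
  have W23 : (W ^ 2 <= W ^ 3)%N by rewrite leq_pexp2l // dimW_gt0.
  have wpos : nmem w vpos 0%N = (pos + size (outB (bsel p res)))%N by rewrite fw.1 // fv.1.
  have wrp : nmem w vrp 0%N = (rp + size (outV (bsel p res)))%N by rewrite fw.1 // fv.1.
  have wnb : nmem w vnb 0%N = size (bsel p res) by rewrite fw.1 // fv.1.
  have w3 : nmem w 3%N = nmem u 3%N by rewrite fw.1 // fv.1.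
  have w4 : rmem w 4%N = rmem u 4%N by rewrite fw.2 // fv.2.
  have wp : carr ny (rmem w rP) = p by rewrite Fw.2.
  pose res' := rcons res (PM, V).
  have rr' : reds q.+1 res'.
    split => [|q']; first by rewrite size_rcons rr.1.
    rewrite ltnS leq_eqVlt => /orP[/eqP->|q'q].
      by rewrite nth_rcons rr.1 ltnn eqxx.
    by rewrite nth_rcons rr.1 q'q; apply: rr.2.
  have bE : bsel p res' = bsel p res ++ (if okx p (PM, V) then [:: (PM, V)] else [::]).
    by rewrite /bsel /res' -cats1 filter_cat /=; case: ifP.
  have skip (x : state R) : frame [:: cQ; cK; cS; cI; vok] [:: rFa; rFe; rAcc; rR] w x -> ~~ okx p (PM, V) ->
    [/\ frame nsBas rsBas s x, nmem x vptr 0%N = off L q.+1 &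
  exists res, let bs := bsel p res in [/\ reds q.+1 res,
    [/\ nmem x vpos 0%N = (pos + size (outB bs))%N,
    nmem x vrp 0%N = (rp + size (outV bs))%N & nmem x vnb 0%N = size bs],
    (forall j, (j < pos)%N -> nmem x 3%N j = nmem s 3%N j) /\
    (forall j, (j < rp)%N -> rmem x 4%N j = rmem s 4%N j),
    stores_at (nmem x 3%N) pos (outB bs) &
    stores_at (rmem x 4%N) rp (outV bs)]].
    move=> fx nok; split; [by apply: (frame_trans Fw); apply: frame_sub fx|by rewrite fx.1|].
    exists res'; rewrite bE (negbTE nok) cats0; split => //.
    - by rewrite !fx.1.
    - by rewrite fx.1 // fx.2 // w3 w4.
    - by rewrite fx.1 // w3.
    - by rewrite fx.2 // w4.
  apply: ht_if; have -> : beval w BFull = (#|PM| == nx).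
    by rewrite /= hc dw.(d_nx) eqn_leq.
  case: eqP => cPM; last first.
    hset; split; [by rewrite /=; lia|by []|].
    apply: skip; first by apply: frame_setn.
    by rewrite /okx /=; case: eqP.
  hseq; apply: ht_mono (check_ok dw pw ew hV) => x tx [fx ttx okxx]; rewrite wp in okxx.
  have ix : nmem x cQ 0%N = q by rewrite fx.1.
  apply: ht_if; rewrite /= okxx lt0b; case: ifP => ok; last first.
    hset; split; [by rewrite /=; lia|by []|].
    apply: skip; first by apply: frame_setn => //; apply: frame_sub fx.
    by rewrite /okx /= ok andbF.
  have Fx : frame nsBas rsBas s x by apply: (frame_trans Fw); apply: frame_sub fx.
  have dx : data x by apply: data_frame Fx d.
  have px : nmem x vp 0%N = nx by rewrite fx.1.
  have ex : nmem x ve 0%N = (ny + 1)%N by rewrite fx.1.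
  have Vx : marr nx (nx + (ny + 1)) (rmem x rV) = V by rewrite fx.2.
  have PMx (i : 'I_m) : nmem x aPM i = (i \in PM) by rewrite fx.1.
  have posx : nmem x vpos 0%N = (pos + size (outB (bsel p res)))%N by rewrite fx.1.
  have rpx : nmem x vrp 0%N = (rp + size (outV (bsel p res)))%N by rewrite fx.1.
  have nbx : nmem x vnb 0%N = size (bsel p res) by rewrite fx.1.
  apply: ht_mono (emit_ok dx px ex Vx PMx posx rpx nbx) => y ty [[fy tty py rpy nby] ly1 ly2 sy1 sy2].
  have okk : okx p (PM, V) by rewrite /okx /= cPM eqxx ok.
  have x3 : nmem x 3%N = nmem u 3%N by rewrite fx.1.
  have x4 : rmem x 4%N = rmem u 4%N by rewrite fx.2.
  split.
  + by rewrite /=; lia.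
  + by rewrite fy.1.
  split.
  + by apply: frame_setn => //; apply: (frame_trans Fx); apply: frame_sub fy.
  + by rewrite /= /upd /= fy.1 // fx.1.
  exists res'; rewrite bE okk.
  have bB : outB (bsel p res ++ [:: (PM, V)]) = outB (bsel p res) ++ map val (enum PM).
    by rewrite /outB !map_cat flatten_cat /= cats0.
  have bV : outV (bsel p res ++ [:: (PM, V)]) = outV (bsel p res) ++ mxseq (rsubmx V).
    by rewrite /outV map_cat flatten_cat /= cats0.
  rewrite /= /upd /= bB bV !size_cat !addnA; split => //.
  + rewrite py rpy nby size_map -cardE size_mxseq; split => //; exact: (esym (addn1 _)).
  + split => j hj; first by rewrite ly1 ?x3 ?l1 //; lia.
    by rewrite ly2 ?x4 ?l2 //; lia.
  + apply: stores_at_cat => //; apply: stores_at_ext o1 => j hj.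
    by rewrite ly1 ?x3 //; lia.
  + apply: stores_at_cat => //; apply: stores_at_ext o2 => j hj.
    by rewrite ly2 ?x4 //; lia.
- move=> u t [fu _ h] _ tt; split => //.
  have W3 : (1 <= W ^ 3)%N by rewrite expn_gt0 dimW_gt0.
  have : (size L * (4500 * W ^ 3 + ncost eL + 11) <= size L * (4600 * W ^ 3))%N.
    by rewrite leq_mul2l /=; apply/orP; right; lia.
  by move: tt; rewrite /=; lia.
Qed.

End Out.

(** * The enumeration *)

Notation vcount := 31%N (only parsing).
Notation vcar := 32%N (only parsing).

(** A hyperplane number below [vH] and a side below 3 form one digit of a counter in base 3H, least
    significant digit first, which is increased with carry. *)
Definition Incr : cmd :=
  sv vcar (NConst 1) ;;
  For cD (gv vD)
    (If (BNle (NConst 1) (gv vcar))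
      (NSet aDs (gv cD) (NAdd (NGet aDs (gv cD)) (NConst 1)) ;;
       If (BNle (NConst 3) (NGet aDs (gv cD)))
         (NSet aDs (gv cD) (NConst 0) ;;
          NSet aDj (gv cD) (NAdd (NGet aDj (gv cD)) (NConst 1)) ;;
          If (BNle (gv vH) (NGet aDj (gv cD)))
            (NSet aDj (gv cD) (NConst 0)) (sv vcar (NConst 0)))
         (sv vcar (NConst 0))) Skip).

Definition Step : cmd :=
  Sample ;; Insert ;;
  If (BNle (NGet aLf (gv vnode)) (NConst 0))
    (Chamb ;; sv vN (NAdd (gv vN) (NConst 1)) ;; NSet aLf (gv vnode) (gv vN)) Skip ;;
  Incr.

Definition Main : cmd :=
  If (BNle eny (gv vH)) (sv vD eny) (sv vD (gv vH)) ;;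
  sv vcount (NConst 1) ;;
  For cD (gv vD) (sv vcount (NMul (gv vcount) (NMul (NConst 3) (gv vH)))) ;;
  sv vpos (NConst 1) ;;
  For cT (gv vcount) Step ;;
  NSet 3 (NConst 0) (gv vN).

(** For m = 0 the bit-length is 0, which leaves no room for a loop over the parameters, so the
    answer is written directly: full rank forces n_x = 0, and the only chamber is the whole
    parameter space with the empty base. *)
Definition Algo : cmd :=
  If (BNle (NConst 1) em) (Hyps ;; Main)
    (NSet 3 (NConst 0) (NConst 1) ;; NSet 3 (NConst 1) (NConst 0) ;;
     NSet 3 (NConst 2) (NConst 1) ;; NSet aLf (NConst 0) (NConst 1)).

(** * Positional notation for digit sequences *)

Section Base.
Variable b : nat.

Definition valb (f : nat -> nat) D := (\sum_(i < D) f i * b ^ i)%N.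

Lemma valb_lt f D : (forall i, (i < D)%N -> (f i < b)%N) -> (valb f D < b ^ D)%N.
Proof.
elim: D => [|D IH] h; first by rewrite /valb big_ord0.
rewrite /valb big_ord_recr /= -/(valb f D).
have := IH (fun i iD => h i (ltnW iD)); have hD := h D (leqnn _).
have : ((f D).+1 * b ^ D <= b * b ^ D)%N by rewrite leq_mul2r hD orbT.
by rewrite expnS mulSn; lia.
Qed.

Lemma valb_inj f g D : (forall i, (i < D)%N -> (f i < b)%N) -> (forall i, (i < D)%N -> (g i < b)%N) ->
  valb f D = valb g D -> forall i, (i < D)%N -> f i = g i.
Proof.
elim: D => [//|D IH] hf hg; rewrite /valb !big_ord_recr /= -/(valb f D) -/(valb g D) => E.
have lf := valb_lt (fun i iD => hf i (ltnW iD)).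
have lg := valb_lt (fun i iD => hg i (ltnW iD)).
have b0 : (0 < b ^ D)%N by apply: leq_ltn_trans lf.
have ED : f D = g D.
  have := congr1 (divn^~ (b ^ D)%N) E; rewrite /= !(addnC (valb _ _)) !divnMDl //.
  by rewrite !divn_small // !addn0.
have EV : valb f D = valb g D by move: E; rewrite ED; lia.
move=> i; rewrite ltnS leq_eqVlt => /orP[/eqP->//|iD].
by apply: (IH (fun i iD => hf i (ltnW iD)) (fun i iD => hg i (ltnW iD)) EV).
Qed.

Lemma valb_upd f g D k : (k < D)%N -> (forall i, (i < D)%N -> i != k -> f i = g i) ->
  (valb f D + g k * b ^ k = valb g D + f k * b ^ k)%N.
Proof.
move=> kD h; rewrite /valb (bigD1 (Ordinal kD)) //= [in RHS](bigD1 (Ordinal kD)) //=.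
rewrite (eq_bigr (fun i : 'I_D => g i * b ^ i)%N) => [|i]; first by lia.
by rewrite -val_eqE /= => ik; rewrite h.
Qed.

End Base.

Section Main.
Variable R : realType.
Implicit Types (s : state R).
Variables (m nx ny : nat) (A : 'M[R]_(m, nx)) (B : 'M[R]_(m, ny)) (b : 'cV[R]_m).
Variables (L L' : seq (seq 'I_m)).
Hypothesis uL : all uniq L.
Hypothesis uL' : all uniq L'.
Notation data := (data A B b L L').
Notation BB := (BB B b).
Notation W := (dimW m nx ny).

Section Hs.
Variable hs : seq 'rV[R]_(ny + 1).
Notation H := (size hs).

Definition dig (s : state R) i := (3 * nmem s aDj i + nmem s aDs i)%N.
Definition digok s D := forall i, (i < D)%N -> (nmem s aDj i < H)%N /\ (nmem s aDs i < 3)%N.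

(** [c] is the carry out of the last digit. During the loop, the value plus the pending carry
    weighted by its position stays equal to the old value plus one. *)
Lemma incr_ok s D : nmem s vD 0%N = D -> nmem s vH 0%N = H -> digok s D ->
  ht Incr s (fun s' t => [/\ frame [:: vcar; cD; aDs; aDj] [::] s s', (t <= 100 * D.+1)%N, digok s' D &
    exists c, (valb (3 * H) (dig s') D + c * (3 * H) ^ D = (valb (3 * H) (dig s) D).+1)%N]).
Proof.
move=> hD hH dok; hseq; hset; set base := (3 * H)%N.
apply: (@ht_forT _ _ _ _ _ D 80 (fun k u => [/\ frame [:: vcar; cD; aDs; aDj] [::] s u,
  digok u D, (nmem u vcar 0%N <= 1)%N &
  (valb base (dig u) D + nmem u vcar 0%N * base ^ k = (valb base (dig s) D).+1)%N])).
- split => //; first by do 2!apply: frame_setn => //.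
  by rewrite /= /upd /= expn0 addn1.
- by move=> k u [fu _ _ _] /=; rewrite fu.1.
- move=> k u kD [fu du cu vu] ik.
  have uH : nmem u vH 0%N = H by rewrite fu.1.
  have [jk sk] := du k kD.
  apply: ht_if; rewrite /=; case E : (nmem u vcar 0%N) cu vu => [|[|//]] _ vu /=.
    hset; split => //; split => //; first by apply: frame_setn.
      by rewrite /= /upd /= E.
    by move: vu; rewrite /= /upd /= E !mul0n.
  have step (x : state R) : frame [:: vcar; cD; aDs; aDj] [::] u x ->
     (nmem x aDj k < H)%N -> (nmem x aDs k < 3)%N ->
     (forall i, i != k -> nmem x aDj i = nmem u aDj i /\ nmem x aDs i = nmem u aDs i) ->
     (nmem x vcar 0%N <= 1)%N ->
     (dig x k + nmem x vcar 0%N * base = (dig u k).+1)%N ->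
     [/\ frame [:: vcar; cD; aDs; aDj] [::] s (setn x cD 0 k.+1),
      digok (setn x cD 0 k.+1) D, (nmem (setn x cD 0 k.+1) vcar 0%N <= 1)%N &
      (valb base (dig (setn x cD 0 k.+1)) D + nmem (setn x cD 0 k.+1) vcar 0%N * base ^ k.+1 = (valb base (dig s) D).+1)%N].
    move=> fx h1 h2 h3 h4 h5; split => //.
    - by apply: frame_setn => //; apply: frame_trans fu fx.
    - move=> i iD; rewrite /= /upd /=; have [->//|ne] := eqVneq i k.
      by have [-> ->] := h3 i ne; apply: du.
    have -> : dig (setn x cD 0 k.+1) = dig x by apply/funext.
    have -> : nmem (setn x cD 0 k.+1) vcar 0%N = nmem x vcar 0%N by [].
    have hv : (valb base (dig x) D + dig u k * base ^ k = valb base (dig u) D + dig x k * base ^ k)%N.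
      apply: valb_upd => // i _ ik'.
      by rewrite /dig; have [-> ->] := h3 i ik'.
    move: vu h5 hv; rewrite expnS; move: (valb _ _ _) (valb _ _ _) (valb _ _ _) (base ^ k)%N => X Y Z P vu h5 hv.
    have : ((dig x k + nmem x vcar 0%N * base) * P = (dig u k).+1 * P)%N by rewrite h5.
    rewrite mulnDl mulSn -mulnA; lia.
  hseq; hset; apply: ht_if; rewrite /= /upd /= ik eqxx.
  case: ifP => s3; last first.
    hset; split => //; apply: step => //=.
    + by do 2!apply: frame_setn => //.
    + by rewrite /upd /= ?ik eqxx addn1; move: s3; lia.
    + by move=> i ne; rewrite /= /upd /= ?ik (negbTE ne).
    + by rewrite /dig /= /upd /= ?ik eqxx; lia.
  hseq; hset; hseq; hset; apply: ht_if; rewrite /= /upd /= ?ik eqxx uH.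
  case: ifP => j3; hset; (split; [by []|by []|apply: step => //=]).
  + by do 4!apply: frame_setn => //.
  + by rewrite /upd /= ?ik eqxx; lia.
  + by rewrite /upd /= ?ik eqxx.
  + by move=> i ne; rewrite /= /upd /= ?ik (negbTE ne).
  + by rewrite /upd /= E.
  + by rewrite /dig /= /upd /= ?ik !eqxx E /base; lia.
  + by do 4!apply: frame_setn => //.
  + by rewrite /upd /= ?ik eqxx; move: j3; lia.
  + by rewrite /upd /= ?ik eqxx.
  + by move=> i ne; rewrite /= /upd /= ?ik (negbTE ne).
  + by rewrite /dig /= /upd /= ?ik !eqxx; lia.
- move=> u t [fu du cu vu] _ tt; split => //; first by move: tt; rewrite /=; lia.
  by exists (nmem u vcar 0%N).
Qed.

Definition res_t := seq ({set 'I_m} * 'M[R]_(nx, nx + (ny + 1))).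

Definition outN (bs : res_t) : seq nat := [:: (2 * H)%N, size bs & outB bs].
Definition outR v (bs : res_t) : seq R := mxseq (rowsM hs v) ++ outV bs.

Definition nsCh := [:: cJ; vjj; vpos0] ++ nsBas.
Definition rsCh := rS :: rsBas.

Lemma chamb_ok s v pos rp : data s -> holds_hs hs s ->
  (forall j, (j < H)%N -> nmem s aSg j = nth 0%N v j) ->
  nmem s vpos 0%N = pos -> nmem s vrp 0%N = rp ->
  let p := carr ny (rmem s rP) in
  ht Chamb s (fun s' t => [/\ frame nsCh rsCh s s',
    (t <= H.+1 * (200 * W) + size L * (4600 * W ^ 3) + 100)%N &
    exists res, let bs := bsel A B b p res in [/\ reds A B b L (size L) res,
    nmem s' vpos 0%N = (pos + size (outN bs))%N /\ nmem s' vrp 0%N = (rp + size (outR v bs))%N,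
    (forall j, (j < pos)%N -> nmem s' 3%N j = nmem s 3%N j) /\
    (forall j, (j < rp)%N -> rmem s' 4%N j = rmem s 4%N j),
    stores_at (nmem s' 3%N) pos (outN bs) &
    stores_at (rmem s' 4%N) rp (outR v bs)]]).
Proof.
move=> d hh hv hpos hrp p.
hseq; hset; hseq; hset; hseq; hset; hseq; hset; rewrite /= /upd /= hpos hh.1.
set s1 := setn _ vnb _ _.
have f1 : frame nsCh rsCh s s1 by do 4!apply: frame_setn => //.
have e1 : nmem s1 3%N pos = (2 * H)%N by rewrite /= /upd /= eqxx.
have e2 j : (j < pos)%N -> nmem s1 3%N j = nmem s 3%N j.
  by move=> jp; rewrite /= /upd /= ltn_eqF.
have [e3 e4 e5] : [/\ nmem s1 vpos0 0%N = pos, nmem s1 vpos 0%N = (pos + 2)%N & nmem s1 vnb 0%N = 0%N] by [].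
have e6 : nmem s1 vrp 0%N = rp by [].
have e7 j : (j < H)%N -> nmem s1 aSg j = nth 0%N v j by exact: hv.
have e8 : rmem s1 = rmem s by [].
clearbody s1.
have d1 : data s1 by apply: data_frame f1 d.
have h1 : holds_hs hs s1 by apply: holds_frame f1 hh.
hseq; apply: ht_mono (rows_ok uL d1 h1 e6 e7) => s2 t2 [f2 tt2 l2 st2].
have F2 : frame nsCh rsCh s s2 by apply: (frame_trans f1); apply: frame_sub f2.
have d2 : data s2 by apply: data_frame F2 d.
have h2 : holds_hs hs s2 by apply: holds_frame F2 hh.
hseq; hset; rewrite /= f2.1 // e6 h2.1 d2.(d_ny).
set rp' := (rp + 2 * H * (ny + 1))%N; set s3 := setn s2 _ _ _.
have f3 : frame [:: vrp] [::] s2 s3 by apply: frame_setn.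
have F3 : frame nsCh rsCh s s3 by apply: frame_setn.
have e33 : nmem s3 vrp 0%N = rp' by [].
clearbody s3.
have d3 : data s3 by apply: data_frame F3 d.
have pos3 : nmem s3 vpos 0%N = (pos + 2)%N by rewrite f3.1 // f2.1.
have nb3 : nmem s3 vnb 0%N = 0%N by rewrite f3.1 // f2.1.
have p3 : carr ny (rmem s3 rP) = p by rewrite F3.2.
hseq; apply: ht_mono (bases_ok uL d3 pos3 e33 nb3) => s4 t4 [f4 tt4 [res]]; rewrite p3.
set bs := bsel _ _ _ _ _ => /= -[rr [n1 n2 n3] [l41 l42] o1 o2].
have n33 : nmem s3 3%N = nmem s1 3%N by rewrite f3.1 // f2.1.
have pos04 : nmem s4 vpos0 0%N = pos by rewrite f4.1 // f3.1 // f2.1.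
have r34 : rmem s3 4%N = rmem s2 4%N by rewrite f3.2.
hset; split.
- by apply: frame_setn => //; apply: (frame_trans F3); apply: frame_sub f4.
- by move: tt2 tt4; rewrite /=; lia.
exists res; rewrite -/bs /= /upd /= pos04 n3 n1 n2; split => //.
- split; first by rewrite -addnA.
  by rewrite /outR size_cat size_mxseq /rp' addnA.
- split => j hj.
    by rewrite ifN ?l41 ?n33 ?e2 //; lia.
  by rewrite l42 ?r34 ?l2 ?e8 //; rewrite /rp'; lia.
- move=> x0 [|[|i]] il /=; rewrite ?addn0 ?addn1 ?eqxx //.
    by rewrite ifN ?l41 ?n33 ?e1 //; lia.
  rewrite ifN; last by lia.
  by have -> : (pos + i.+2 = pos + 2 + i)%N; [lia|apply: o1].
- apply: stores_at_cat; last by rewrite size_mxseq.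
  apply: stores_at_ext st2 => j; rewrite size_mxseq => hj.
  by rewrite l42 ?r34 // /rp'; lia.
Qed.

Notation ch_t := ('cV[R]_ny * res_t)%type.

Definition svs (chs : seq ch_t) := [seq svec hs c.1 | c <- chs].
Definition flatN (chs : seq ch_t) := flatten [seq outN (bsel A B b c.1 c.2) | c <- chs].
Definition flatR (chs : seq ch_t) :=
  flatten [seq outR (svec hs c.1) (bsel A B b c.1 c.2) | c <- chs].

Record outstate s (chs : seq ch_t) : Prop := Outstate {
  os_uniq : uniq (svs chs);
  os_reds : forall c, c \in chs -> reds A B b L (size L) c.2;
  os_pos : nmem s vpos 0%N = (1 + size (flatN chs))%N;
  os_rp : nmem s vrp 0%N = size (flatR chs);
  os_vN : nmem s vN 0%N = size chs;
  os_N : stores_at (nmem s 3%N) 1 (flatN chs);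
  os_R : stores_at (rmem s 4%N) 0 (flatR chs);
  os_trie : exists nodes, [/\ trie (nmem s aTr) nodes, (nmem s vncnt 0%N).+1 = size nodes &
     leaf (nmem s aLf) nodes (svs chs)] }.

(** A digit sequence does not determine a point, since pivots and steps are free; it is enough that
    some admissible sample of each earlier sequence has a recorded sign vector. *)
Definition covers D k (chs : seq ch_t) := forall f g : nat -> nat,
  (forall i, (i < D)%N -> (f i < H)%N /\ (g i < 3)%N) ->
  (valb (3 * H) (fun i => 3 * f i + g i)%N D < k)%N ->
  exists p, smp hs (row_mx 1%:M 0) [seq (f i, g i) | i <- iota 0 D] p /\ svec hs p \in svs chs.

Definition nsStep := [:: vcar; aDs; aDj; vN; aLf] ++ nsSmp ++ nsIns ++ nsCh.
Definition nsMain := cT :: nsStep.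
Definition rsMain := rsSmp ++ rsCh.
Definition cStep := (H.+1 * (4500 * W ^ 3))%N.
Definition cCh := (H.+1 * (200 * W) + size L * (4600 * W ^ 3) + 200)%N.

(** The cost is amortised: writing a chamber is paid for by the growth of the number of chambers,
    and only sampling and the search in the trie are paid per candidate. Hence the number of
    n_y-dimensional faces is multiplied by the number of chambers, not by that of candidates. *)
Lemma step_ok s D k chs : data s -> holds_hs hs s -> nmem s vD 0%N = D -> (D <= ny)%N ->
  digok s D -> valb (3 * H) (dig s) D = k -> outstate s chs -> covers D k chs ->
  ht Step s (fun s' t => [/\ frame nsStep rsMain s s', digok s' D,
    exists c, (valb (3 * H) (dig s') D + c * (3 * H) ^ D = k.+1)%N &
    exists chs', [/\ outstate s' chs', covers D k.+1 chs' &
      (t + size chs * cCh <= cStep + size chs' * cCh)%N]]).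
Proof.
move=> d hh hD Dny dok vk os cov.
have hdj i : (i < D)%N -> (nmem s aDj i < H)%N by case/dok.
hseq; apply: ht_mono (sample_ok d hh hD Dny hdj) => s1 t1 [f1 tt1]; set p := carr _ _ => sp.
have F1 : frame nsStep rsMain s s1 by apply: frame_sub f1.
have d1 : data s1 by apply: data_frame F1 d.
have h1 : holds_hs hs s1 by apply: holds_frame F1 hh.
have [nodes [tr nc lf]] := os.(os_trie).
have tr1 : trie (nmem s1 aTr) nodes by rewrite f1.1.
have nc1 : (nmem s1 vncnt 0%N).+1 = size nodes by rewrite f1.1.
have lf1 : leaf (nmem s1 aLf) nodes (svs chs) by rewrite f1.1.
hseq; apply: ht_mono (insert_ok d1.(d_ny) h1 tr1 nc1 lf1) => s2 t2; rewrite -/p.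
move=> [f2 tt2 sg2 [nd [tr2 nc2 lf2 nn2 nv2]]]; set v := svec hs p in sg2 nv2.
have F2 : frame nsStep rsMain s s2 by apply: (frame_trans F1); apply: frame_sub f2.
have d2 : data s2 by apply: data_frame F2 d.
have h2 : holds_hs hs s2 by apply: holds_frame F2 hh.
have p2 : carr ny (rmem s2 rP) = p by rewrite f2.2.
have [q1 q2 q3 q4 q5] : [/\ nmem s2 vpos = nmem s vpos, nmem s2 vrp = nmem s vrp,
   nmem s2 vN = nmem s vN, nmem s2 3%N = nmem s 3%N & rmem s2 4%N = rmem s 4%N].
  by split; rewrite ?f2.1 ?f2.2 // ?f1.1 ?f1.2.
set k2 := nmem s2 vnode 0%N in nn2 nv2.
have W3 : (W <= W ^ 3)%N by rewrite -{1}[W]expn1 leq_pexp2l // dimW_gt0.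
have Wny : (ny.+1 <= W)%N by rewrite /dimW; lia.
have W0 := dimW_gt0 m nx ny.
have T12 : (t1 + (t2 + 100 * D.+1 + 50) <= cStep)%N.
  have a1 : (W ^ 3 <= H.+1 * W ^ 3)%N by rewrite leq_pmull.
  have a2 : (H.+1 * (200 * ny.+1) <= H.+1 * (200 * W ^ 3))%N.
    by apply: leq_mul => //; apply: leq_mul => //; apply: leq_trans W3.
  have a3 z : (H.+1 * (z * W ^ 3) = z * (H.+1 * W ^ 3))%N by rewrite mulnCA.
  rewrite /cStep; rewrite (a3 4500); move: tt1 tt2 a1 a2; rewrite (a3 4000) (a3 200) -/v.
  by move: (H.+1 * W ^ 3)%N (W ^ 3)%N W3 => Y Z W3; lia.
have nF2 : nmem s2 aLf k2 = if v \in svs chs then (index v (svs chs)).+1 else 0%N.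
  by rewrite lf2.2 nn2 nv2.
pose chs' (res : res_t) := if v \in svs chs then chs else rcons chs (p, res).
hseq; apply: (@ht_mono _ _ _ (fun s3 t3 => [/\ frame nsCh rsCh s2 s3 \/ frame (vN :: aLf :: nsCh) rsCh s2 s3,
   nmem s3 aDj = nmem s aDj /\ nmem s3 aDs = nmem s aDs & exists chs', [/\ outstate s3 chs',
     {subset svs chs <= svs chs'}, v \in svs chs' &
     (t3 + size chs * cCh <= size chs' * cCh + 20)%N]])); last first.
  apply: ht_if; rewrite /= nF2.
  have [vs|vs] := boolP (v \in svs chs).
    hset; split; [by left| |exists chs; split => //].
    - by rewrite !f2.1 // !f1.1.
    - by case: os => ? ? ? ? ? ? ? _; split => //; rewrite ?q1 ?q2 ?q3 ?q4 ?q5 //; exists nd.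
    - by rewrite /=; lia.
  have pos2 : nmem s2 vpos 0%N = (1 + size (flatN chs))%N by rewrite q1 os.(os_pos).
  have rp2 : nmem s2 vrp 0%N = size (flatR chs) by rewrite q2 os.(os_rp).
  hseq; apply: ht_mono (chamb_ok d2 h2 sg2 pos2 rp2) => s3 t3; rewrite p2.
  move=> [f3 tt3 [res /=]]; set bs := bsel _ _ _ _ _ => -[rr [n1 n2] [l1 l2] o1 o2].
  hseq; hset; hset.
  have g3 : nmem s3 vnode 0%N = k2 by rewrite f3.1.
  have NN3 : nmem s3 vN 0%N = size chs by rewrite f3.1 // q3 os.(os_vN).
  split.
  - by right; do 2!apply: frame_setn => //; apply: frame_sub f3.
  - by rewrite /= /upd /= !f3.1 // !f2.1 // !f1.1.
  have svE : svs (rcons chs (p, res)) = rcons (svs chs) v by rewrite /svs map_rcons.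
  exists (rcons chs (p, res)); split; last 1 first.
  - by rewrite size_rcons /= mulSn; move: tt3; rewrite /cCh; lia.
  - have fN : flatN (rcons chs (p, res)) = flatN chs ++ outN bs.
      by rewrite /flatN map_rcons -cats1 flatten_cat /= cats0.
    have fR : flatR (rcons chs (p, res)) = flatR chs ++ outR v bs.
      by rewrite /flatR map_rcons -cats1 flatten_cat /= cats0.
    split; rewrite ?fN ?fR ?size_cat /= /upd /=.
    + by rewrite svE rcons_uniq vs os.(os_uniq).
    + by move=> c; rewrite mem_rcons in_cons => /orP[/eqP->|] //; apply: os.(os_reds).
    + by rewrite n1 addnA.
    + by rewrite n2 size_cat.
    + by rewrite NN3 size_rcons addn1.
    + apply: stores_at_cat => //; apply: stores_at_ext os.(os_N) => j hj.
      by rewrite l1 ?q4 //; lia.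
    + apply: stores_at_cat => //; apply: stores_at_ext os.(os_R) => j hj.
      by rewrite l2 ?q5 //; lia.
    exists nd; rewrite (f3.1 aTr) // (f3.1 vncnt) // (f3.1 aLf) //; split => //.
    have := leaf_new lf2 tr2.(tr_uniq) nn2; rewrite nv2 => /(_ vs); rewrite svE.
    congr (leaf _ _ _); apply/funext => i; rewrite /updT g3 NN3 size_map addn1.
    by case: eqP.
  - by move=> w ws; rewrite svE mem_rcons in_cons ws orbT.
  - by rewrite svE mem_rcons in_cons eqxx.
move=> s3 t3 [f3 [dj3 ds3] [ch3 [os3 sub3 v3 tt3]]].
have F3 : frame nsStep rsMain s s3.
  by apply: (frame_trans F2); case: f3 => f3; apply: frame_sub f3.
have D3 : nmem s3 vD 0%N = D by rewrite F3.1.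
have H3 : nmem s3 vH 0%N = H by rewrite F3.1 // hh.1.
have dok3 : digok s3 D by move=> i iD; rewrite dj3 ds3; apply: dok.
have dig3 : dig s3 = dig s by apply/funext => i; rewrite /dig dj3 ds3.
apply: ht_mono (incr_ok D3 H3 dok3) => s4 t4 [f4 tt4 dok4 [c vc]].
rewrite dig3 vk in vc.
split => //; [by apply: (frame_trans F3); apply: frame_sub f4|by exists c|].
exists ch3; split.
- case: os3 => o1 o2 o3 o4 o5 o6 o7 [nd' o8].
  by split => //; rewrite ?f4.1 ?f4.2 //; exists nd'; rewrite ?f4.1.
- move=> f g fg; rewrite ltnS leq_eqVlt => /orP[/eqP E|lt]; last first.
    by have [p' [h3 h4]] := cov f g fg lt; exists p'; split => //; apply: sub3.
  exists p; split => //.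
  (* Equal values in base 3H force equal digits, and a digit 3f + g with g < 3 determines the
     pair. *)
  have eqd i : (i < D)%N -> (3 * f i + g i = dig s i)%N.
    apply: (@valb_inj (3 * H)%N (fun i => 3 * f i + g i)%N (dig s) D) => [j jD|j jD|].
    - by have [] := fg j jD; lia.
    - by have [] := dok j jD; rewrite /dig; lia.
    - by rewrite E vk.
  have -> : [seq (f i, g i) | i <- iota 0 D] = digs s D.
    apply/eq_in_map => i; rewrite mem_iota add0n => /andP[_ iD].
    have := eqd i iD; have [_ g3] := fg i iD; have [_ s3'] := dok i iD; rewrite /dig => e.
    by congr pair; lia.
  exact: sp.
- by move: T12 tt3 tt4; lia.
Qed.

Lemma main_ok s : data s -> holds_hs hs s -> 
  [/\ nmem s aTr = (fun=> 0%N), nmem s aLf = (fun=> 0%N), nmem s aDj = (fun=> 0%N) & nmem s aDs = (fun=> 0%N)] ->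
  [/\ nmem s vN 0%N = 0%N, nmem s vrp 0%N = 0%N & nmem s vncnt 0%N = 0%N] ->
  let D := minn ny H in let cnt := ((3 * H) ^ D)%N in
  ht Main s (fun s' t => [/\ data s', holds_hs hs s' & 
    exists chs, [/\ outstate s' chs, covers D cnt chs, nmem s' 3%N 0%N = size chs &
     (t <= cnt * (cStep + 13) + size chs * cCh + 100 * W)%N]]).
Proof.
move=> d hh [z1 z2 z3 z4] [z5 z6 z7] D cnt.
have WD : (D + 2 <= W)%N by rewrite /D /dimW; lia.
hseq; apply: (@ht_mono _ _ _ (fun s' t => s' = setn s vD 0 D /\ (t <= 20)%N)).
  2:{ apply: ht_if; rewrite /= hh.1 d.(d_ny) /D; case: ifP => h; hset; rewrite /= ?d.(d_ny) ?hh.1; split => //.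
        by rewrite (minn_idPl h).
      by move/negbT: h; rewrite -ltnNge => /ltnW /minn_idPr ->. }
move=> _ t1 [-> tt1]; hseq; hset.
hseq; apply: (@ht_forT _ _ _ _ _ D 20 (fun k u => [/\ frame [:: vD; vcount; cD] [::] s u,
   nmem u vD 0%N = D & nmem u vcount 0%N = ((3 * H) ^ k)%N])).
- by split => //; do 3!apply: frame_setn => //.
- by move=> k u [fu].
- move=> k u kD [fu Du cu] ik; hset; split => //; split => //.
    by do 2!apply: frame_setn => //.
  by rewrite /= /upd /= cu fu.1 // hh.1 expnSr.
move=> s2 t2 [f2 D2 c2] _ tt2.
have f3' : frame [:: vD; vcount; cD; vpos] [::] s (setn s2 vpos 0 1).
  by apply: frame_setn => //; apply: frame_sub f2.
hseq; hset; rewrite /=.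
set s3 := setn s2 vpos 0 1.
have [D3 c3 p3] : [/\ nmem s3 vD 0%N = D, nmem s3 vcount 0%N = cnt & nmem s3 vpos 0%N = 1%N] by [].
rewrite -/s3 in f3'; clearbody s3.
have os3 : outstate s3 [::].
  split => //; rewrite ?(f3'.1 vrp) ?(f3'.1 vN) //.
  exists [:: [::]]; rewrite (f3'.1 aTr) // (f3'.1 aLf) // (f3'.1 vncnt) // z1 z2 z7.
  split => //; first exact: trie0.
  by split => // k; rewrite andbF.
have dj3 : nmem s3 aDj = (fun=> 0%N) by rewrite f3'.1.
have ds3 : nmem s3 aDs = (fun=> 0%N) by rewrite f3'.1.
(* The value of the counter is asserted only for k < cnt, because the last increment wraps it
   round. *)
hseq; apply: (@ht_for _ _ _ _ _ cnt (fun k u t => [/\ frame nsMain rsMain s3 u, digok u D,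
   ((k < cnt)%N -> valb (3 * H) (dig u) D = k) &
   exists chs, [/\ outstate u chs, covers D k chs & (t <= k * (cStep + 13) + size chs * cCh)%N]])).
- split.
  + by apply: frame_setn.
  + move=> i iD; rewrite /= /upd /= dj3 ds3; split => //.
    by move: iD; rewrite /D; case: (size hs) => //; rewrite minn0.
  + by move=> _; rewrite /valb big1 // => i _; rewrite /dig /= /upd /= dj3 ds3.
  exists [::]; split => //.
  by case: os3 => ? ? ? ? ? ? ? ?; split.
- by move=> k u t [fu _ _ _] /=; rewrite fu.1.
- move=> k u t kc [fu du vu [chs [os cov tt]]] ik.
  have Fu : frame ([:: vD; vcount; vpos] ++ nsMain) rsMain s u.
    by apply: (@frame_trans _ _ _ _ s3); [apply: frame_sub f3'|apply: frame_sub fu].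
  have d' : data u by apply: data_frame Fu d.
  have h' : holds_hs hs u by apply: holds_frame Fu hh.
  have Du : nmem u vD 0%N = D by rewrite fu.1.
  apply: ht_mono (step_ok d' h' Du (geq_minl _ _) du (vu kc) os cov) => x tx [fx dx [c vc] [chs' [os' cov' ttx]]].
  split; first by rewrite fx.1.
  split => //.
  + by apply: frame_setn => //; apply: (frame_trans fu); apply: frame_sub fx.
  + move=> kc'; move: vc; case: c => [|c]; first by rewrite mul0n addn0.
    by rewrite mulSn -/cnt; lia.
  exists chs'; split => //.
    by case: os' => ? ? ? ? ? ? ? ?; split.
  by rewrite mulSn /=; move: tt ttx; lia.
move=> u t [fu _ _ [chs [os cov tt]]] _; hset.
have Fu : frame (3%N :: [:: vD; vcount; vpos] ++ nsMain) rsMain s (setn u 3 0 (nmem u vN 0%N)).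
  apply: frame_setn => //; apply: (@frame_trans _ _ _ _ s3); [by apply: frame_sub f3'|by apply: frame_sub fu].
split.
- by apply: data_frame Fu d.
- by apply: holds_frame Fu hh.
exists chs; split => //.
- by case: os => *; split.
- by rewrite /= /upd /= os.(os_vN).
- by move: tt tt1 tt2; rewrite /=; lia.
Qed.

End Hs.
End Main.

(** * Cells of hyperplane arrangements *)

Section Affine.
Variable R : realType.

Lemma hval_line n (h : 'rV[R]_(n + 1)) y d t :
  hval h (y + t *: d) = hval h y + t * (lsubmx h *m d) 0 0.
Proof. by rewrite /hval mulmxDr -scalemxAr !mxE addrAC. Qed.

Lemma hval_seg n (h : 'rV[R]_(n + 1)) y z t :
  hval h (y + t *: (z - y)) = (1 - t) * hval h y + t * hval h z.
Proof. by rewrite hval_line mulmxBr !mxE /hval !mxE; ring. Qed.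

Lemma hvalZ n c (h : 'rV[R]_(n + 1)) y : hval (c *: h) y = c * hval h y.
Proof. by rewrite /hval !linearZ /= -scalemxAl !mxE mulrDr. Qed.

Lemma hvalB n (h g : 'rV[R]_(n + 1)) y : hval (h - g) y = hval h y - hval g y.
Proof. by rewrite /hval !linearB /= mulmxBl !mxE; ring. Qed.

Lemma hval_col n (h : 'rV[R]_(n + 1)) y : hval h y = (h *m col_mx y (1%:M : 'M_1)) 0 0.
Proof. by rewrite -{2}[h]hsubmxK mul_row_col mulmx1 mxE /hval. Qed.

Lemma hval_lin0 n (h : 'rV[R]_(n + 1)) y : lsubmx h = 0 -> hval h y = 0 -> h = 0.
Proof.
move=> h0; rewrite /hval h0 mul0mx mxE add0r => h1; rewrite -[h]hsubmxK h0.
by rewrite (_ : rsubmx h = 0) ?row_mx0 //; apply/rowP => j; rewrite (ord1 j) h1 mxE.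
Qed.

(** A pair is the value and the slope of an affine function of t. The functions that are nonzero at
    0 keep their sign up to the same quotient that the program uses as step length, and finitely
    many of these have a positive minimum. *)
Lemma small (s : seq (R * R)) : exists2 e, 0 < e &
  forall x, x \in s -> x.1 != 0 -> forall t, `|t| <= e -> 0 < (x.1 + t * x.2) * x.1.
Proof.
elim: s => [|[al be] s [e e0 IH]]; first by exists 1.
have [a0|a0] := eqVneq al 0.
  exists e => // x; rewrite in_cons => /orP[/eqP->|]; [by rewrite a0 eqxx|exact: IH].
pose q := al * al / (1 + al * al + be * be).
have q0 : 0 < q by apply: divr_gt0; [rewrite -expr2 exprn_even_gt0|exact: denom_gt0].
exists (Num.min e q); first by rewrite lt_min e0.
move=> x; rewrite in_cons => /orP[/eqP-> _|xs x0] t; rewrite le_min => /andP[te tq] /=; last exact: IH.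
have h : `|t * be| < `|al|.
  rewrite normrM; apply: le_lt_trans (eps_bound be a0); exact: ler_wpM2r.
case: (ltrgt0P al) h a0 => // al0; rewrite ltr_norml => /andP[h1 h2] _.
  by apply: mulr_gt0 => //; lra.
by rewrite nmulr_lgt0 //; lra.
Qed.

Lemma seq_min (T : eqType) (s : seq T) (f : T -> R) x0 : x0 \in s ->
  exists2 x, x \in s & forall y, y \in s -> f x <= f y.
Proof.
elim: s x0 => // a [|c s] IH x0 _.
  by exists a => [|y]; rewrite ?inE // => /eqP->.
have [x xs hx] := IH c (mem_head _ _).
have [le|lt] := leP (f a) (f x).
  exists a; first by rewrite mem_head.
  by move=> y; rewrite in_cons => /orP[/eqP->//|/hx]; apply: le_trans.
exists x; first by rewrite in_cons xs orbT.
by move=> y; rewrite in_cons => /orP[/eqP->|/hx //]; apply: ltW.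
Qed.

(** The forms are made nonzero one at a time: a nonzero form that vanishes at the current point has
    a nonzero coefficient, and a small step in that coordinate direction repairs it without spoiling
    the positive forms or those already treated. *)
Lemma generic_pt n (fs gs : seq 'rV[R]_(n + 1)) z :
  (forall f, f \in fs -> f != 0) -> (forall g, g \in gs -> 0 < hval g z) ->
  exists z', (forall g, g \in gs -> 0 < hval g z') /\ (forall f, f \in fs -> hval f z' != 0).
Proof.
elim: fs => [|f fs IH] hf hg; first by exists z.
have [|z1 [g1 f1]] := IH _ hg; first by move=> f' f's; apply: hf; rewrite in_cons f's orbT.
have [fz|fz] := eqVneq (hval f z1) 0; last first.
  by exists z1; split => // f'; rewrite in_cons => /orP[/eqP->|/f1].
have f0 : lsubmx f != 0.
  by apply/eqP => l0; have := hf f (mem_head _ _); rewrite (hval_lin0 l0 fz) eqxx.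
have /existsP[c fc] : [exists c, lsubmx f 0 c != 0].
  rewrite -[X in is_true X]negbK negb_exists; apply: contra f0 => /forallP h.
  by apply/eqP/rowP => c; rewrite [RHS]mxE; apply/eqP; have := h c; rewrite negbK.
pose d : 'cV[R]_n := delta_mx c 0.
have dE (h : 'rV_n) : (h *m d) 0 0 = h 0 c by rewrite /d -colE mxE.
have [e e0 he] := small [seq (hval h z1, (lsubmx h *m d) 0 0) | h <- fs ++ gs].
exists (z1 + e *: d); split => [g gs'|h].
  rewrite hval_line.
  have := he (hval g z1, (lsubmx g *m d) 0 0); rewrite /= (gt_eqF (g1 _ gs')).
  move=> /(_ (map_f _ _) isT e); rewrite mem_cat gs' orbT => /(_ isT).
  by rewrite ger0_norm ?(ltW e0) // lexx => /(_ isT); rewrite pmulr_lgt0 // g1.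
rewrite in_cons hval_line => /orP[/eqP->|hs].
  by rewrite fz add0r dE mulf_neq0 // gt_eqF.
have := he (hval h z1, (lsubmx h *m d) 0 0); rewrite /= (f1 _ hs).
move=> /(_ (map_f _ _) isT e); rewrite mem_cat hs => /(_ isT).
rewrite ger0_norm ?(ltW e0) // lexx => /(_ isT) h0.
by apply/eqP => h1; rewrite h1 mul0r ltxx in h0.
Qed.

(** The first crossing on the segment from [y0] to [ys] might lie on several unrelated hyperplanes.
    The start is therefore moved to a nearby z with the same signs, chosen such that two members
    vanish at the same point of the segment from z to [ys] only if they are proportional; [w] is the
    first zero on that segment. *)
Lemma crossing n (fam : seq 'rV[R]_(n + 1)) y0 ys j0 :
  (forall h, h \in fam -> hval h y0 != 0) -> j0 \in fam -> hval j0 y0 * hval j0 ys < 0 ->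
  exists w j, [/\ j \in fam, hval j w = 0, hval j y0 * hval j ys < 0,
    forall l, l \in fam -> hval l w != 0 -> 0 < hval l w * hval l y0 &
    forall l, l \in fam -> hval l w = 0 -> exists2 k, k != 0 & l = k *: j].
Proof.
move=> hf j0f hj0.
(* [Dl i l] vanishes at [ys]. If i and l have a common zero other than [ys] on the line through z
   and [ys], it vanishes there too and hence at z; genericity of z then leaves only the case that it
   is identically zero. *)
pose Dl (i l : 'rV[R]_(n + 1)) := hval l ys *: i - hval i ys *: l.
have [||z [hg hD]] := @generic_pt n [seq f <- [seq Dl i l | i <- fam, l <- fam] | f != 0]
    [seq hval h y0 *: h | h <- fam] y0.
- by move=> f; rewrite mem_filter => /andP[].
- move=> g /mapP[h hfam ->]; rewrite hvalZ -expr2 exprn_even_gt0 //=; exact: hf.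
have a_gt0 h : h \in fam -> 0 < hval h y0 * hval h z.
  by move=> hh; have := hg _ (map_f (fun h => hval h y0 *: h) hh); rewrite hvalZ.
(* Multiplied by its value at [y0], a member takes the value a + t bb at z + t (ys - z), where a >
   0; so for bb < 0 it vanishes at t = [tt]. *)
pose a h := hval h y0 * hval h z.
pose bb h := hval h y0 * hval h ys - a h.
pose tt h := a h / (- bb h).
have bj0 : j0 \in [seq h <- fam | bb h < 0].
  by rewrite mem_filter j0f andbT /bb; have := a_gt0 _ j0f; rewrite -/(a j0); lra.
have [j] := seq_min tt bj0; rewrite mem_filter => /andP[bj jf] hmin.
have tj0 : 0 < tt j by apply: divr_gt0; [exact: a_gt0|rewrite oppr_gt0].
have tj1 : tt j < 1.
  apply: le_lt_trans (hmin _ bj0) _; move: bj0; rewrite mem_filter => /andP[b0 _].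
  rewrite ltr_pdivrMr ?oppr_gt0 // mul1r /bb; lra.
set t := tt j in hmin tj0 tj1.
have tb : a j + t * bb j = 0.
  by rewrite /t /tt invrN mulrN mulNr mulfVK ?subrr // lt_eqF.
pose w := z + t *: (ys - z).
have wE h : hval h y0 * hval h w = a h + t * bb h.
  by rewrite /w hval_seg /bb /a; ring.
have zj : hval j w = 0.
  by have := wE j; rewrite tb => /eqP; rewrite mulf_eq0 (negbTE (hf j jf)) => /eqP.
have hj : hval j y0 * hval j ys < 0.
  have : a j + bb j < 0 by rewrite -tb ltrD2l -[X in X < _]mul1r ltr_nM2r.
  by rewrite /bb addrC subrK.
exists w, j; split => //.
- move=> l lf lw; rewrite lt_def mulf_neq0 ?hf //= mulrC wE.
  have := a_gt0 l lf; rewrite -/(a l) => al; case: (ltP (bb l) 0) => bl.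
    have : t <= tt l by apply: hmin; rewrite mem_filter bl.
    by rewrite /tt ler_pdivlMr ?oppr_gt0 //; lra.
  by apply: addr_ge0; [exact: ltW|apply: mulr_ge0 => //; exact: ltW].
- move=> l lf lw.
  move: lw zj; rewrite /w !hval_seg => lw zj.
  have yj : hval j ys != 0 by apply/eqP => e; rewrite e mulr0 ltxx in hj.
  have t1 : 1 - t != 0 by rewrite subr_eq0 gt_eqF.
  have yl : hval l ys != 0.
    apply/eqP => e; move: lw; rewrite e mulr0 addr0 => /eqP; rewrite mulf_eq0 (negbTE t1) /= => /eqP e0.
    by have := a_gt0 l lf; rewrite e0 mulr0 ltxx.
  have D0 : hval (Dl j l) z = 0.
    apply: (mulfI t1); rewrite mulr0 /Dl hvalB !hvalZ.
    have -> : (1 - t) * (hval l ys * hval j z - hval j ys * hval l z) =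
      hval l ys * ((1 - t) * hval j z) - hval j ys * ((1 - t) * hval l z) by ring.
    have -> : (1 - t) * hval j z = - (t * hval j ys) by apply/eqP; rewrite -addr_eq0 zj.
    have -> : (1 - t) * hval l z = - (t * hval l ys) by apply/eqP; rewrite -addr_eq0 lw.
    by ring.
  have : Dl j l = 0.
    apply/eqP; rewrite -[X in is_true X]negbK; apply/negP => Dn.
    have := hD (Dl j l); rewrite mem_filter Dn /= D0 eqxx => h.
    suff : false by []. apply: h; exact: allpairs_f.
  move/subr0_eq => e; exists (hval l ys / hval j ys); first by rewrite mulf_neq0 // invr_neq0.
  by rewrite mulrC -scalerA e scalerA mulVf // scale1r.
Qed.

Lemma sgd_pos (u v : R) : 0 < u * v -> sgd u = sgd v.
Proof.
rewrite /sgd; case: (ltrgt0P u) => [u0|u0|->]; last by rewrite mul0r ltxx.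
  by rewrite pmulr_rgt0 // => v0; rewrite (lt_geF v0).
by rewrite nmulr_rgt0 // => v0; rewrite (ltW v0) (lt_geF v0).
Qed.

Lemma sgd1 (u : R) : (sgd u == 1%N) = (u == 0).
Proof. by rewrite /sgd; case: (ltrgt0P u). Qed.

Lemma sgd_eq0 (u v : R) : sgd u = sgd v -> (u == 0) = (v == 0).
Proof. by rewrite -!sgd1 => ->. Qed.

Lemma sgd_eqP (u v : R) : sgd u = sgd v -> (u = 0 /\ v = 0) \/ 0 < u * v.
Proof.
rewrite /sgd; case: (ltrgt0P u) => [u0|u0|->]; case: (ltrgt0P v) => [v0|v0|->] // _.
- by right; apply: mulr_gt0.
- by right; rewrite nmulr_rgt0.
- by left.
Qed.

Lemma sgd_seg (u v t : R) : sgd u = sgd v -> 0 <= t -> t <= 1 -> sgd ((1 - t) * u + t * v) = sgd u.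
Proof.
move=> /sgd_eqP[[-> ->] _ _|uv t0 t1]; first by rewrite !mulr0 addr0.
apply: sgd_pos; have u0 : u != 0 by apply/eqP => e; rewrite e mul0r ltxx in uv.
have uu : 0 < u * u by rewrite -expr2 exprn_even_gt0.
have -> : ((1 - t) * u + t * v) * u = (1 - t) * (u * u) + t * (u * v) by ring.
have [->|tn] := eqVneq t 0; first by rewrite subr0 mul0r addr0 mul1r.
apply: ltr_wpDl; first by apply: mulr_ge0; [rewrite subr_ge0|exact: ltW].
by apply: mulr_gt0 => //; rewrite lt_def tn.
Qed.

(** * Counting the cells of an arrangement *)

Fixpoint Tc f n := match f, n with
  | 0, _ => 1%N | _, 0 => 1%N | f'.+1, n'.+1 => (Tc f' n'.+1 + 2 * Tc f' n')%N end.

Lemma TcS f n : Tc f.+1 n.+1 = (Tc f n.+1 + 2 * Tc f n)%N. Proof. by []. Qed.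

(** The step needs (f + 1)^n >= f^n + 2 f^(n - 1), which holds from n = 2 on. For n = 1 the
    recursion adds only 2, because dimension 0 has a single cell. *)
Lemma Tc_bound f n : (0 < f)%N -> (Tc f n <= 3 * f ^ n)%N.
Proof.
elim: f n => // f IH n _; have [->|f0] := posnP f; first by case: n => [|n] //=; rewrite exp1n.
case: n => [//|n]; rewrite TcS; have h2 := IH n.+1 f0; have h1 := IH n f0.
have [n0|n0] := posnP n.
  by rewrite n0 in h2 *; move: h2; rewrite !expn1; case: f f0 {IH h1} => // f _; rewrite [Tc f.+1 0]/=; lia.
have mon e : (f ^ e <= f.+1 ^ e)%N by elim: e => // e IHe; rewrite !expnS leq_mul.
case: n n0 h1 h2 => // n _ h1 h2.
have h3 := mon n; move: h1 h2; rewrite !(expnS f) !(expnS f.+1).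
set X := (f ^ n)%N in h3 *; set Y := (f.+1 ^ n)%N in h3 *; set P := Tc f n.+2; set Q := Tc f n.+1.
move=> h1 h2; have : (f.+1 * (f.+1 * X) <= f.+1 * (f.+1 * Y))%N by do 2!apply: leq_mul => //.
by rewrite !mulSn !mulnDr; move: h1 h2; move: (f * (f * X))%N (f * X)%N => a c; lia.
Qed.

Lemma Tc_mono f n : (Tc f n.+1 <= Tc f.+1 n.+1)%N.
Proof. exact: leq_addr. Qed.

(** Solving the equation of the hyperplane for a coordinate with nonzero coefficient identifies it
    with a space of one dimension less, and [F] restricts affine forms to it. *)
Lemma hyperplane_param n (h : 'rV[R]_(n.+1 + 1)) : lsubmx h != 0 ->
  exists (F : 'rV[R]_(n.+1 + 1) -> 'rV[R]_(n + 1)), forall y, hval h y = 0 ->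
    exists t, forall g, hval (F g) t = hval g y.
Proof.
move eb : (lsubmx h) => be h0; move eg : (rsubmx h 0 0) => ga.
have /existsP[c bc] : [exists c, be 0 c != 0].
  rewrite -[X in is_true X]negbK negb_exists; apply: contra h0 => /forallP e.
  by apply/eqP/rowP => c; rewrite [RHS]mxE; apply/eqP; have := e c; rewrite negbK.
pose M : 'M[R]_(n.+1, n) := \matrix_(i, k)
   (if unlift c i is Some k' then (k' == k)%:R else - be 0 (lift c k) / be 0 c).
pose p0 : 'cV[R]_n.+1 := \col_i (if unlift c i is Some _ then 0 else - ga / be 0 c).
exists (fun g => g *m block_mx M p0 0 1%:M) => y hy; exists (row' c y) => g.
rewrite !hval_col -mulmxA mul_block_col mul0mx add0r !mulmx1.
suff -> : M *m row' c y + p0 = y by [].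
apply/colP => i; rewrite !mxE; case: unliftP => [k ->|->].
  rewrite addr0 (bigD1 k) //= big1 => [|k' ne]; first by rewrite !mxE liftK eqxx mul1r addr0.
  by rewrite !mxE liftK eq_sym (negbTE ne) mul0r.
apply: (mulfI bc); have := hy; rewrite /hval eb eg mxE (bigD1_ord c) //= => e.
rewrite mulrDr mulr_sumr (eq_bigr (fun k => - (be 0 (lift c k) * y (lift c k) 0))).
  have -> : be 0 c * (- ga / be 0 c) = - ga by field.
  rewrite sumrN; move: e; set S := \sum_(i < n) _.
  by move: (be 0 c * y c 0) S => x S e; lra.
by move=> k _; rewrite !mxE unlift_none; field.
Qed.

(** Remove the first hyperplane and consider the sign words of the others. Those on its two open
    sides number |U| + |X|, where U is the union of the two sets and X their intersection. U is
    counted in the same dimension; the words of X also occur on the hyperplane, so X and the words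
    found there are each counted in one dimension less. If the first form is constant, its sign
    carries no information. *)
Lemma count_svec n (hs : seq 'rV[R]_(n + 1)) (taus : seq (seq nat)) : uniq taus ->
  (forall tau, tau \in taus -> exists y, svec hs y = tau) -> (size taus <= Tc (size hs) n)%N.
Proof.
have one (ts : seq (seq nat)) t0 : uniq ts -> (forall t, t \in ts -> t = t0) -> (size ts <= 1)%N.
  case: ts => [//|a [//|c ts]] /= /andP[+ _] h.
  by rewrite in_cons (h a) ?mem_head // (h c) ?eqxx // in_cons mem_head orbT.
move: taus; move E : (size hs) => k; elim: k n hs E => [|k IH] n [|h hs] //=.
  by move=> _ taus u hr; apply: (one _ [::]) => // t /hr[y].
case: n h hs => [|n] h hs [E] taus u hr.
  apply: (one _ (svec (h :: hs) 0)) => // t /hr[y <-].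
  by rewrite (_ : y = 0) //; apply/colP; case.
have tl (ts : seq (seq nat)) d : uniq ts -> (forall t, t \in ts -> exists y, svec (h :: hs) y = t /\ sgd (hval h y) = d) ->
    uniq (map behead ts).
  move=> uts hts; rewrite map_inj_in_uniq // => t1 t2 /hts[y1 [<- e1]] /hts[y2 [<- e2]] /=.
  by rewrite e1 e2 => ->.
have [h0|h0] := eqVneq (lsubmx h) 0.
  apply: leq_trans (Tc_mono _ _); rewrite -(size_map behead); apply: (IH _ hs E).
    apply: (tl _ (sgd (rsubmx h 0 0))) => // t /hr[y <-]; exists y; split => //.
    by rewrite /hval h0 mul0mx mxE add0r.
  by move=> t /mapP[t' /hr[y <-] ->]; exists y.
pose Td d := [seq behead t | t <- taus & head 9 t == d].
have TdP d t : t \in Td d -> exists y, svec hs y = t /\ sgd (hval h y) = d.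
  by case/mapP => t'; rewrite mem_filter => /andP[/eqP hd /hr[y yt]] ->; exists y; rewrite -yt /= in hd *.
have uT d : uniq (Td d).
  apply: (tl _ d); first exact: filter_uniq.
  by move=> t; rewrite mem_filter => /andP[/eqP hd /hr[y yt]]; exists y; split => //; rewrite -yt in hd.
have szT : size taus = (size (Td 0) + size (Td 1) + size (Td 2))%N.
  rewrite !size_map !size_filter; elim: taus hr {u Td TdP uT} => //= t ts IHt hr.
  have [y yt] := hr t (mem_head _ _); rewrite IHt; last by move=> t' ht; apply: hr; rewrite in_cons ht orbT.
  have : (head 9 t < 3)%N by rewrite -yt /= sgd_lt3.
  by case: (head 9 t) => [|[|[|]]] //= _; lia.
pose U := undup (Td 0 ++ Td 2); pose X := [seq t <- Td 0 | t \in Td 2].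
have sU : (size (Td 0) + size (Td 2) = size U + size X)%N.
  rewrite /U undup_cat size_cat !undup_id // !size_filter.
  rewrite (@eq_count _ (fun t => t \notin Td 2) (predC (mem (Td 2)))) //.
  rewrite (@eq_count _ (fun t => t \in Td 2) (mem (Td 2))) //.
  have := count_predC (mem (Td 2)) (Td 0).
  move: (count (predC _) _) (count (mem _) _) (size (Td 0)) (size (Td 2)) => x y z w; lia.
pose Z := undup (Td 1 ++ X).
have s1 : (size (Td 1) <= size Z)%N.
  by apply: uniq_leq_size => // t ht; rewrite mem_undup mem_cat ht.
have s2 : (size X <= size Z)%N.
  by apply: uniq_leq_size; [exact: filter_uniq|move=> t ht; rewrite mem_undup mem_cat ht orbT].
have hU : (size U <= Tc k n.+1)%N.
  apply: (IH _ hs E); first exact: undup_uniq.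
  by move=> t; rewrite mem_undup mem_cat => /orP[] /TdP[y [yt _]]; exists y.
have hZ t : t \in Z -> exists y, svec hs y = t /\ hval h y = 0.
  rewrite mem_undup mem_cat => /orP[/TdP[y [yt /eqP]]|].
    by rewrite sgd1 => /eqP e; exists y.
  rewrite mem_filter => /andP[/TdP[y2 [yt2 e2]] /TdP[y0 [yt0 e0]]].
  have n0 : hval h y0 < 0 by move: e0; rewrite /sgd; case: ltrgt0P.
  have p2 : 0 < hval h y2 by move: e2; rewrite /sgd; case: ltrgt0P.
  (* The segment between the witnesses on the two sides meets the hyperplane here; the other signs
     agree at both ends and hence along the segment. *)
  pose t' := - hval h y0 / (hval h y2 - hval h y0).
  have d0 : 0 < hval h y2 - hval h y0 by lra.
  have t0 : 0 <= t' by apply: divr_ge0; lra.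
  have t1 : t' <= 1 by rewrite ler_pdivrMr //; lra.
  exists (y0 + t' *: (y2 - y0)); split; last first.
    by rewrite hval_seg /t'; field; rewrite gt_eqF.
  rewrite -yt0; apply/eq_in_map => g gs; rewrite hval_seg; apply: sgd_seg => //.
  by move: yt0; rewrite -yt2 => /eq_in_map/(_ g gs).
have [F hF] := hyperplane_param h0.
have sZ : (size Z <= Tc k n)%N.
  apply: (IH _ (map F hs)); [by rewrite size_map|exact: undup_uniq|].
  move=> t /hZ[y [yt /hF[t' ht']]]; exists t'; rewrite -yt /svec -map_comp.
  by apply: eq_map => g /=; rewrite ht'.
rewrite szT -/(Tc k n.+1) -/(Tc k n); move: sU s1 s2 hU sZ.
by move: (size (Td 0)) (size (Td 1)) (size (Td 2)) (size U) (size X) (size Z) (Tc k n.+1) (Tc k n) => *; lia.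
Qed.

End Affine.

Lemma mul_col_entry (R : realType) m n k (M : 'M[R]_(m, n)) (N : 'M[R]_(n, k)) i c :
  (M *m N) i c = (M *m col c N) i 0.
Proof. by rewrite !mxE; apply: eq_bigr => j _; rewrite !mxE. Qed.

Lemma scalar11 (R : realType) : (1%:M : 'M[R]_1) 0 0 = 1.
Proof. by rewrite mxE. Qed.

(** * Every cell is reached by some digit sequence *)

Section Sampling.
Variables (R : realType) (n : nat).
Implicit Types (h : 'rV[R]_(n + 1)) (V : 'M[R]_(n, n + 1)).

Definition pull h V : 'rV[R]_(n + 1) := rowm (lsubmx h) (- rsubmx h) V.

Lemma pullE h V : pull h V = row_mx (lsubmx h *m lsubmx V) (lsubmx h *m rsubmx V + rsubmx h).
Proof. by rewrite /pull rowm_lr opprK. Qed.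

Lemma hval_pull h V t : hval (pull h V) t = hval h (lsubmx V *m t + rsubmx V).
Proof. by rewrite /hval pullE row_mxKl row_mxKr mulmxDr mulmxA !mxE addrA. Qed.

(** [V] parametrises the common zero set of [Js]; by the second clause its left block is the
    identity on directions parallel to that set. *)
Record flat (Js : seq 'rV[R]_(n + 1)) V : Prop := Flat' {
  fl_eq : forall h, h \in Js -> pull h V = 0;
  fl_fix : forall k (Z : 'M[R]_(n, k)), (forall h, h \in Js -> lsubmx h *m Z = 0) ->
    lsubmx V *m Z = Z }.

Lemma flat_lin Js V h : flat Js V -> h \in Js -> lsubmx h *m lsubmx V = 0.
Proof. by move=> fl /fl.(fl_eq) /(congr1 lsubmx); rewrite pullE row_mxKl linear0. Qed.

Lemma flat_step Js V h U V' : flat Js V -> elim_rel (lsubmx h) (- rsubmx h) V true U V' ->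
  flat (h :: Js) V'.
Proof.
move=> fl E; split.
- move=> g; rewrite in_cons => /orP[/eqP->|/fl.(fl_eq)]; first exact: (elim_rowm_new E).
  exact: (elim_rowm_old E).
- move=> k Z hZ; apply: (elim_fix E); last by apply: hZ; rewrite mem_head.
  by apply: fl.(fl_fix) => g gJ; apply: hZ; rewrite in_cons gJ orbT.
Qed.

(** Two parametrisations of the same flat have the same directions, so whether a form is constant on
    the flat is the same for the pivots of the program and for those chosen in the proof. *)
Lemma flat_active Js V V0 (l : 'rV[R]_n) : flat Js V -> flat Js V0 ->
  l *m lsubmx V = 0 -> l *m lsubmx V0 = 0.
Proof.
move=> fl fl0 h; rewrite -(fl.(fl_fix) (Z := lsubmx V0)); last by move=> g gJ; apply: flat_lin fl0 gJ.
by rewrite mulmxA h mul0mx.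
Qed.

Lemma flat_pt Js V y : flat Js V -> (forall h, h \in Js -> hval h y = 0) ->
  lsubmx V *m (y - rsubmx V) + rsubmx V = y.
Proof.
move=> fl hy; rewrite fl.(fl_fix) ?subrK // => h hJ; rewrite mulmxBr.
have := hy h hJ; have /(congr1 rsubmx) := fl.(fl_eq) hJ; rewrite pullE row_mxKr linear0 => e1 e2.
apply/matrixP => i j; rewrite !ord1 [LHS]mxE [X in _ + X]mxE [RHS]mxE.
by move: e1 e2 => /matrixP/(_ 0 0); rewrite /hval [LHS]mxE [RHS]mxE => e1 e2; lra.
Qed.

(** This stands in for the dimension of the flat: an active elimination clears the pivot column of
    the left block and revives no cleared one. *)
Definition nzcol V := #|[set c | col c (lsubmx V) != 0]|.

Lemma nzcol_step h V U V' : elim_rel (lsubmx h) (- rsubmx h) V true U V' -> (nzcol V' < nzcol V)%N.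
Proof.
move=> E; apply: proper_card; apply/properP.
have VE := elim_lsub E.
have colV' c : col c (lsubmx V') = col c (lsubmx V) - U *m (lsubmx h *m col c (lsubmx V)).
  by rewrite VE !colE mulmxBl !mulmxA.
split.
  apply/subsetP => c; rewrite !inE colV'; apply: contra => /eqP->.
  by rewrite !mulmx0 subrr.
have [c [rc UE _]] := E; have cE : col (lshift 1 c) V = col c (lsubmx V) by apply/colP => i; rewrite !mxE.
have rE : rowm (lsubmx h) (- rsubmx h) V 0 (lshift 1 c) = (lsubmx h *m col c (lsubmx V)) 0 0.
  have := lsub_rowm (lsubmx h) (- rsubmx h) V => /rowP/(_ c); rewrite mxE => ->.
  exact: mul_col_entry.
exists c; rewrite inE.
  by apply: contra rc => /eqP e; rewrite rE e mulmx0 mxE.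
rewrite negbK colV' UE cE.
have -> : lsubmx h *m col c (lsubmx V) = (rowm (lsubmx h) (- rsubmx h) V 0 (lshift 1 c))%:M.
  by apply/matrixP => i j; rewrite !ord1 rE [RHS]mxE.
by rewrite mul_mx_scalar scalerA mulfV // scale1r subrr.
Qed.

Variable hs : seq 'rV[R]_(n + 1).
Notation H := (size hs).

Definition activej V (j : 'I_H) := lsubmx (nth 0 hs j) *m lsubmx V != 0.
Definition nact V := #|[set j | activej V j]|.

Lemma elim_exists h V : lsubmx h *m lsubmx V != 0 ->
  exists U V', elim_rel (lsubmx h) (- rsubmx h) V true U V'.
Proof.
move=> h0; have /existsP[c hc] : [exists c, (lsubmx h *m lsubmx V) 0 c != 0].
  rewrite -[X in is_true X]negbK negb_exists; apply: contra h0 => /forallP e.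
  by apply/eqP/rowP => c; rewrite [RHS]mxE; apply/eqP; have := e c; rewrite negbK.
do 2!eexists; exists c; split; [|reflexivity|reflexivity].
by have := lsub_rowm (lsubmx h) (- rsubmx h) V => /rowP/(_ c); rewrite mxE => ->.
Qed.

Lemma elim_act h V act U V' : elim_rel (lsubmx h) (- rsubmx h) V act U V' ->
  act = (lsubmx h *m lsubmx V != 0).
Proof.
case: act => E.
  have [c [rc _ _]] := E; symmetry; apply/eqP => e; move: rc.
  have := lsub_rowm (lsubmx h) (- rsubmx h) V => /rowP/(_ c); rewrite mxE => ->.
  by rewrite e mxE eqxx.
have [r0 _] := E; symmetry; apply/negbTE; rewrite negbK; apply/eqP/rowP => c; rewrite [RHS]mxE.
by have := lsub_rowm (lsubmx h) (- rsubmx h) V => /rowP/(_ c); rewrite mxE => <-.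
Qed.

Lemma nact_step (j : 'I_H) V U V' : activej V j ->
  elim_rel (lsubmx (nth 0 hs j)) (- rsubmx (nth 0 hs j)) V true U V' -> (nact V' < nact V)%N.
Proof.
move=> aj E; apply: proper_card; apply/properP; split.
  apply/subsetP => l; rewrite !inE /activej; apply: contra => /eqP e.
  by apply/eqP; apply: (elim_lsub_old E).
exists j; rewrite inE // /activej negbK; apply/eqP.
by rewrite -(lsub_rowm _ (- rsubmx (nth 0 hs j))) (elim_rowm_new E) linear0.
Qed.

Lemma smp_inactive V ds p : (forall j, ~~ activej V j) ->
  all (fun x => (x.1 < H)%N && (x.2 < 3)%N) ds -> smp hs V ds p -> p = rsubmx V.
Proof.
move=> ina; elim: ds p => [//|[j sg] ds IH] p /= /andP[/andP[jH _] ok] [act [U [V' [E]]]].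
have := elim_act E; have := ina (Ordinal jH); rewrite /activej /= => /negbTE -> ae.
rewrite ae in E *; have [_ ->] := E; exact: IH.
Qed.

(** Induction on the number of digits, descending through flats. If [y0] lies on an active
    hyperplane, the digit is 1 and the flat shrinks. Otherwise a boundary point y1 of its cell
    within the flat is found on a hyperplane j, the cell of y1 is reached by induction, and the
    first digit pushes the sample back to the side of [y0]. Both measures drop at every active
    hyperplane, which is why min(n_y, H) digits suffice. *)
Lemma smp_complete D Js V0 y0 : flat Js V0 -> (forall h, h \in Js -> hval h y0 = 0) ->
  (0 < H)%N || (D == 0%N) -> (minn (nzcol V0) (nact V0) <= D)%N ->
  exists ds, [/\ size ds = D, all (fun x => (x.1 < H)%N && (x.2 < 3)%N) ds &
    forall V p, flat Js V -> smp hs V ds p -> svec hs p = svec hs y0].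
Proof.
elim: D Js V0 y0 => [|D IH] Js V0 y0 fl hy HD le.
  exists [::]; split => // V p flV /= ->; apply/eq_in_map => h hin.
  have /(nthP 0)[j jH je] := hin.
  have l0 : lsubmx h *m lsubmx V0 = 0.
    apply/eqP; rewrite -[X in is_true X]negbK; apply/negP => ac.
    have : (0 < minn (nzcol V0) (nact V0))%N.
      rewrite leq_min; apply/andP; split; apply/card_gt0P.
        have /existsP[c hc] : [exists c, (lsubmx h *m lsubmx V0) 0 c != 0].
          rewrite -[X in is_true X]negbK negb_exists; apply: contra ac => /forallP e.
          by apply/eqP/rowP => c; rewrite [RHS]mxE; apply/eqP; have := e c; rewrite negbK.
        exists c; rewrite inE; apply: contra hc => /eqP e.
        by rewrite mul_col_entry e mulmx0 mxE.
      by exists (Ordinal jH); rewrite inE /activej /= je.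
    by move: le; rewrite leqn0 => /eqP->.
  have l1 := flat_active fl flV l0.
  by rewrite -(flat_pt flV hy) /hval mulmxDr mulmxA l1 mul0mx add0r.
have H0 : (0 < H)%N by case/orP: HD.
have [/existsP[j0 a0]|] := boolP [exists j, activej V0 j]; last first.
  (* Every hyperplane is constant on the flat, so any digits serve as padding; (0, 0) is a legal
     digit because there is at least one hyperplane. *)
  rewrite negb_exists => /forallP ina; exists (nseq D.+1 (0, 0)%N); split.
  - by rewrite size_nseq.
  - by rewrite all_nseq /= H0.
  move=> V p flV sm; have inaV j : ~~ activej V j.
    rewrite /activej negbK; apply/eqP; apply: (flat_active fl flV).
    by apply/eqP; rewrite -[X in is_true X]negbK; exact: ina.
  rewrite (smp_inactive inaV _ sm); last by rewrite all_nseq /= H0.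
  apply/eq_in_map => h hin; have /(nthP 0)[j jH je] := hin.
  have := inaV (Ordinal jH); rewrite /activej /= je negbK => /eqP l1.
  by rewrite -[in RHS](flat_pt flV hy) /hval mulmxDr mulmxA l1 mul0mx add0r.
have step (j : 'I_H) y1 : activej V0 j -> hval (nth 0 hs j) y1 = 0 ->
    (forall h, h \in Js -> hval h y1 = 0) ->
    exists ds, [/\ size ds = D, all (fun x => (x.1 < H)%N && (x.2 < 3)%N) ds &
      forall V p, flat (nth 0 hs j :: Js) V -> smp hs V ds p -> svec hs p = svec hs y1].
  move=> aj hj hJ; have [U [V' E]] := elim_exists aj.
  apply: (IH (nth 0 hs j :: Js) V') => //; first exact: flat_step fl E.
  - by move=> h; rewrite in_cons => /orP[/eqP->|/hJ].
  - by rewrite H0.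
  have := nzcol_step E; have := nact_step aj E; move: le; rewrite !geq_min.
  by move: (nzcol _) (nact _) (nzcol _) (nact _) => *; lia.
have [/existsP[j /andP[aj /eqP hj]]|] := boolP [exists j, activej V0 j && (hval (nth 0 hs j) y0 == 0)].
  have [ds [sz ok hds]] := step j y0 aj hj hy.
  exists ((val j, 1%N) :: ds); split; [by rewrite /= sz|by rewrite /= ok ltn_ord|].
  move=> V p flV /= [act [U [V' [E]]]].
  have ajV : lsubmx (nth 0 hs j) *m lsubmx V != 0.
    by apply: contra aj => /eqP e; rewrite (flat_active flV fl e).
  have ae := elim_act E; rewrite ajV in ae; rewrite ae in E *.
  move=> [p' [eps [sm _ _ ->]]]; rewrite subrr mul0r scale0r addr0.
  exact: hds (flat_step flV E) sm.
rewrite negb_exists => /forallP nz.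
pose q0 := rsubmx V0; pose t0 := y0 - q0.
have y0E h : hval (pull h V0) t0 = hval h y0 by rewrite hval_pull (flat_pt fl hy).
pose fam := [seq pull (nth 0 hs (val j)) V0 | j <- enum 'I_H & activej V0 j].
have famP l : l \in fam -> exists2 j : 'I_H, activej V0 j & l = pull (nth 0 hs j) V0.
  by case/mapP => j; rewrite mem_filter => /andP[aj _] ->; exists j.
have famI (j : 'I_H) : activej V0 j -> pull (nth 0 hs j) V0 \in fam.
  by move=> aj; apply/mapP; exists j => //; rewrite mem_filter aj mem_enum.
have fam0 l : l \in fam -> hval l t0 != 0.
  by case/famP => j aj ->; rewrite y0E; have := nz j; rewrite aj.
have [e [U [V' E0]]] : exists e : R, exists U V', [/\ e = hval (nth 0 hs j0) y0 &
    elim_rel (lsubmx (nth 0 hs j0)) (- rsubmx (nth 0 hs j0)) V0 true U V'].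
  by have [U [V' E]] := elim_exists a0; exists (hval (nth 0 hs j0) y0), U, V'.
have [eE E] := E0; have [c [rc UE _]] := E.
pose d : 'cV[R]_n := (rowm (lsubmx (nth 0 hs j0)) (- rsubmx (nth 0 hs j0)) V0 0 (lshift 1 c))^-1 *: delta_mx c 0.
have dU : lsubmx V0 *m d = U.
  rewrite /d UE -scalemxAr -colE; congr (_ *: _); by apply/colP => i; rewrite !mxE.
(* In the coordinates of the flat, the move by -2e along [d] changes the form of [j0] from e to -e,
   so there is something to cross. *)
have [|w [l [lf lw lneg lpos lprop]]] := @crossing R n fam t0 (t0 - (2%:R * e) *: d) _ fam0 (famI _ a0).
  rewrite -scaleNr hval_line y0E -eE pullE row_mxKl -mulmxA dU (elim_aU E) scalar11 mulr1.
  have e0 : e != 0 by rewrite eE; have := nz j0; rewrite a0.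
  have : 0 < e * e by rewrite -expr2 exprn_even_gt0.
  have -> : e * (e - 2%:R * e) = - (e * e) by ring.
  by rewrite oppr_lt0.
have [j aj lE] := famP _ lf; subst l.
pose y1 := lsubmx V0 *m w + q0.
have y1E h : hval h y1 = hval (pull h V0) w by rewrite hval_pull.
have y1J h : h \in Js -> hval h y1 = 0.
  by move=> hJ; rewrite y1E fl.(fl_eq) // /hval !linear0 mul0mx !mxE addr0.
have [ds [sz ok hds]] := step j y1 aj (etrans (y1E _) lw) y1J.
set hj := nth 0 hs j in hds lw lneg lprop *.
have hj0 : hval hj y0 != 0 by have := nz j; rewrite aj.
pose sg := if 0 < hval hj y0 then 2%N else 0%N.
have sgE : 0 < (sg%:R - 1) * hval hj y0.
  rewrite /sg; case: ifP => hp; first by rewrite (_ : 2%:R - 1 = 1 :> R) ?mul1r //; lra.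
  by rewrite sub0r mulN1r oppr_gt0 lt_neqAle hj0 leNgt hp.
exists ((val j, sg) :: ds); split; [by rewrite /= sz|by rewrite /= ok ltn_ord /sg; case: ifP|].
move=> V p flV /= [act [UU [V1 [E1]]]].
have ajV : lsubmx hj *m lsubmx V != 0.
  by apply: contra aj => /eqP ee; rewrite /activej (flat_active flV fl ee).
have ae := elim_act E1; rewrite -/hj ajV in ae; rewrite ae in E1 *; rewrite -/hj in E1.
move=> [p' [eps [sm eps0 hsmall ->]]].
have svp := hds _ _ (flat_step flV E1) sm.
apply/eq_in_map => h hin; have /(nthP 0)[i iH ie] := hin.
have sgd1 : sgd (hval h p') = sgd (hval h y1) by move/eq_in_map: svp => /(_ h hin).
rewrite hval_line.
(* Three kinds of hyperplanes remain: those constant on the flat; those not through y1, for which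
   the step is too short to change the sign; and those through y1, whose form on the flat is a
   multiple of that of j and so follows its side. *)
have [ia|ia] := boolP (activej V0 (Ordinal iH)); last first.
  move: ia; rewrite /activej /= ie negbK => /eqP l0.
  rewrite (elim_a'U E1 (flat_active fl flV l0)) mxE mulr0 addr0 sgd1 /y1.
  have cst z : hval h (lsubmx V0 *m z + q0) = hval h q0 by rewrite /hval mulmxDr mulmxA l0 mul0mx add0r.
  by rewrite -(y0E h) hval_pull !cst.
have hfam : pull h V0 \in fam by rewrite -ie; apply: (famI (Ordinal iH)).
have [z1|z1] := eqVneq (hval h y1) 0; last first.
  have p'0 : hval h p' != 0 by rewrite (sgd_eq0 sgd1).
  have := lpos _ hfam; rewrite -y1E y0E => /(_ z1) /sgd_pos <-; rewrite -sgd1.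
  apply: sgd_pos; have := hsmall h hin p'0; set be := (_ *m UU) 0 0 => hb.
  have : `|(sg%:R - 1) * eps * be| < `|hval h p'|.
    rewrite !normrM (gtr0_norm eps0).
    have -> : `|sg%:R - 1 : R| = 1 by rewrite /sg; case: ifP => _; rewrite ?sub0r ?normrN1 // (_ : 2%:R - 1 = 1 :> R) ?normr1 //; lra.
    by rewrite mul1r.
  move: (hval h p') ((sg%:R - 1) * eps * be) p'0 => x z x0.
  case: (ltrgt0P x) x0 => // x0 _; rewrite ltr_norml => /andP[b1 b2].
    by apply: mulr_gt0 => //; lra.
  by rewrite nmulr_lgt0 //; lra.
have [k k0 kE] := lprop _ hfam (etrans (esym (y1E h)) z1).
have p'0 : hval h p' = 0 by apply/eqP; rewrite (sgd_eq0 sgd1) z1.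
have lk : (lsubmx h - k *: lsubmx hj) *m lsubmx V0 = 0.
  move/(congr1 lsubmx): kE; rewrite linearZ /= !pullE !row_mxKl => ee.
  by rewrite mulmxBl ee -scalemxAl subrr.
have := elim_a'U E1 (flat_active fl flV lk); rewrite mulmxBl -scalemxAl (elim_aU E1).
move=> /eqP; rewrite subr_eq0 => /eqP hU.
rewrite p'0 add0r hU mxE scalar11 mulr1 -(y0E h) kE hvalZ y0E.
apply: sgd_pos.
have -> : (sg%:R - 1) * eps * k * (k * hval hj y0) = (k * k) * (eps * ((sg%:R - 1) * hval hj y0)) by ring.
by apply: mulr_gt0; [rewrite -expr2 exprn_even_gt0|apply: mulr_gt0].
Qed.

End Sampling.

(** * Relative interiors of cells *)

Section Relint.
Variables (R : realType) (n : nat) (hs : seq 'rV[R]_(n + 1)).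
Notation H := (size hs).

Definition cellc (v : seq nat) : set 'cV[R]_n := fun y => forall j, (j < H)%N ->
  ((nth 0%N v j <= 1)%N -> hval (nth 0 hs j) y <= 0) /\
  ((1 <= nth 0%N v j)%N -> 0 <= hval (nth 0 hs j) y).

Lemma poly_rows v : polyhedron (lsubmx (rowsM hs v)) (rsubmx (rowsM hs v)) = cellc v.
Proof.
have rowE (r : 'I_(2 * H)) (y : 'cV[R]_n) : ((lsubmx (rowsM hs v) *m y) r 0 <= rsubmx (rowsM hs v) r 0) =
   (alpha hs v r * hval (nth 0 hs (jjf hs r)) y <= 0).
  have -> : (lsubmx (rowsM hs v) *m y) r 0 = alpha hs v r * (lsubmx (nth 0 hs (jjf hs r)) *m y) 0 0.
    rewrite !mxE mulr_sumr; apply: eq_bigr => k _; rewrite !mxE mulrA; congr (_ * _ * _).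
    by rewrite (unsplitK (inl _ : 'I_n + 'I_1)) mxE.
  have -> : rsubmx (rowsM hs v) r 0 = - (alpha hs v r * rsubmx (nth 0 hs (jjf hs r)) 0 0).
    by rewrite !mxE (unsplitK (inr _ : 'I_n + 'I_1)) !mxE mulrN.
  by rewrite /hval mulrDr -subr_le0 opprK.
apply/funext => y; apply/propext; split => [h j jH|h r].
  have r1 : (j < 2 * H)%N by lia.
  have r2 : (H + j < 2 * H)%N by lia.
  have := h (Ordinal r1); have := h (Ordinal r2); rewrite !rowE /= /alpha /jjf jH.
  rewrite ltnNge leq_addr /= addKn; case: (nth 0%N v j) => [|[|k]] /=; rewrite ?mulN1r ?mul1r ?oppr_le0 //.
rewrite rowE /alpha /jjf; case: ifP => rH.
  by have [h1 h2] := h r rH; case: (nth 0%N v r) h1 h2 => [|[|k]] /= h1 h2;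
     rewrite ?mulN1r ?mul1r ?oppr_le0 ?h1 ?h2.
have rH2 : (r - H < H)%N by move: (ltn_ord r) rH => *; lia.
by have [h1 h2] := h _ rH2; case: (nth 0%N v (r - H)) h1 h2 => [|[|k]] /= h1 h2;
     rewrite ?mulN1r ?mul1r ?oppr_le0 ?h1 ?h2.
Qed.

Lemma svec_cell y : cellc (svec hs y) y.
Proof.
move=> j jH; rewrite (nth_map 0) // /sgd; by case: (ltrgt0P (hval _ y)).
Qed.

Lemma svec_nth y j : (j < H)%N -> nth 0%N (svec hs y) j = sgd (hval (nth 0 hs j) y).
Proof. by move=> jH; rewrite (nth_map 0). Qed.

(** A hyperplane vanishing at y but not at p would be crossed by prolonging the segment from p
    slightly beyond y; the prolongation lies in the affine hull and thus, if y is relatively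
    interior, in the cell. Conversely, forms of sign zero vanish on the whole affine hull and the
    others keep their sign near y. *)
Lemma relint_cell p y : relint (cellc (svec hs p)) y <-> svec hs y = svec hs p.
Proof.
have affE (j : nat) (X : set 'cV[R]_n) z : (j < H)%N -> (forall x, X x -> hval (nth 0 hs j) x = 0) ->
    aff_hull X z -> hval (nth 0 hs j) z = 0.
  move=> jH hX [k [q [w [hq w1 ->]]]]; set h := nth 0 hs j.
  have -> : hval h (q *m w) = \sum_i w i 0 * hval h (col i q).
    have hv i : true -> w i 0 * hval h (col i q) = w i 0 * (lsubmx h *m col i q) 0 0 + w i 0 * rsubmx h 0 0.
      by rewrite /hval mulrDr.
    rewrite (eq_bigr _ hv) big_split /= -mulr_suml w1 mul1r /hval mulmxA; congr (_ + _).
    by rewrite mxE; apply: eq_bigr => i _; rewrite mulrC -mul_col_entry.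
  by rewrite big1 // => i _; rewrite hX ?mulr0.
split.
  move=> [cy [e e0 he]]; apply/esym/(@eq_from_nth _ 0%N); first by rewrite !size_map.
  move=> j; rewrite size_map => jH; rewrite !svec_nth //.
  have aff t : aff_hull (cellc (svec hs p)) (y + t *: (p - y)).
    exists 2, (row_mx y p), (col_mx (1 - t)%:M t%:M); split.
    - move=> i; rewrite -[i]splitK; case: (split i) => k; rewrite (ord1 k) /=.
        by rewrite (_ : lshift 1 0 = lshift 1 (0 : 'I_1)) // colKl col_id.
      by rewrite colKr col_id; exact: svec_cell.
    - by rewrite big_split_ord /= !big_ord1 col_mxEu col_mxEd !mxE /= !mulr1n subrK.
    - by rewrite mul_row_col !mul_mx_scalar scalerBl scale1r scalerBr addrAC addrA.
  have [d d0 hd] : exists2 d : R, 0 < d & cellc (svec hs p) (y + (- d) *: (p - y)).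
    have [M M0 hM] : exists2 M : R, 0 < M & forall i, `|(p - y) i 0| < M.
      exists (1 + \sum_i `|(p - y) i 0|); first by rewrite ltr_pwDl // sumr_ge0.
      move=> i; rewrite (bigD1 i) //= addrCA ltr_pwDr // ?ltr_pwDl // sumr_ge0 //.
    exists (e / M); first exact: divr_gt0.
    apply: he; first exact: aff.
    have eM : 0 <= e / M by apply: ltW; apply: divr_gt0.
    move=> i; rewrite 2!mxE addrAC subrr add0r normrM normrN (ger0_norm eM).
    by rewrite mulrAC ltr_pdivrMr // ltr_pM2l.
  have := hd j jH; have := cy j jH; rewrite !svec_nth // hval_seg.
  move: (hval _ p) (hval _ y) => u v; rewrite /sgd opprK mulNr.
  case: (ltrgt0P u) => [u0|u0|u0]; case: (ltrgt0P v) => [v0|v0|v0] //= [h1 h2] [h3 h4].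
  all: try (by have := h1 isT); try (by have := h2 isT).
  - by have := h4 isT; rewrite v0 mulr0 add0r oppr_ge0 leNgt mulr_gt0.
  - by have := h3 isT; rewrite v0 mulr0 add0r oppr_le0 leNgt pmulr_rlt0 // u0.
move=> E; split; first by rewrite -E; exact: svec_cell.
have [e e0 he] := small [seq (hval h y, 1) | h <- hs].
(* [K] bounds the change of every form per unit of the maximum norm; the summand 1 makes it
   positive. *)
pose K := 1 + \sum_(h <- hs) \sum_i `|lsubmx h 0 i|.
have K0 : 0 < K by rewrite ltr_pwDl // sumr_ge0 // => h _; rewrite sumr_ge0.
exists (e / K); first exact: divr_gt0.
move=> z az hz j jH; set h := nth 0 hs j.
have hin : h \in hs by rewrite mem_nth.
have sv : sgd (hval h y) = nth 0%N (svec hs p) j by rewrite -E svec_nth.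
have [y0|y0] := eqVneq (hval h y) 0.
  have -> : hval h z = 0.
    apply: (affE j (cellc (svec hs p))) => // x /(_ j jH).
    by rewrite -sv y0 /sgd lexx /= -/h => -[/(_ isT) h1 /(_ isT) h2]; apply/le_anti/andP.
  by rewrite lexx.
have hzE : hval h z = hval h y + (lsubmx h *m (z - y)) 0 0.
  by rewrite -{1}(subrK y z) addrC -[z - y]scale1r hval_line mul1r scale1r.
have small_d : `|(lsubmx h *m (z - y)) 0 0| <= e.
  rewrite mxE; apply: le_trans (ler_norm_sum _ _ _) _.
  have ek : 0 < e / K by exact: divr_gt0.
  apply: (@le_trans _ _ (\sum_i `|lsubmx h 0 i| * (e / K))).
    apply: ler_sum => i _; rewrite normrM; apply: ler_wpM2l => //.
    by have := hz i; rewrite [X in _ -> `|X| <= _]mxE [X in _ -> `|_ + X| <= _]mxE => /ltW.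
  rewrite -mulr_suml mulrCA -[X in _ <= X]mulr1 ler_pM2l // ler_pdivrMr // mul1r /K.
  rewrite (big_rem h) //=; rewrite [X in _ <= 1 + X](_ : _ = \sum_i `|lsubmx h 0 i| + \sum_(g <- rem h hs) \sum_i `|lsubmx g 0 i|) //.
  have : 0 <= \sum_(g <- rem h hs) \sum_i `|lsubmx g 0 i| by rewrite sumr_ge0 // => g _; rewrite sumr_ge0.
  by move=> ?; lra.
have := he (hval h y, 1) (map_f _ hin) y0 _ small_d; rewrite /= mulr1 -hzE => /sgd_pos hs'.
by have := svec_cell z jH; rewrite svec_nth // -/h hs' sv.
Qed.

End Relint.

(** * Faces of polyhedra *)

From mathcomp Require Import boolp classical_sets functions cardinality reals.

Local Open Scope classical_set_scope.

Section Poly.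
Variables (R : realType) (m n : nat) (M : 'M[R]_(m, n)).
Implicit Types (c : 'cV[R]_m) (x d : 'cV[R]_n) (J : {set 'I_m}).

Definition tg c x : {set 'I_m} := [set i | (M *m x) i 0 == c i 0]%SET.
Definition kerfree J := forall d, (forall i, i \in J -> (M *m d) i 0 = 0) -> d = 0.

Lemma tgP c x i : i \in tg c x -> (M *m x) i 0 = c i 0.
Proof. by rewrite inE => /eqP. Qed.

Lemma poly_lt c x i : polyhedron M c x -> i \notin tg c x -> (M *m x) i 0 < c i 0.
Proof. by move=> /(_ i) h; rewrite inE lt_neqAle h andbT. Qed.

Lemma mul_line x d t i : (M *m (x + t *: d)) i 0 = (M *m x) i 0 + t * (M *m d) i 0.
Proof. by rewrite mulmxDr -scalemxAr !mxE. Qed.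

Lemma poly_step c x d : polyhedron M c x -> (forall i, i \in tg c x -> (M *m d) i 0 = 0) ->
  exists2 e, 0 < e & forall t, `|t| <= e -> polyhedron M c (x + t *: d).
Proof.
move=> px hd.
have [e e0 he] := small [seq (c i 0 - (M *m x) i 0, - (M *m d) i 0) | i <- enum 'I_m].
exists e => // t te i; rewrite mul_line.
have [it|it] := boolP (i \in tg c x); first by rewrite hd // mulr0 addr0 px.
have lt := poly_lt px it; have := he (c i 0 - (M *m x) i 0, - (M *m d) i 0).
move=> /(_ (map_f _ (mem_enum _ i))) /=; rewrite subr_eq0 (gt_eqF lt) => /(_ isT t te).
by rewrite pmulr_lgt0 ?subr_gt0 // => h; lra.
Qed.

(** All constraints tight at x are tight at z, so the segment from z to x can be prolonged beyond x
    inside the polyhedron. The supporting functional is maximal at x, hence not smaller at z. *)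
Lemma face_sat c F x z : face (polyhedron M c) F -> F x -> polyhedron M c z ->
  tg c x \subset tg c z -> F z.
Proof.
move=> [f [d0 [val ->]]] [px fx] pz sub.
have [e e0 he] : exists2 e, 0 < e & forall t, `|t| <= e -> polyhedron M c (x + t *: (x - z)).
  apply: poly_step => // i it; rewrite mulmxBr [LHS]mxE [X in _ + X]mxE (tgP it).
  by rewrite (tgP (fintype.subsetP sub i it)) subrr.
split => //; apply/le_anti/andP; split; first exact: val.
have := val _ (he e _); rewrite ger0_norm ?lexx ?(ltW e0) // => /(_ isT).
have -> : (f *m (x + e *: (x - z))) 0 0 = d0 + e * (d0 - (f *m z) 0 0).
  by rewrite mulmxDr -scalemxAr mulmxBr -fx; move: (f *m x) (f *m z) => a1 a2; rewrite !mxE.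
by rewrite gerDl pmulr_rle0 // subr_le0.
Qed.

Definition faceT c J : set 'cV[R]_n := [set x | polyhedron M c x /\ J \subset tg c x].

(** The sum of the rows in [J] is a supporting functional: it reaches the sum of the bounds exactly
    where each single bound is reached. *)
Lemma face_faceT c J : face (polyhedron M c) (faceT c J).
Proof.
exists (\sum_(i in J) row i M), (\sum_(i in J) c i 0).
have E x : ((\sum_(i in J) row i M) *m x) 0 0 = \sum_(i in J) (M *m x) i 0.
  rewrite mulmx_suml summxE; apply: eq_bigr => i _.
  by rewrite -row_mul mxE.
split; first by move=> x px; rewrite E; apply: ler_sum.
apply/seteqP; split => x /= [px hx]; split => //.
  by rewrite E; apply: eq_bigr => i iJ; apply: tgP; apply: (fintype.subsetP hx).
apply/fintype.subsetP => i iJ; rewrite inE; move: hx; rewrite E => /eqP; rewrite -subr_eq0 -sumrB.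
have : forall k, k \in J -> (M *m x) k 0 - c k 0 <= 0 by move=> k _; rewrite subr_le0 px.
move=> hk; rewrite -oppr_eq0 -sumrN psumr_eq0; last by move=> k kJ; rewrite oppr_ge0 hk.
by move=> /allP/(_ i (mem_index_enum i)); rewrite iJ /= oppr_eq0 subr_eq0.
Qed.

Lemma face0 c : face (polyhedron M c) set0.
Proof.
exists 0, 1; split; first by move=> x _; rewrite mul0mx mxE ler01.
by apply/seteqP; split => x //= -[_]; rewrite mul0mx mxE => /eqP; rewrite eq_sym oner_eq0.
Qed.

Lemma face_sub c F x : face (polyhedron M c) F -> F x -> polyhedron M c x.
Proof. by move=> [f [d0 [_ ->]]] []. Qed.

Definition mid x z := 2%:R^-1 *: x + 2%:R^-1 *: z.

Lemma mul_mid x z i : (M *m mid x z) i 0 = 2%:R^-1 * (M *m x) i 0 + 2%:R^-1 * (M *m z) i 0.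
Proof. by rewrite mulmxDr -!scalemxAr !mxE. Qed.

Lemma poly_mid c x z : polyhedron M c x -> polyhedron M c z ->
  polyhedron M c (mid x z) /\ tg c (mid x z) = tg c x :&: tg c z.
Proof.
move=> px pz; split => [i|]; first by rewrite mul_mid; have := px i; have := pz i; lra.
apply/setP => i; rewrite !inE mul_mid; have := px i; have := pz i => h1 h2.
by apply/eqP/andP => [h|[/eqP h3 /eqP h4]]; [split; apply/eqP; lra|lra].
Qed.

Lemma face_mid c F x z : face (polyhedron M c) F -> F x -> F z -> F (mid x z).
Proof.
move=> fF fx fz; have := face_sub fF fx; have := face_sub fF fz => pz px.
case: fF fx fz => f [d0 [val ->]] [_ ex] [_ ez]; split; first by have [] := poly_mid px pz.
move: ex ez; rewrite !mxE => ex ez.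
have -> : \sum_j f 0 j * mid x z j 0 = 2%:R^-1 * (\sum_j f 0 j * x j 0) + 2%:R^-1 * (\sum_j f 0 j * z j 0).
  by rewrite !mulr_sumr -big_split /=; apply: eq_bigr => j _; rewrite !mxE; ring.
by rewrite ex ez; lra.
Qed.

(* A point of smallest tight set lies in the relative interior of the face. *)
Lemma face_relpt c F x0 : face (polyhedron M c) F -> F x0 ->
  exists2 x, F x & forall z, F z -> tg c x \subset tg c z.
Proof.
move=> fF fx0.
have : exists2 k, (exists2 x, F x & #|tg c x| = k) & forall z, F z -> (k <= #|tg c z|)%N.
  have : exists k, `[< exists2 x, F x & #|tg c x| = k >] by exists #|tg c x0|; apply/asboolP; exists x0.
  case/ex_minnP => k /asboolP hk hmin; exists k => // z fz; apply: hmin; apply/asboolP; by exists z.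
move=> [k [x fx xk] hmin]; exists x => // z fz.
have [_ tE] := poly_mid (face_sub fF fx) (face_sub fF fz).
have := hmin _ (face_mid fF fx fz); rewrite tE -xk => le.
have /eqP <- : tg c x :&: tg c z == tg c x by rewrite eqEcard finset.subsetIl le.
exact: finset.subsetIr.
Qed.

Lemma face_eqT c F x : face (polyhedron M c) F -> F x -> (forall z, F z -> tg c x \subset tg c z) ->
  F = faceT c (tg c x).
Proof.
move=> fF fx h; apply/seteqP; split => z; first by move=> fz; split; [exact: face_sub fF fz|exact: h].
by move=> [pz sub]; apply: face_sat fF fx pz sub.
Qed.

Lemma faces_finite c : finite_set (faces (polyhedron M c)).
Proof.
pose G (o : option {set 'I_m}) := if o is Some J then faceT c J else set0.
apply: (@sub_finite_set _ _ (G @` [set: option {set 'I_m}])); last first.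
  by apply: finite_image; apply: finite_finset.
move=> F fF; have [e|/set0P[x0 fx0]] := eqVneq F set0; first by exists None.
have [x fx hx] := face_relpt fF fx0.
by exists (Some (tg c x)) => //=; rewrite (face_eqT fF fx hx).
Qed.

(** A nonzero direction annihilated by the tight rows could be followed a little way, giving a
    second point of the face; if there is none, the tight equalities have a single solution. *)
Lemma vertP c v : vert (polyhedron M c) v <-> polyhedron M c v /\ kerfree (tg c v).
Proof.
split.
  move=> fF; have pv := face_sub fF (erefl v : [set v] v); split => // d hd.
  have [e e0 he] := poly_step pv hd.
  have /= := @face_sat c [set v] v (v + e *: d) fF erefl (he e _).
  rewrite ger0_norm ?lexx ?(ltW e0) // => /(_ isT) h.
  have : v + e *: d = v.
    apply: h; apply/fintype.subsetP => i it; rewrite inE mul_line hd // mulr0 addr0.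
    by rewrite (tgP it).
  rewrite -[X in _ = X -> _]addr0 => /addrI /eqP; rewrite scaler_eq0 gt_eqF //= => /eqP.
  by [].
move=> [pv kf]; rewrite /vert /=.
suff -> : [set v] = faceT c (tg c v) by exact: face_faceT.
apply/seteqP; split => x; first by move=> /= ->; split.
move=> [px sub] /=; apply/eqP; rewrite -subr_eq0; apply/eqP; apply: kf => i it.
rewrite mulmxBr [LHS]mxE [X in _ + X]mxE (tgP it).
by rewrite (tgP (fintype.subsetP sub i it)) subrr.
Qed.

Hypothesis kfT : forall d, (forall i, (M *m d) i 0 = 0) -> d = 0.

Lemma ray c x d : polyhedron M c x -> (forall i, i \in tg c x -> (M *m d) i 0 = 0) ->
  (exists i, 0 < (M *m d) i 0) ->
  exists t, [/\ 0 < t, polyhedron M c (x + t *: d), tg c x \subset tg c (x + t *: d) &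
    (#|tg c x| < #|tg c (x + t *: d)|)%N].
Proof.
move=> px hd [i0 hi0].
pose f i := (c i 0 - (M *m x) i 0) / (M *m d) i 0.
have i0s : i0 \in [seq i <- enum 'I_m | 0 < (M *m d) i 0] by rewrite mem_filter hi0 mem_enum.
have [j] := seq_min f i0s; rewrite mem_filter => /andP[jd _] hmin.
have jt : j \notin tg c x by apply/negP => /hd e; rewrite e ltxx in jd.
have fj : 0 < f j by apply: divr_gt0 => //; rewrite subr_gt0; apply: poly_lt.
have sub : tg c x \subset tg c (x + f j *: d).
  by apply/fintype.subsetP => i it; rewrite inE mul_line hd // mulr0 addr0 (tgP it).
exists (f j); split => //.
  move=> i; rewrite mul_line; case: (ltP 0 ((M *m d) i 0)) => di; last first.
    have : f j * (M *m d) i 0 <= 0 by rewrite pmulr_rle0.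
    by have := px i; lra.
  have : f j <= f i by apply: hmin; rewrite mem_filter di mem_enum.
  by rewrite /f ler_pdivlMr //; lra.
apply: proper_card; apply/properP; split => //; exists j => //.
have fE : f j * (M *m d) j 0 = c j 0 - (M *m x) j 0 by rewrite /f mulfVK // gt_eqF.
by rewrite inE mul_line fE addrC subrK.
Qed.

(** The decomposition into vertices and recession directions, as an induction principle. Unless x is
    a vertex, some direction keeps its tight constraints tight. Following it both ways leads to
    points with more tight constraints between which x lies; if one way is unbounded, x is such a
    point plus a recession direction. *)
Lemma poly_ind c (Pr : 'cV[R]_n -> Prop) :
  (forall x, polyhedron M c x -> kerfree (tg c x) -> Pr x) ->
  (forall x1 x2 l, 0 < l -> l < 1 -> polyhedron M c x1 -> polyhedron M c x2 -> Pr x1 -> Pr x2 ->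
     Pr (x1 + l *: (x2 - x1))) ->
  (forall x1 d t, 0 < t -> polyhedron M c x1 -> Pr x1 -> (forall i, (M *m d) i 0 <= 0) ->
     Pr (x1 + t *: d)) ->
  forall x, polyhedron M c x -> Pr x.
Proof.
move=> h1 h2 h3 x; move Ek : (m - #|tg c x|)%N => k.
elim/ltn_ind: k x Ek => k IH x Ek px.
have rec t d : polyhedron M c (x + t *: d) -> (#|tg c x| < #|tg c (x + t *: d)|)%N -> Pr (x + t *: d).
  move=> pt lt; apply: (IH (m - #|tg c (x + t *: d)|)%N) => //.
  have : (#|tg c (x + t *: d)| <= m)%N by rewrite -[X in (_ <= X)%N]card_ord max_card.
  by rewrite -Ek; lia.
have [kf|] := pselect (kerfree (tg c x)); first exact: h1.
move=> /existsNP[d /not_implyP[hd /eqP d0]].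
have [i di] : exists i, (M *m d) i 0 != 0.
  apply: contrapT => /forallNP h; apply/(elimN eqP d0); apply: kfT => i.
  by apply/eqP; rewrite -[X in is_true X]negbK; apply/negP; apply: h.
have main d' : (forall i, i \in tg c x -> (M *m d') i 0 = 0) -> (exists i, 0 < (M *m d') i 0) -> Pr x.
  move=> hd' [i1 di1]; have [t [t0 pt sub lt]] := ray px hd' (ex_intro _ i1 di1).
  have Pt := rec t d' pt lt.
  have hdN : forall i, i \in tg c x -> (M *m (- d')) i 0 = 0.
    by move=> k' k't; rewrite mulmxN mxE hd' // oppr0.
  have [[i2 di2]|nex] := pselect (exists i, 0 < (M *m (- d')) i 0).
    have [t' [t'0 pt' sub' lt']] := ray px hdN (ex_intro _ i2 di2).
    have Pt' := rec t' (- d') pt' lt'.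
    have tt : 0 < t + t' by lra.
    have := h2 _ _ (t / (t + t')) _ _ pt pt' Pt Pt'.
    rewrite divr_gt0 // ltr_pdivrMr // mul1r ltrDl t'0 => /(_ isT isT).
    suff -> : x + t *: d' + (t / (t + t')) *: (x + t' *: (- d') - (x + t *: d')) = x by [].
    have -> : x + t' *: (- d') - (x + t *: d') = - (t + t') *: d'.
      by rewrite opprD addrACA subrr add0r scalerN -opprD scaleNr scalerDl addrC.
    by rewrite scalerA mulrN mulfVK ?gt_eqF // scaleNr addrK.
  have := h3 _ (- d') t t0 pt Pt _; rewrite scalerN addrK; apply => k'.
  by rewrite leNgt; apply/negP => h; apply: nex; exists k'.
case: (ltrgt0P ((M *m d) i 0)) di => // di _; first by apply: main hd _; exists i.
apply: (main (- d)); first by move=> k' k't; rewrite mulmxN mxE hd // oppr0.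
by exists i; rewrite mulmxN mxE oppr_gt0.
Qed.

Lemma vertex_exists c x : polyhedron M c x -> exists2 v, polyhedron M c v & kerfree (tg c v).
Proof. by move=> px; apply: (@poly_ind c (fun=> exists2 v, polyhedron M c v & kerfree (tg c v))) px => // y ? ?; exists y. Qed.

(** The tight set of a proper convex combination is the intersection of the two tight sets, and
    adding a recession direction intersects with the rows vanishing on it. Neither operation depends
    on the right-hand side, so the construction of a point from vertices can be copied. *)
Lemma tg_transfer c c' :
  (forall v, polyhedron M c v -> kerfree (tg c v) ->
     exists2 v', polyhedron M c' v' & tg c' v' = tg c v) ->
  forall x, polyhedron M c x -> exists2 x', polyhedron M c' x' & tg c' x' = tg c x.
Proof.
move=> hv; apply: poly_ind => //.
- move=> x1 x2 l l0 l1 p1 p2 [y1 q1 e1] [y2 q2 e2].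
  have seg (cc : 'cV[R]_m) z1 z2 : polyhedron M cc z1 -> polyhedron M cc z2 ->
     polyhedron M cc (z1 + l *: (z2 - z1)) /\ tg cc (z1 + l *: (z2 - z1)) = tg cc z1 :&: tg cc z2.
    move=> r1 r2; have E i : (M *m (z1 + l *: (z2 - z1))) i 0 = (1 - l) * (M *m z1) i 0 + l * (M *m z2) i 0.
      by rewrite mul_line mulmxBr [X in _ + l * X]mxE [X in _ + l * (_ + X)]mxE; ring.
    have l1' : 0 < 1 - l by lra.
    have r1' i : (1 - l) * (M *m z1) i 0 <= (1 - l) * cc i 0 by rewrite ler_pM2l // r1.
    have r2' i : l * (M *m z2) i 0 <= l * cc i 0 by rewrite ler_pM2l // r2.
    split => [i|]; first by rewrite E; have := r1' i; have := r2' i; lra.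
    apply/setP => i; rewrite !inE E; have := r1' i; have := r2' i => a1 a2.
    apply/eqP/andP => [h|[/eqP -> /eqP ->]]; last by ring.
    split; apply/eqP.
      by apply: (mulfI (lt0r_neq0 l1')); lra.
    by apply: (mulfI (lt0r_neq0 l0)); lra.
  have [s1 t1] := seg c' _ _ q1 q2; have [_ t2] := seg c _ _ p1 p2.
  by exists (y1 + l *: (y2 - y1)) => //; rewrite t1 t2 e1 e2.
- move=> x1 d t t0 p1 [y1 q1 e1] hd.
  have rayE (cc : 'cV[R]_m) z : polyhedron M cc z -> polyhedron M cc (z + t *: d) /\
     tg cc (z + t *: d) = tg cc z :&: [set i | (M *m d) i 0 == 0]%SET.
    move=> r; have td i : t * (M *m d) i 0 <= 0 by rewrite pmulr_rle0.
    split => [i|]; first by rewrite mul_line; have := r i; have := td i; lra.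
    apply/setP => i; rewrite !inE mul_line; have := r i; have := td i => a1 a2.
    apply/eqP/andP => [h|[/eqP -> /eqP ->]]; last by rewrite mulr0 addr0.
    have z0 : t * (M *m d) i 0 = 0 by lra.
    split; apply/eqP; first by lra.
    by apply/eqP; move/eqP: z0; rewrite mulf_eq0 gt_eqF.
  have [s1 t1] := rayE c' _ q1; have [_ t2] := rayE c _ p1.
  by exists (y1 + t *: d) => //; rewrite t1 t2 e1.
Qed.

(** A face corresponds to the points of the other polyhedron that share their tight set with one of
    its points. Going back and forth returns the face, because with x it contains all points whose
    tight set contains that of x. *)
Lemma comb_type c c' :
  (forall x, polyhedron M c x -> exists2 x', polyhedron M c' x' & tg c' x' = tg c x) ->
  (forall x, polyhedron M c' x -> exists2 x', polyhedron M c x' & tg c x' = tg c' x) ->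
  same_combinatorial_type (polyhedron M c) (polyhedron M c').
Proof.
move=> h1 h2.
pose phi (c1 c2 : 'cV[R]_m) (F : set 'cV[R]_n) : set 'cV[R]_n :=
  [set z | polyhedron M c2 z /\ exists2 x, F x & tg c1 x = tg c2 z].
have phi_face (c1 c2 : 'cV[R]_m) F :
   (forall x, polyhedron M c1 x -> exists2 x', polyhedron M c2 x' & tg c2 x' = tg c1 x) ->
   (forall x, polyhedron M c2 x -> exists2 x', polyhedron M c1 x' & tg c1 x' = tg c2 x) ->
   face (polyhedron M c1) F -> face (polyhedron M c2) (phi c1 c2 F).
  move=> k1 k2 fF; have [e|/set0P[x0 fx0]] := eqVneq F set0.
    suff -> : phi c1 c2 F = set0 by exact: face0.
    by apply/seteqP; split => z //= [_ [x]]; rewrite e.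
  have [x fx hx] := face_relpt fF fx0.
  suff -> : phi c1 c2 F = faceT c2 (tg c1 x) by exact: face_faceT.
  apply/seteqP; split => z /=.
    by move=> [pz [x' fx' e]]; split => //; rewrite -e; exact: hx.
  move=> [pz sub]; split => //; have [z' pz' tz'] := k2 z pz; exists z' => //.
  by apply: face_sat fF fx pz' _; rewrite tz'.
have phiK (c1 c2 : 'cV[R]_m) F :
   (forall x, polyhedron M c1 x -> exists2 x', polyhedron M c2 x' & tg c2 x' = tg c1 x) ->
   face (polyhedron M c1) F -> phi c2 c1 (phi c1 c2 F) = F.
  move=> k1 fF; apply/seteqP; split => z /=.
    move=> [pz [w [pw [x fx e1]] e2]]; apply: face_sat fF fx pz _; by rewrite e1 e2.
  move=> fz; have pz := face_sub fF fz; split => //; have [w pw tw] := k1 z pz.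
  by exists w => //; split => //; exists z.
have mono (c1 c2 : 'cV[R]_m) F G : F `<=` G -> phi c1 c2 F `<=` phi c1 c2 G.
  by move=> FG z [pz [x fx e]]; split => //; exists x => //; exact: FG.
exists (phi c c'); split; last first.
  move=> F G fF fG; split; first exact: mono.
  by move=> /(@mono c' c); rewrite !phiK.
split.
- by move=> F fF; apply: phi_face.
- move=> F G /set_mem fF /set_mem fG e.
  by rewrite -(phiK c c' F) // e phiK.
- move=> G fG; exists (phi c' c G); first exact: phi_face.
  exact: phiK.
Qed.

End Poly.

(** * Faces of the parametric polyhedron *)

Lemma row_entry (R : realType) m p n (A' : 'M[R]_(m, p)) (N : 'M[R]_(p, n)) i j :
  (A' *m N) i j = (row i A' *m N) 0 j.
Proof. by rewrite -row_mul [RHS]mxE. Qed.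

(** * From a reduced system to a base of A *)

Section RedLin.
Variables (R : realType) (m nx e : nat) (A : 'M[R]_(m, nx)) (BB : 'M[R]_(m, e)).
Implicit Types (I PM : {set 'I_m}) (V : 'M[R]_(nx, nx + e)).

Lemma subrowsE n k (J : {set 'I_m}) (E : #|J| = k) (N : 'M[R]_(m, n)) i j :
  subrows k N J i j = N (enum_val (cast_ord (esym E) i)) j.
Proof. by case: k / E i => i; rewrite /subrows conform_mx_id mxE cast_ord_id. Qed.

Lemma subrows_free PM k (E : #|PM| = k) :
  (forall l : 'rV_m, (forall i, i \notin PM -> l 0 i = 0) -> l *m A = 0 -> l = 0) ->
  row_free (subrows k A PM).
Proof.
move=> ind; apply: inj_row_free => l' hl'.
pose ev (r : 'I_k) := enum_val (cast_ord (esym E) r).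
pose l : 'rV[R]_m := \row_i \sum_r l' 0 r * (ev r == i)%:R.
have l0 : l = 0.
  apply: ind => [i iP|].
    rewrite mxE big1 // => r _; case: eqP => [ee|]; last by rewrite mulr0.
    by move: iP; rewrite -ee enum_valP.
  rewrite -hl'; apply/rowP => j; rewrite !mxE.
  under eq_bigr do rewrite mxE mulr_suml.
  rewrite exchange_big /=; apply: eq_bigr => r _; rewrite subrowsE -/(ev r).
  by rewrite (bigD1 (ev r)) //= eqxx mulr1 big1 ?addr0 // => i ir; rewrite eq_sym (negbTE ir) mulr0 mul0r.
apply/rowP => r; move/rowP: l0 => /(_ (ev r)); rewrite !mxE (bigD1 r) //= eqxx mulr1 big1 ?addr0 //.
move=> r' rr'; case: eqP => [/enum_val_inj/cast_ord_inj ee|]; last by rewrite mulr0.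
by rewrite ee eqxx in rr'.
Qed.

Lemma sub_rows_ker PM k (E : #|PM| = k) (d : 'cV[R]_nx) : subrows k A PM *m d = 0 ->
  forall i, i \in PM -> (A *m d) i 0 = 0.
Proof.
move=> h i iP; have [r ir] : exists r, i = enum_val (cast_ord (esym E) r).
  exists (cast_ord E (enum_rank_in iP i)); rewrite cast_ordK enum_rankK_in //.
move/colP: h => /(_ r); rewrite [RHS]mxE => <-; rewrite !mxE.
by apply: eq_bigr => j _; rewrite subrowsE -ir.
Qed.

Lemma sub_rows_ker' PM k (E : #|PM| = k) (d : 'cV[R]_nx) :
  (forall i, i \in PM -> (A *m d) i 0 = 0) -> subrows k A PM *m d = 0.
Proof.
move=> h; apply/colP => r; rewrite [RHS]mxE -(h _ (enum_valP (cast_ord (esym E) r))) !mxE.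
by apply: eq_bigr => j _; rewrite subrowsE.
Qed.

(** The rows in [PM] are independent. A vector in their common kernel is fixed by the left block of
    [V], whose columns all rows of [I] annihilate, so it is zero. The two facts give the two bounds
    on the size of [PM]. *)
Lemma red_full I PM V : red_inv A BB I PM V -> kerfree A I -> #|PM| = nx.
Proof.
move=> ri kf; set S := subrows #|PM| A PM.
have fr : row_free S by apply: subrows_free => //; exact: ri.(ri_ind).
have kP : kerfree A PM.
  move=> d hd; have fx : lsubmx V *m d = d.
    by apply: ri.(ri_fix) => j jP; apply/matrixP => a c; rewrite !ord1 -row_entry hd // mxE.
  apply: kf => i iI; rewrite -fx row_entry mulmxA ri.(ri_ker) // mul0mx mxE //.
have : row_free S^T.
  apply: inj_row_free => v hv; apply: trmx_inj; rewrite trmx0; apply: kP.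
  apply: (sub_rows_ker (erefl #|PM|)); apply: trmx_inj.
  by rewrite trmx_mul trmxK trmx0.
by move: fr; rewrite /row_free mxrank_tr => /eqP-> /eqP.
Qed.

Lemma red_unit I PM V : red_inv A BB I PM V -> #|PM| = nx -> subrows nx A PM \in unitmx.
Proof. by move=> ri E; rewrite -row_free_unit; apply: subrows_free => //; exact: ri.(ri_ind). Qed.

Lemma red_kerfree I PM V : red_inv A BB I PM V -> #|PM| = nx -> kerfree A PM.
Proof.
move=> ri E d hd; have := sub_rows_ker' E hd => h.
by rewrite -[d](mulKmx (red_unit ri E)) h mulmx0.
Qed.

Lemma red_sol I PM V i : red_inv A BB I PM V -> i \in PM -> row i A *m rsubmx V = row i BB.
Proof.
move=> ri /ri.(ri_eq) /(congr1 rsubmx); rewrite rsub_rowm linear0 => /eqP.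
by rewrite subr_eq0 => /eqP.
Qed.

(** This identifies what the elimination leaves in the right block with the parametric vertex of the
    base [PM]. *)
Lemma red_vertex I PM V : red_inv A BB I PM V -> #|PM| = nx ->
  rsubmx V = invmx (subrows nx A PM) *m subrows nx BB PM.
Proof.
move=> ri E; rewrite -[LHS](mulKmx (red_unit ri E)); congr (_ *m _).
apply/matrixP => r j; rewrite mxE; under eq_bigr do rewrite subrowsE.
rewrite subrowsE; have := red_sol ri (enum_valP (cast_ord (esym E) r)) => /rowP/(_ j).
by rewrite !mxE => <-; apply: eq_bigr => k _; rewrite !mxE.
Qed.

End RedLin.

(** * Parametric vertices as graphs over the parameter space *)

Section Param.
Variables (R : realType) (m nx ny : nat).
Variables (A : 'M[R]_(m, nx)) (B : 'M[R]_(m, ny)) (b : 'cV[R]_m).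
Notation BB := (row_mx B b).
Notation xof X y := (X *m col_mx y (1%:M : 'M[R]_1)).

Definition cy (y : 'cV[R]_ny) : 'cV[R]_m := b + B *m y.
Definition MM : 'M[R]_(m, nx + ny) := row_mx A (- B).
(** The residual of inequality i along the parametric vertex y -> X (y, 1): an affine form in y,
    nonpositive where the vertex satisfies the inequality. *)
Definition hX (X : 'M[R]_(nx, ny + 1)) i : 'rV[R]_(ny + 1) := row i A *m X - row i BB.
Definition Xs (J : {set 'I_m}) (X : 'M[R]_(nx, ny + 1)) := forall i, i \in J -> row i A *m X = row i BB.

Lemma MM_col x y i : ((MM *m col_mx x y) i 0 <= b i 0) = ((A *m x) i 0 <= cy y i 0).
Proof.
rewrite /MM mul_row_col mulNmx /cy; move: (A *m x) (B *m y) => p q; rewrite !mxE.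
by rewrite lerBlDr.
Qed.

Lemma MM_tg x y : tg MM b (col_mx x y) = tg A (cy y) x.
Proof.
apply/setP => i; rewrite !inE /MM mul_row_col mulNmx /cy; move: (A *m x) (B *m y) => p q; rewrite !mxE.
by rewrite subr_eq.
Qed.

Lemma MM_poly x y : polyhedron MM b (col_mx x y) <-> polyhedron A (cy y) x.
Proof. by split => h i; have := h i; rewrite MM_col. Qed.

Lemma hX_val X i y : hval (hX X i) y = (A *m xof X y) i 0 - cy y i 0.
Proof.
rewrite hval_col /hX mulmxBl -mulmxA -!row_mul mul_row_col mulmx1 /cy [b + _]addrC.
by move: (A *m _) (B *m y + b) => p q; rewrite !mxE.
Qed.

Lemma Xs_hX J X i : Xs J X -> i \in J -> hX X i = 0.
Proof. by move=> h /h; rewrite /hX => ->; rewrite subrr. Qed.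

Lemma hval0 n (y : 'cV[R]_n) : hval (0 : 'rV[R]_(n + 1)) y = 0.
Proof. by rewrite /hval !linear0 mul0mx !mxE addr0. Qed.

Lemma xof_unique J X x y : kerfree A J -> Xs J X -> (forall i, i \in J -> (A *m x) i 0 = cy y i 0) ->
  x = xof X y.
Proof.
move=> kf hX' hx; apply/eqP; rewrite -subr_eq0; apply/eqP; apply: kf => i iJ.
have := hX_val X i y; rewrite (Xs_hX hX' iJ) hval0 => /esym/eqP; rewrite subr_eq0 => /eqP e.
by rewrite mulmxBr [LHS]mxE [X in _ + X]mxE hx // e subrr.
Qed.

Definition tightR (F : set 'cV[R]_(nx + ny)) i := forall z, F z -> i \in tg MM b z.

Definition faceI d (I : {set 'I_m}) := exists F, [/\ face (polyhedron MM b) F, has_dim F d &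
  forall i, i \in I <-> tightR F i].

(** The map y -> (X (y, 1), y) in homogeneous coordinates. It has a left inverse, so affine
    independence passes between a graph and its projection. *)
Definition lift1 (X : 'M[R]_(nx, ny + 1)) : 'M[R]_(nx + ny + 1, ny + 1) :=
  col_mx (col_mx X (row_mx 1%:M 0)) (row_mx 0 1%:M).

Lemma lift1E X k (ys : 'M[R]_(ny, k)) (o : 'rV[R]_k) :
  lift1 X *m col_mx ys o = col_mx (col_mx (X *m col_mx ys o) ys) o.
Proof. by rewrite /lift1 !mul_col_mx !mul_row_col !mul1mx !mul0mx addr0 add0r. Qed.

Lemma graph_pts (F : set 'cV[R]_(nx + ny)) (X : 'M[R]_(nx, ny + 1)) k (p : 'M[R]_(nx + ny, k)) :
  (forall z, F z -> usubmx z = xof X (dsubmx z)) -> (forall j, F (col j p)) ->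
  col_mx p (const_mx 1 : 'rV[R]_k) = lift1 X *m col_mx (dsubmx p) (const_mx 1).
Proof.
move=> gr hp; rewrite lift1E; congr col_mx; rewrite -[LHS]vsubmxK; congr col_mx.
apply/matrixP => i j; have := gr _ (hp j) => /colP/(_ i); rewrite [LHS]mxE [LHS]mxE => e.
rewrite [LHS]mxE e [RHS]mul_col_entry; congr ((_ *m _) _ _); rewrite col_col_mx; congr col_mx.
  by apply/colP => a; rewrite !mxE.
by apply/matrixP => a c; rewrite !ord1 !mxE.
Qed.

Lemma has_dim_graph (F : set 'cV[R]_(nx + ny)) (X : 'M[R]_(nx, ny + 1)) k :
  (forall z, F z -> usubmx z = xof X (dsubmx z)) ->
  (exists2 ys : 'M[R]_(ny, k), (forall j, F (col_mx (xof X (col j ys)) (col j ys))) &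
     \rank (col_mx ys (const_mx 1 : 'rV[R]_k)) = k) ->
  (forall ys : 'M[R]_(ny, k.+1), (forall j, F (col_mx (xof X (col j ys)) (col j ys))) ->
     (\rank (col_mx ys (const_mx 1%R : 'rV[R]_(k.+1))) <= k)%N) ->
  has_dim F (k%:Z - 1).
Proof.
move=> gr [ys hys rys] up; exists k; split => //.
  have colE' j : col j (col_mx ys (const_mx 1 : 'rV[R]_k)) = col_mx (col j ys) (1%:M : 'M[R]_1).
    rewrite col_col_mx; congr col_mx; by apply/matrixP => a c; rewrite !ord1 !mxE.
  exists (col_mx (X *m col_mx ys (const_mx 1)) ys).
    move=> j; rewrite col_col_mx; have := hys j; congr (F (col_mx _ _)).
    by rewrite -colE' !colE mulmxA.
  rewrite /aff_indep -lift1E eqn_leq rank_leq_col /= -{1}rys.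
  pose S : 'M[R]_(ny + 1, nx + ny + 1) := block_mx (row_mx 0 1%:M) 0 0 1%:M.
  have SE : S *m lift1 X = 1%:M.
    rewrite /S /lift1 mul_block_col mul_row_col !mul0mx mul1mx add0r addr0 add0r mul1mx.
    by rewrite [RHS]scalar_mx_block.
  by rewrite -{1}[col_mx ys _]mul1mx -SE -mulmxA; exact: mxrankM_maxr.
move=> p hp; rewrite /aff_indep (graph_pts gr hp) neq_ltn ltnS.
apply/orP; left; apply: leq_trans (mxrankM_maxr _ _) _; apply: up => j.
have := hp j; congr (F _); rewrite -[LHS]vsubmxK; congr col_mx; last by apply/colP => i; rewrite !mxE.
by rewrite (gr _ (hp j)); congr (_ *m col_mx _ _); apply/colP => i; rewrite !mxE.
Qed.

(** A form that is positive at one point and nonnegative at another is positive at their midpoint;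
    the witnesses for the single forms are merged in this way. *)
Lemma avg n (gs : seq 'rV[R]_(n + 1)) (Q : 'cV[R]_n -> Prop) y1 : Q y1 ->
  (forall y, Q y -> forall g, g \in gs -> 0 <= hval g y) ->
  (forall x y, Q x -> Q y -> Q (x + 2%:R^-1 *: (y - x))) ->
  (forall g, g \in gs -> exists2 y, Q y & 0 < hval g y) ->
  exists2 y, Q y & forall g, g \in gs -> 0 < hval g y.
Proof.
move=> Q1 hge hmid; elim: gs hge => [|g gs IH] hge hex; first by exists y1.
have [||y Qy hy] := IH.
- by move=> y Qy g' g's; apply: hge; rewrite ?in_cons ?g's ?orbT.
- by move=> g' g's; apply: hex; rewrite in_cons g's orbT.
have [z Qz hz] := hex g (mem_head _ _).
exists (y + 2%:R^-1 *: (z - y)); first exact: hmid.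
move=> g'; rewrite in_cons hval_seg => /orP[/eqP->|g's].
  by have := hge y Qy g (mem_head _ _); lra.
have := hge z Qz g'; rewrite in_cons g's orbT => /(_ isT).
by have := hy g' g's; lra.
Qed.

Lemma face_conv c F x z : face (polyhedron MM c) F -> F x -> F z -> F (x + 2%:R^-1 *: (z - x)).
Proof.
move=> fF fx fz; have := face_mid fF fx fz; rewrite /mid; congr F.
by apply/colP => a; rewrite !mxE; lra.
Qed.

(** The tight rows make the face a graph over y, so n_y + 1 affinely independent points of it have
    affinely independent projections; a residual from [I] vanishes at all of these and is zero.
    Averaging yields one y at which all other residuals are negative. *)
Lemma Lfull (I PM : {set 'I_m}) X : faceI ny%:Z I -> PM \subset I -> kerfree A PM -> Xs PM X ->
  (forall i, i \in I -> hX X i = 0) /\ exists y, forall i, i \notin I -> hval (hX X i) y < 0.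
Proof.
move=> [F [fF [k [kE [p hp ind] _]] tF]] sub kf xs.
have gr z : F z -> usubmx z = xof X (dsubmx z).
  move=> fz; apply: (xof_unique kf xs) => i iP.
  have /tF/(_ z fz) : i \in I by apply: (fintype.subsetP sub).
  by rewrite -{1}[z]vsubmxK MM_tg => /tgP.
have kE' : k = (ny + 1)%N by lia.
have full : row_free (col_mx (dsubmx p) (const_mx 1 : 'rV[R]_k)).
  have := mxrankM_maxr (lift1 X) (col_mx (dsubmx p) (const_mx 1 : 'rV[R]_k)).
  rewrite -(graph_pts gr hp) (eqP ind) => h; rewrite /row_free eqn_leq rank_leq_row /=.
  by apply: leq_trans _ h; rewrite kE'.
have valz z i : F z -> hval (hX X i) (dsubmx z) = (MM *m z) i 0 - b i 0.
  move=> fz; rewrite hX_val -(gr z fz) -[in RHS](vsubmxK z) /MM mul_row_col mulNmx /cy.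
  by move: (A *m _) (B *m _) => u v; rewrite !mxE; ring.
split.
  move=> i iI; apply: (row_free_inj full); rewrite mul0mx; apply/rowP => j.
  have fj := hp j; have := valz _ i fj; have /tF/(_ _ fj)/tgP -> := iI; rewrite subrr => e.
  rewrite [RHS]mxE mul_col_entry -[RHS]e hval_col.
  suff -> : col j (col_mx (dsubmx p) (const_mx 1 : 'rV[R]_k)) = col_mx (dsubmx (col j p)) 1%:M by [].
  by rewrite col_col_mx; congr col_mx; apply/matrixP => a c; rewrite ?ord1 !mxE.
have [z0 fz0] : exists z, F z.
  have k0 : (0 < k)%N by rewrite kE' addn1.
  by exists (col (Ordinal k0) p); apply: hp.
pose gs := [seq - hX X i | i <- enum 'I_m & i \notin I].
have hN i y : hval (- hX X i) y = - hval (hX X i) y by rewrite -sub0r hvalB /hval !linear0 mul0mx !mxE addr0 sub0r.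
have [||||y Qy hy] := @avg ny gs (fun y => exists2 z, F z & y = dsubmx z) (dsubmx z0).
- by exists z0.
- move=> y [z fz ->] g /mapP[i _ ->]; rewrite hN valz // oppr_ge0 subr_le0.
  exact: (face_sub fF fz).
- move=> x y [z1 f1 ->] [z2 f2 ->]; exists (z1 + 2%:R^-1 *: (z2 - z1)); first exact: face_conv fF f1 f2.
  by apply/colP => a; rewrite !mxE.
- move=> g /mapP[i]; rewrite mem_filter => /andP[iI _] ->.
  have /existsNP[z /not_implyP[fz nt]] : ~ tightR F i by move=> /tF; apply/negP.
  exists (dsubmx z); first by exists z.
  rewrite hN valz // oppr_gt0 subr_lt0; apply: poly_lt; [exact: face_sub fF fz|exact/negP].
exists y => i iI; have := hy (- hX X i); rewrite hN oppr_gt0; apply.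
by apply/mapP; exists i => //; rewrite mem_filter iI mem_enum.
Qed.

(** A constraint form that vanishes at n_x + n_y + 1 affinely independent points is zero; the second
    alternative is such a trivial inequality 0 <= 0, which no point satisfies strictly. *)
Lemma full_interior : has_dim (polyhedron MM b) (nx + ny)%N%:Z ->
  exists z : 'cV[R]_(nx + ny), forall i, 0 < b i 0 - (MM *m z) i 0 \/ (row i MM = 0 /\ b i 0 = 0).
Proof.
move=> [k [kE [p hp ind] _]]; have kE' : k = (nx + ny + 1)%N by lia.
pose s i : 'rV[R]_(nx + ny + 1) := row_mx (- row i MM) (b i 0)%:M.
have sE i z : hval (s i) z = b i 0 - (MM *m z) i 0.
  by rewrite /hval row_mxKl row_mxKr mulNmx -row_mul !mxE eqxx mulr1n addrC.
have full : row_free (col_mx p (const_mx 1 : 'rV[R]_k)).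
  by rewrite /row_free (eqP ind) kE'.
pose gs := [seq s i | i <- enum 'I_m & s i != 0].
have [z0 pz0] : exists z, polyhedron MM b z.
  have k0 : (0 < k)%N by rewrite kE' addn1.
  by exists (col (Ordinal k0) p); apply: hp.
have [||||z Qz hz] := @avg (nx + ny) gs (polyhedron MM b) z0.
- by [].
- by move=> y py g /mapP[i _ ->]; rewrite sE subr_ge0.
- by move=> x y px py; apply: (face_conv (c := b) (F := polyhedron MM b)) => //; exists 0, 0; split => [z _|]; rewrite ?mul0mx ?mxE //; apply/seteqP; split => z; [move=> pz; split => //; rewrite mul0mx mxE|case].
- move=> g /mapP[i]; rewrite mem_filter => /andP[si _] ->.
  apply: contrapT => /forall2NP h; move/eqP: si; apply; apply: (row_free_inj full).
  rewrite mul0mx; apply/rowP => j; rewrite [RHS]mxE mul_col_entry.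
  have -> : (s i *m col j (col_mx p (const_mx 1))) 0 0 = hval (s i) (col j p).
    rewrite hval_col; suff -> : col j (col_mx p (const_mx 1 : 'rV[R]_k)) = col_mx (col j p) 1%:M by [].
    by rewrite col_col_mx; congr col_mx; apply/matrixP => a c; rewrite ?ord1 !mxE.
  have := hp j i; rewrite -subr_ge0 -sE le_eqVlt => /orP[/eqP<- //|lt].
  by case: (h (col j p)).
exists z => i; have [s0|s0] := eqVneq (s i) 0; last first.
  by left; rewrite -sE; apply: hz; apply/mapP; exists i => //; rewrite mem_filter s0 mem_enum.
right; move: s0 => /[dup] /(congr1 lsubmx) + /(congr1 rsubmx); rewrite /s row_mxKl row_mxKr !linear0.
move=> /eqP; rewrite oppr_eq0 => /eqP -> /matrixP/(_ 0 0); rewrite !mxE eqxx mulr1n => ->.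
by [].
Qed.

Lemma graph_faceT (I J0 : {set 'I_m}) X z : J0 \subset I -> kerfree A J0 -> Xs J0 X ->
  faceT MM b I z -> usubmx z = xof X (dsubmx z).
Proof.
move=> sub kf xs [pz hz]; apply: (xof_unique kf xs) => i iJ.
have : i \in tg MM b z by apply: (fintype.subsetP hz); apply: (fintype.subsetP sub).
by rewrite -{1}[z]vsubmxK MM_tg => /tgP.
Qed.

Lemma faceT_pt (I : {set 'I_m}) X y : (forall i, hval (hX X i) y <= 0) ->
  (forall i, i \in I -> hval (hX X i) y = 0) -> faceT MM b I (col_mx (xof X y) y).
Proof.
move=> h1 h2; split; first by apply/MM_poly => i; have := h1 i; rewrite hX_val subr_le0.
apply/fintype.subsetP => i /h2; rewrite hX_val MM_tg inE => /eqP; by rewrite subr_eq0.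
Qed.

Lemma faceT_val (I J0 : {set 'I_m}) X z i : J0 \subset I -> kerfree A J0 -> Xs J0 X ->
  faceT MM b I z -> i \in I -> hval (hX X i) (dsubmx z) = 0.
Proof.
move=> sub kf xs fz iI; rewrite hX_val -(graph_faceT sub kf xs fz).
have : i \in tg MM b z by apply: (fintype.subsetP fz.2).
by rewrite -{1}[z]vsubmxK MM_tg => /tgP ->; rewrite subrr.
Qed.

(** The face contains the graph points over [y1] and over its small translates along the coordinate
    axes, which are n_y + 1 affinely independent points. *)
Lemma faceI_full (J : {set 'I_m}) X y1 : kerfree A J -> Xs J X ->
  (forall i, i \notin J -> hval (hX X i) y1 < 0) -> faceI ny%:Z J.
Proof.
move=> kf xs hy1; exists (faceT MM b J).
have hJ i y : i \in J -> hval (hX X i) y = 0 by move=> iJ; rewrite (Xs_hX xs iJ) hval0.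
have [e e0 he] := small [seq (hval (hX X p.1) y1, lsubmx (hX X p.1) 0 p.2) | p <- enum {: 'I_m * 'I_ny}].
have ptk i k : hval (hX X i) (y1 + e *: delta_mx k 0) <= 0.
  have [iJ|iJ] := boolP (i \in J); first by rewrite hJ.
  have lt := hy1 i iJ; rewrite hval_line.
  have := he (hval (hX X i) y1, lsubmx (hX X i) 0 k) (map_f (fun p => (hval (hX X p.1) y1, lsubmx (hX X p.1) 0 p.2)) (mem_enum _ (i, k))).
  rewrite /= (lt_eqF lt) => /(_ isT e); rewrite ger0_norm ?(ltW e0) // lexx => /(_ isT).
  have -> : (lsubmx (hX X i) *m (delta_mx k 0 : 'cV[R]_ny)) 0 0 = lsubmx (hX X i) 0 k by rewrite -colE [LHS]mxE.
  by rewrite nmulr_lgt0 // => /ltW.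
have pt1 i : hval (hX X i) y1 <= 0.
  by have [iJ|/hy1/ltW//] := boolP (i \in J); rewrite hJ.
split; first exact: face_faceT.
  have -> : ny%:Z = (ny + 1)%N%:Z - 1 :> int by lia.
  apply: (has_dim_graph (X := X)).
  - by move=> z; apply: (graph_faceT (J0 := J)).
  - exists (row_mx (y1 *m const_mx 1 + e *: 1%:M) y1).
      move=> j; have := fintype.splitK j; case: (fintype.split j) => k /= <-.
        rewrite colKl; have -> : col k (y1 *m const_mx 1 + e *: 1%:M) = y1 + e *: delta_mx k 0.
          apply/colP => a; rewrite !mxE big_ord1 !mxE mulr1 eqxx andbT.
          by rewrite eq_sym.
        by apply: faceT_pt => i // iJ; rewrite hJ.
      by rewrite colKr col_id; apply: faceT_pt => i // iJ; rewrite hJ.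
    apply/eqP; apply: inj_row_free => l; rewrite -[l]hsubmxK; move: (lsubmx l) (rsubmx l) => l1 l0.
    rewrite mul_row_col mul_mx_row => h.
    have e1 : l1 *m y1 + l0 = 0.
      move/(congr1 rsubmx): h; rewrite linearD /= row_mxKr linear0 => <-; congr (_ + _).
      by apply/matrixP => a c; rewrite !ord1 !mxE big_ord1 !mxE mulr1.
    have e2 : l1 = 0.
      move/(congr1 lsubmx): h; rewrite linearD /= row_mxKl linear0 mulmxDr mulmxA -scalemxAr mulmx1 => h.
      have : e *: l1 = 0.
        rewrite -h -[LHS]add0r -[X in X + _ = _](mul0mx _ (const_mx 1 : 'rV[R]_ny)) -e1 mulmxDl addrAC; congr (_ + _ + _).
        by apply/matrixP => a c; rewrite !mxE; apply: eq_bigr => r _; rewrite !mxE.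
      by move/eqP; rewrite scaler_eq0 gt_eqF //= => /eqP.
    by move: e1; rewrite e2 mul0mx add0r => ->; rewrite row_mx0.
  - by move=> ys _; exact: rank_leq_row.
move=> i; split => [iJ z fz|ti]; first exact: (fintype.subsetP fz.2).
apply: contrapT => /negP iJ; have := hy1 i iJ.
have := ti (col_mx (xof X y1) y1) (faceT_pt pt1 (fun i iJ => hJ i y1 iJ)).
by rewrite MM_tg hX_val => /tgP ->; rewrite subrr ltxx.
Qed.

(** The residuals from [I] vanish together exactly on the hyperplane s = 0, so the face is the graph
    over a part of this hyperplane, and near [w] the part is everything. *)
Lemma faceI_facet (I J0 : {set 'I_m}) X (s : 'rV[R]_(ny + 1)) w l0 : J0 \subset I -> kerfree A J0 -> Xs J0 X ->
  lsubmx s != 0 -> hval s w = 0 -> (forall l, l \in I -> exists k, hX X l = k *: s) ->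
  l0 \in I -> hX X l0 != 0 -> (forall l, l \notin I -> hval (hX X l) w < 0) -> faceI (ny%:Z - 1) I.
Proof.
move=> sub kf xs s0 sw hI l0I l0n hw; exists (faceT MM b I).
have /existsP[c sc] : [exists c, lsubmx s 0 c != 0].
  rewrite -[X in is_true X]negbK negb_exists; apply: contra s0 => /forallP e.
  by apply/eqP/rowP => c; rewrite [RHS]mxE; apply/eqP; have := e c; rewrite negbK.
set be := lsubmx s in s0 sc.
(* The projection onto the directions of the hyperplane along coordinate c. Its columns lead to n_y
   points, the zero column c standing for [w] itself. *)
pose dd : 'M[R]_ny := 1%:M - delta_mx c 0 *m ((be 0 c)^-1 *: be).
have bdd : be *m dd = 0.
  rewrite /dd mulmxBr mulmx1 mulmxA -colE -scalemxAr.
  have -> : col c be = (be 0 c)%:M by apply/matrixP => a d; rewrite !ord1 !mxE eqxx.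
  by rewrite mul_scalar_mx scalerA mulVf // scale1r subrr.
have [e e0 he] := small [seq (hval (hX X p.1) w, (lsubmx (hX X p.1) *m dd) 0 p.2) | p <- enum {: 'I_m * 'I_ny}].
have sk k : hval s (w + e *: col k dd) = 0.
  by rewrite hval_line sw -/be -mul_col_entry bdd mxE mulr0 addr0.
have zero y l : hval s y = 0 -> l \in I -> hval (hX X l) y = 0.
  by move=> sy /hI[k ->]; rewrite hvalZ sy mulr0.
have ptk i k : hval (hX X i) (w + e *: col k dd) <= 0.
  have [iI|iI] := boolP (i \in I); first by rewrite zero.
  have lt := hw i iI; rewrite hval_line -mul_col_entry.
  have := he (hval (hX X i) w, (lsubmx (hX X i) *m dd) 0 k) (map_f (fun p => (hval (hX X p.1) w, (lsubmx (hX X p.1) *m dd) 0 p.2)) (mem_enum _ (i, k))).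
  rewrite /= (lt_eqF lt) => /(_ isT e); rewrite ger0_norm ?(ltW e0) // lexx => /(_ isT).
  by rewrite nmulr_lgt0 // => /ltW.
have pt1 i : hval (hX X i) w <= 0.
  by have [iI|/hw/ltW//] := boolP (i \in I); rewrite zero.
split; first exact: face_faceT.
  apply: (has_dim_graph (X := X)).
  - by move=> z; apply: (graph_faceT (J0 := J0)).
  - exists (w *m const_mx 1 + e *: dd).
      move=> k; have -> : col k (w *m const_mx 1 + e *: dd) = w + e *: col k dd.
        by apply/colP => a; rewrite !mxE big_ord1 !mxE mulr1.
      by apply: faceT_pt => i // iI; apply: zero.
    rewrite -mxrank_tr; apply/eqP; apply: inj_row_free => t ht; apply: trmx_inj; rewrite trmx0.
    move/(congr1 trmx): ht; rewrite trmx_mul trmxK trmx0 mul_col_mx => h.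
    set t' := t^T in h *.
    have h1 : const_mx 1 *m t' = 0 :> 'M[R]_1 by rewrite -[LHS](col_mxKd ((w *m const_mx 1 + e *: dd) *m t')) h linear0.
    have h2 : dd *m t' = 0.
      have : (w *m const_mx 1 + e *: dd) *m t' = 0.
        by rewrite -[LHS](col_mxKu _ (const_mx 1 *m t' : 'M[R]_1)) h linear0.
      rewrite mulmxDl -mulmxA h1 mulmx0 add0r -scalemxAl => /eqP; rewrite scaler_eq0 gt_eqF //= => /eqP.
      by [].
    have h3 : t' = delta_mx c 0 *m ((be 0 c)^-1 *: (be *m t')).
      by apply/eqP; rewrite -subr_eq0 -[X in X - _]mul1mx scalemxAl mulmxA -mulmxBl h2.
    move: h1 h3; move: ((be 0 c)^-1 *: (be *m t')) => mu h1 h3.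
    have mu0 : mu = 0.
      rewrite -h1 h3 mulmxA -colE (_ : col c _ = 1%:M) ?mul1mx //.
      by apply/matrixP => a d; rewrite !ord1 !mxE eqxx.
    by rewrite h3 mu0 mulmx0.
  - move=> ys hys; rewrite leqNgt; apply/negP => gt.
    have fr' : row_free (col_mx ys (const_mx 1 : 'rV[R]_ny.+1)).
      by rewrite /row_free eqn_leq rank_leq_row /=; apply: leq_trans gt; rewrite addn1.
    have s00 : s = 0.
      apply: (row_free_inj fr'); rewrite mul0mx; apply/rowP => j; rewrite [RHS]mxE mul_col_entry.
      have [k kE] := hI _ l0I; have k0 : k != 0 by apply: contra l0n => /eqP k0; rewrite kE k0 scale0r.
      have := faceT_val sub kf xs (hys j) l0I; rewrite col_mxKd kE hvalZ => /eqP.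
      rewrite mulf_eq0 (negbTE k0) /= hval_col => /eqP e1; rewrite -[RHS]e1.
      suff -> : col j (col_mx ys (const_mx 1 : 'rV[R]_ny.+1)) = col_mx (col j ys) 1%:M by [].
      by rewrite col_col_mx; congr col_mx; apply/matrixP => a d; rewrite ?ord1 !mxE.
    by move: s0; rewrite /be s00 linear0 eqxx.
move=> i; split => [iI z fz|ti]; first exact: (fintype.subsetP fz.2).
apply: contrapT => /negP iI; have := hw i iI.
have := ti (col_mx (xof X w) w) (faceT_pt pt1 (fun i iI => zero w i sw iI)).
by rewrite MM_tg hX_val => /tgP ->; rewrite subrr ltxx.
Qed.

(** The directions e_j - (s_j / s_c) e_c are parallel to the hyperplane s = 0, so h cannot change
    along them; this fixes the ratios of its coefficients. *)
Lemma prop_affine n (s h : 'rV[R]_(n + 1)) w : lsubmx s != 0 -> hval s w = 0 ->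
  (forall y, hval s y = 0 -> hval h y = 0) -> exists k, h = k *: s.
Proof.
move=> s0 sw hz.
have /existsP[c sc] : [exists c, lsubmx s 0 c != 0].
  rewrite -[X in is_true X]negbK negb_exists; apply: contra s0 => /forallP e.
  by apply/eqP/rowP => c; rewrite [RHS]mxE; apply/eqP; have := e c; rewrite negbK.
set k := lsubmx h 0 c / lsubmx s 0 c; exists k; apply/eqP; rewrite -subr_eq0; apply/eqP.
apply: (@hval_lin0 R n _ w); last by rewrite hvalB hvalZ sw (hz _ sw) mulr0 subrr.
apply/rowP => j; rewrite linearB linearZ /= [RHS]mxE.
pose d : 'cV[R]_n := delta_mx j 0 - (lsubmx s 0 j / lsubmx s 0 c) *: delta_mx c 0.
have dE (g : 'rV[R]_n) : (g *m d) 0 0 = g 0 j - (lsubmx s 0 j / lsubmx s 0 c) * g 0 c.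
  rewrite /d mulmxBr -scalemxAr -!colE; move: (lsubmx s 0 j / _) => q; by rewrite !mxE.
have sd : hval s (w + 1 *: d) = 0 by rewrite hval_line sw dE mul1r add0r mulfVK // subrr.
have := hz _ sd; rewrite hval_line (hz _ sw) dE mul1r add0r => e.
have -> : (lsubmx h - k *: lsubmx s) 0 j = lsubmx h 0 j - k * lsubmx s 0 j.
  by move: (lsubmx h) (lsubmx s) k {sd e dE d hz sw s0 sc} => u v q; rewrite !mxE.
by rewrite -[RHS]e /k; congr (_ - _); ring.
Qed.

(** At a degenerate vertex the whole tight set need not belong to a face of dimension n_y. In the
    cone of feasible directions at (v, y), a parameter direction dy is chosen generically near one
    that points to the interior. The fibre of the cone over dy has a vertex dx', whose tight rows
    [J] determine dx' and impose no relation on dy. So [J] defines a parametric vertex through (v,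
    y) that stays feasible when y moves along dy. *)
Lemma vertex_face (z0 : 'cV[R]_(nx + ny)) y v : (forall i, 0 < b i 0 - (MM *m z0) i 0 \/ (row i MM = 0 /\ b i 0 = 0)) ->
  polyhedron A (cy y) v -> kerfree A (tg A (cy y) v) ->
  exists J : {set 'I_m}, [/\ J \subset tg A (cy y) v, kerfree A J & faceI ny%:Z J].
Proof.
move=> hz0 pv kf; set V0 := tg A (cy y) v in kf *.
pose dx := usubmx z0 - v; pose dy0 := dsubmx z0 - y.
have slackE i : i \in V0 -> (B *m dy0) i 0 - (A *m dx) i 0 = b i 0 - (MM *m z0) i 0.
  move=> /tgP; rewrite /dx /dy0 !mulmxBr -[in MM *m _](vsubmxK z0) /MM mul_row_col mulNmx /cy.
  by move: (A *m v) (B *m y) (A *m usubmx z0) (B *m dsubmx z0) => p q r u; rewrite !mxE => ->; ring.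
have nullA i : row i MM = 0 -> row i A = 0 /\ row i B = 0.
  rewrite /MM row_row_mx -[X in _ = X](row_mx0 _ _ nx ny) => /eq_row_mx[-> /eqP].
  by rewrite linearN oppr_eq0 => /eqP ->.
(* A combination of the rows in [J] that eliminates x but leaves a relation on the parameters. One
   is fixed for each [J], with default 0 if there is none; as there are finitely many, dy can be
   chosen to violate all of these relations. *)
pose bad (J : {set 'I_m}) (l : 'rV[R]_m) := [/\ forall i, i \notin J -> l 0 i = 0, l *m A = 0 & l *m B != 0].
pose lam J := xget 0 (bad J).
pose fs : seq 'rV[R]_(ny + 1) := [seq f <- [seq row_mx (lam J *m B) 0 | J <- enum {: {set 'I_m}}] | f != 0].
pose gs : seq 'rV[R]_(ny + 1) := [seq row_mx (row i B) (- (A *m dx) i 0)%:M | i <- enum 'I_m & (i \in V0) && (0 < b i 0 - (MM *m z0) i 0)].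
have gE i d : hval (row_mx (row i B) (- (A *m dx) i 0)%:M) d = (B *m d) i 0 - (A *m dx) i 0.
  by rewrite /hval row_mxKl row_mxKr -row_mul [X in X + _ = _]mxE [X in _ + X = _]mxE eqxx mulr1n.
have [||dy [hg hf]] := @generic_pt R ny fs gs dy0.
- by move=> f; rewrite mem_filter => /andP[].
- by move=> g /mapP[i]; rewrite mem_filter => /andP[/andP[iV pos] _] ->; rewrite gE slackE.
pose A0 : 'M[R]_(m, nx) := \matrix_(i, j) ((i \in V0)%:R * A i j).
pose c0 : 'cV[R]_m := \col_i ((i \in V0)%:R * (B *m dy) i 0).
have A0E (d : 'cV[R]_nx) i : (A0 *m d) i 0 = (i \in V0)%:R * (A *m d) i 0.
  by rewrite !mxE mulr_sumr; apply: eq_bigr => j _; rewrite mxE mulrA.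
have c0E i : c0 i 0 = (i \in V0)%:R * (B *m dy) i 0 by rewrite mxE.
have feas : polyhedron A0 c0 dx.
  move=> i; rewrite A0E c0E; have [iV|iV] := boolP (i \in V0); last by rewrite !mul0r.
  rewrite !mul1r; case: (hz0 i) => [pos|[n0 _]].
    rewrite -subr_ge0 -gE; apply/ltW/hg/mapP; exists i => //.
    by rewrite mem_filter iV pos mem_enum.
  have [n1 n2] := nullA i n0; rewrite (row_entry A) (row_entry B) n1 n2 !mul0mx.
  by rewrite lexx.
have kf0 (d : 'cV[R]_nx) : (forall i, (A0 *m d) i 0 = 0) -> d = 0.
  by move=> h; apply: kf => i iV; have := h i; rewrite A0E iV mul1r.
have [dx' p' k'] := vertex_exists kf0 feas.
pose J := (tg A0 c0 dx' :&: V0)%SET.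
have JE i : i \in J -> (A *m dx') i 0 = (B *m dy) i 0.
  by rewrite inE => /andP[/tgP + iV]; rewrite A0E c0E iV !mul1r.
have JV : J \subset V0 by exact: finset.subsetIr.
have kJ : kerfree A J.
  move=> d hd; apply: k' => i it; rewrite A0E; have [iV|] := boolP (i \in V0); last by rewrite mul0r.
  by rewrite mul1r; apply: hd; rewrite inE it iV.
(* Such a relation would hold for dy, because dx' satisfies the rows in [J] with equality. *)
have nobad (l : 'rV[R]_m) : (forall i, i \notin J -> l 0 i = 0) -> l *m A = 0 -> l *m B = 0.
  move=> h1 h2; apply/eqP; rewrite -[X in is_true X]negbK; apply/negP => h3.
  have bJ : bad J (lam J) by apply: (@xgetPex _ 0 (bad J)); exists l.
  have [b1 b2 b3] := bJ.
  have : row_mx (lam J *m B) 0 \in fs.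
    rewrite mem_filter; apply/andP; split; last by apply: map_f; rewrite mem_enum.
    by apply: contra b3 => /eqP /(congr1 lsubmx); rewrite row_mxKl linear0 => ->.
  have e2 : (lam J *m B *m dy) 0 0 = 0.
    transitivity ((lam J *m A *m dx') 0 0); last by rewrite b2 mul0mx mxE.
    rewrite -!mulmxA [LHS]mxE [RHS]mxE; apply: eq_bigr => i _.
    by have [iJ|iJ] := boolP (i \in J); [rewrite JE|rewrite b1 // !mul0r].
  by move=> /hf; rewrite /hval row_mxKl row_mxKr [X in _ + X]mxE addr0 e2 eqxx.
pose mk n (N : 'M[R]_(m, n)) : 'M[R]_(m, n) := \matrix_(i, j) ((i \in J)%:R * N i j).
pose D : 'M[R]_m := \matrix_(i, j) ((i \in J)%:R * (i == j)%:R).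
have DE n (N : 'M[R]_(m, n)) : D *m N = mk n N.
  apply/matrixP => i j; rewrite !mxE (bigD1 i) //= mxE eqxx mulr1 big1 ?addr0 // => a ai.
  by rewrite mxE eq_sym (negbTE ai) mulr0 mul0r.
have /row_fullP[Y YE] : row_full (mk _ A).
  have : row_free (mk _ A)^T.
    apply: inj_row_free => t ht; apply: trmx_inj; rewrite trmx0; apply: kJ => i iJ.
    move/(congr1 trmx): ht; rewrite trmx_mul trmxK trmx0 -DE -mulmxA DE => /colP/(_ i).
    by rewrite !mxE iJ mul1r.
  by rewrite /row_free mxrank_tr.
(* Every dependency of the rows of [A] in [J] also holds for the rows of [B], so the candidate
   obtained from a left inverse solves all these rows. *)
pose X1 := Y *m mk _ B.
have X1E i : i \in J -> row i A *m X1 = row i B.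
  pose La := 1%:M - mk _ A *m Y.
  have La0 : La *m D *m A = 0 by rewrite -mulmxA DE mulmxBl mul1mx -mulmxA YE mulmx1 subrr.
  have LaB : La *m D *m B = 0.
    apply/row_matrixP => a; rewrite row_mul row0; apply: nobad.
      by move=> k kJ'; rewrite mxE mxE big1 // => q _; rewrite [D _ _]mxE; case: eqP => [->|]; rewrite ?(negbTE kJ') ?mul0r ?mulr0.
    by rewrite -row_mul La0 row0.
  have : mk _ B = mk _ A *m X1.
    rewrite /X1 mulmxA; apply/eqP.
    by rewrite -subr_eq0 -[X in X - _]mul1mx -mulmxBl -/La -(DE _ B) mulmxA LaB.
  move=> E iJ; apply/rowP => j; move/matrixP: E => /(_ i j); rewrite !mxE iJ mul1r => ->.
  by apply: eq_bigr => q _; rewrite !mxE iJ mul1r.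
pose X : 'M[R]_(nx, ny + 1) := row_mx X1 (v - X1 *m y).
have xv : xof X y = v by rewrite /X mul_row_col mulmx1 addrC subrK.
have xs : Xs J X.
  move=> i iJ; rewrite /X mul_mx_row row_row_mx X1E //; congr row_mx.
  rewrite mulmxBr mulmxA X1E // -!row_mul; have /tgP := fintype.subsetP JV i iJ; rewrite /cy => e.
  apply/rowP => a; rewrite (ord1 a); move: e; move: (A *m v) (B *m y) => p q; rewrite !mxE => ->; ring.
have X1dy : X1 *m dy = dx'.
  apply/eqP; rewrite -subr_eq0; apply/eqP; apply: kJ => i iJ.
  by rewrite mulmxBr [LHS]mxE [X in _ + X]mxE JE // (row_entry A) mulmxA X1E // -row_mul [X in X - _]mxE subrr.
have hy i : hval (hX X i) y = (A *m v) i 0 - cy y i 0 by rewrite hX_val xv.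
have hd i : (lsubmx (hX X i) *m dy) 0 0 = (A *m dx') i 0 - (B *m dy) i 0.
  rewrite /hX linearB /= row_row_mx row_mxKl /X mul_mx_row row_mxKl mulmxBl -mulmxA X1dy -!row_mul.
  by move: (A *m dx') (B *m dy) => p q; rewrite !mxE.
have [e e0 he] := small [seq (hval (hX X i) y, (lsubmx (hX X i) *m dy) 0 0) | i <- enum 'I_m].
exists J; split => //; apply: (@faceI_full J X (y + e *: dy)) => // i iJ.
(* A tight inequality outside [J] becomes strict because its residual decreases along dy; an
   inequality that is strict at y stays so for a short step. *)
rewrite hval_line; have [iV|iV] := boolP (i \in V0).
  rewrite hy (tgP iV) subrr add0r hd pmulr_rlt0 // subr_lt0.
  have it : i \notin tg A0 c0 dx' by apply: contra iJ => it; rewrite inE it.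
  by have := poly_lt p' it; rewrite A0E c0E iV !mul1r.
have lt : hval (hX X i) y < 0 by rewrite hy subr_lt0; apply: poly_lt.
have := he _ (map_f _ (mem_enum _ i)); rewrite /= (lt_eqF lt) => /(_ isT e).
by rewrite ger0_norm ?(ltW e0) // lexx => /(_ isT); rewrite nmulr_lgt0.
Qed.

End Param.

(** * Chambers *)

Section Chambers.
Variables (R : realType) (m nx ny : nat).
Variables (A : 'M[R]_(m, nx)) (B : 'M[R]_(m, ny)) (b : 'cV[R]_m).
Variable hs : seq 'rV[R]_(ny + 1).
Notation xof X y := (X *m col_mx y (1%:M : 'M[R]_1)).
Notation hX := (hX A B b).
Notation BB := (row_mx B b).
Hypothesis Hcov : forall I, faceI A B b (ny%:Z - 1) I -> hyp_cover A B b I hs.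

Lemma hrow_hX V i : hrow A B b V i = hX (rsubmx V) i.
Proof. by rewrite /hrow rsub_rowm. Qed.

(* If the sign pattern did not decide the feasibility of the parametric vertex X, the segment
   from y0 to y' would leave its region through a facet, hence through one of the hyperplanes hs. *)
Lemma key (I J0 : {set 'I_m}) X y0 y y' : J0 \subset I -> kerfree A J0 -> Xs A B b J0 X ->
  (forall i, i \in I -> hX X i = 0) -> (forall i, i \notin I -> hval (hX X i) y0 < 0) ->
  svec hs y = svec hs y' -> (forall i, hval (hX X i) y <= 0) -> forall i, hval (hX X i) y' <= 0.
Proof.
move=> sub kf xs hI hy0 sv hy i0; rewrite leNgt; apply/negP => pos.
have i0I : i0 \notin I by apply/negP => /hI e; move: pos; rewrite e hval0 ltxx.
pose fam := [seq hX X i | i <- enum 'I_m & i \notin I].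
have famP h : h \in fam -> exists2 i, i \notin I & h = hX X i.
  by move=> /mapP[i]; rewrite mem_filter => /andP[iI _] ->; exists i.
have famI i : i \notin I -> hX X i \in fam.
  by move=> iI; apply/mapP; exists i => //; rewrite mem_filter iI mem_enum.
have [|||w [s [sf sw sneg hpos hprop]]] := @crossing R ny fam y0 y' (hX X i0).
- by move=> h /famP[i iI ->]; rewrite lt_eqF // hy0.
- exact: famI.
- by rewrite nmulr_rlt0 ?hy0.
have [i1 i1I sE] := famP _ sf.
have s_y0 : hval s y0 < 0 by rewrite sE hy0.
have s_y' : 0 < hval s y' by move: sneg; rewrite nmulr_rlt0.
have s_y : hval s y <= 0 by rewrite sE hy.
have s0 : lsubmx s != 0.
  by apply/eqP => l0; have z := hval_lin0 l0 sw; move: s_y'; rewrite z hval0 ltxx.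
(* The equalities that hold at the crossing point. By the choice of the crossing their residuals are
   multiples of s, so they define a face of dimension n_y - 1. *)
pose I' := [set i | (i \in I) || (hval (hX X i) w == 0)]%SET.
have subI : J0 \subset I'.
  by apply/fintype.subsetP => i /(fintype.subsetP sub) iI; rewrite inE iI.
have i1I' : i1 \in I' by rewrite inE -sE sw eqxx orbT.
have cases l yy : hval s yy = 0 -> l \in I' -> hval (hX X l) yy = 0.
  move=> syy; rewrite inE; have [lI _|lI /= /eqP e] := boolP (l \in I); first by rewrite hI // hval0.
  by have [k _ ->] := hprop _ (famI _ lI) e; rewrite hvalZ syy mulr0.
have fI' : faceI A B b (ny%:Z - 1) I'.
  apply: (@faceI_facet _ _ _ _ A B b I' J0 X s w i1) => //.
  - move=> l; rewrite inE; have [lI _|lI /= /eqP e] := boolP (l \in I); first by exists 0; rewrite hI // scale0r.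
    by have [k _ ->] := hprop _ (famI _ lI) e; exists k.
  - by rewrite -sE; apply/eqP => z; move: s_y'; rewrite z hval0 ltxx.
  - move=> l; rewrite inE negb_or => /andP[lI lw].
    by have := hpos _ (famI _ lI) lw; rewrite nmulr_lgt0 // hy0.
have [PM [V [ri alt]]] := Hcov fI'.
have kI' : kerfree A I'.
  by move=> d hd; apply: kf => i iJ; apply: hd; apply: (fintype.subsetP subI).
have E := red_full ri kI'.
(* The elimination may have found another base than the one behind [X]. Over the hyperplane s = 0
   the two parametric vertices agree, so an equation in y obtained from [X'] is a multiple of s. *)
pose X' := rsubmx V.
have van yy i : hval s yy = 0 -> i \in I' -> hval (hX X' i) yy = 0.
  move=> syy iI'.
  have xE : xof X yy = xof X' yy.
    apply: (@xof_unique _ _ _ _ A B b PM X') => [|l lP|l lP].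
    - exact: (red_kerfree ri E).
    - exact: (red_sol ri).
    have := cases l yy syy (fintype.subsetP ri.(ri_sub) l lP); rewrite hX_val => /eqP.
    by rewrite subr_eq0 => /eqP.
  by rewrite hX_val -xE -hX_val cases.
case: (alt E) => [[i [iI' li hin]]|alll].
  rewrite hrow_hX -/X' in li hin.
  have [k kE] : exists k, hX X' i = k *: s.
    by apply: (prop_affine s0 sw) => yy syy; apply: van.
  have k0 : k != 0 by apply: contra li => /eqP k0; rewrite kE k0 scale0r linear0.
  have : sgd (hval (hX X' i) y) = sgd (hval (hX X' i) y').
    by move: (sv); rewrite /svec => /eq_in_map/(_ _ hin).
  rewrite kE !hvalZ => /sgd_eqP[[_ /eqP]|]; first by rewrite mulf_eq0 (negbTE k0) gt_eqF.
  rewrite mulrACA pmulr_rgt0; last by rewrite lt0r sqr_ge0 mulf_neq0.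
  by rewrite pmulr_lgt0 // ltNge s_y.
(* If the face gave no hyperplane, its equalities would hold along [X'] for every y; then [X'] and
   [X] would agree at y' as well, against the positive value of s there. *)
have z l : l \in I' -> hX X' l = 0.
  by move=> lI; apply: (@hval_lin0 R ny _ w); [rewrite -hrow_hX alll|apply: van].
have xE : xof X' y' = xof X y'.
  apply: (xof_unique kf xs) => l lJ; have := hX_val A B b X' l y'.
  rewrite z ?hval0; last exact: (fintype.subsetP subI).
  by move/esym/eqP; rewrite subr_eq0 => /eqP.
by move: s_y'; rewrite sE hX_val -xE -hX_val z // hval0 ltxx.
Qed.

(** Prolonging the segment from y' slightly beyond y stays in the cell, where the vertex is still
    feasible; as the residual is affine and zero at y, it cannot be negative at y'. *)
Lemma key0 (I J0 : {set 'I_m}) X y0 y y' i : J0 \subset I -> kerfree A J0 -> Xs A B b J0 X ->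
  (forall i, i \in I -> hX X i = 0) -> (forall i, i \notin I -> hval (hX X i) y0 < 0) ->
  svec hs y = svec hs y' -> (forall i, hval (hX X i) y <= 0) ->
  hval (hX X i) y = 0 -> hval (hX X i) y' = 0.
Proof.
move=> sub kf xs hI hy0 sv hy yi; apply/eqP; rewrite eq_le (key sub kf xs hI hy0 sv hy) /=.
pose d := y' - y.
have dE h : (lsubmx h *m d) 0 0 = hval h y' - hval h y.
  have := hval_line h y d 1; rewrite scale1r mul1r {1}/d [y + _]addrC subrK => ->.
  by rewrite [RHS]addrC addKr.
have [e e0 he] := small [seq (hval h y, (lsubmx h *m d) 0 0) | h <- hs].
have sv' : svec hs y = svec hs (y + (- e) *: d).
  rewrite /svec; apply/eq_in_map => h hin; rewrite hval_line.
  have sg : sgd (hval h y) = sgd (hval h y') by move: (sv); rewrite /svec => /eq_in_map/(_ _ hin).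
  have [z|nz] := eqVneq (hval h y) 0.
    have z' : hval h y' = 0 by apply/eqP; rewrite -(sgd_eq0 sg) z.
    by rewrite dE z z' subrr mulr0 addr0.
  apply: sgd_pos; rewrite mulrC.
  apply: (he _ (map_f (fun h => (hval h y, (lsubmx h *m d) 0 0)) hin)) => //=.
  by rewrite normrN ger0_norm ?(ltW e0).
have := key sub kf xs hI hy0 sv' hy i.
by rewrite hval_line yi add0r dE yi subr0 mulNr oppr_le0 pmulr_rge0.
Qed.

Variable L : seq (seq 'I_m).
Hypothesis uL : uniq [seq [set:: l]%SET | l <- L].
Hypothesis HL : forall I, I \in [seq [set:: l]%SET | l <- L] <-> faceI A B b ny%:Z I.
Variables (p : 'cV[R]_ny) (res : seq ({set 'I_m} * 'M[R]_(nx, nx + (ny + 1)))).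
Hypothesis hres : reds A B b L (size L) res.

Lemma bselP x : x \in bsel A B b p res -> exists I, [/\ faceI A B b ny%:Z I, red_inv A BB I x.1 x.2,
  #|x.1| = nx & forall i, hval (hX (rsubmx x.2) i) p <= 0].
Proof.
rewrite mem_filter => /andP[/andP[/eqP E /forallP ok] xr].
have /(nthP (finset.set0, 0))[q qs qE] := xr; have [sz hr] := hres.
rewrite sz in qs; exists [set:: nth [::] L q]%SET; split => //.
- by apply/HL; apply: map_f; apply: mem_nth.
- by have := hr q qs; rewrite qE.
- by move=> i; rewrite -hrow_hX.
Qed.

Lemma bsel_in I : faceI A B b ny%:Z I -> exists2 x, x \in res & red_inv A BB I x.1 x.2.
Proof.
move=> /HL/mapP[l lL ->]; have /(nthP [::])[q qs <-] := lL; have [sz hr] := hres.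
by exists (nth (finset.set0, 0) res q); [apply: mem_nth; rewrite sz|exact: hr].
Qed.

(** A base determines its parametric vertex, and the inequalities whose residual vanishes
    identically along it form the tight set of the face; so different faces of the list give
    different bases. *)
Lemma uniq_bases : uniq [seq x.1 | x <- bsel A B b p res].
Proof.
have [sz hr] := hres.
pose rec (J : {set 'I_m}) := [set i | hX (invmx (subrows nx A J) *m subrows nx BB J) i == 0]%SET.
pose zs := [seq z <- zip L res | okx A B b p z.2].
have -> : bsel A B b p res = [seq z.2 | z <- zs].
  by rewrite /bsel -[in LHS](@unzip2_zip _ _ L res) ?sz // /unzip2 filter_map.
apply: (@map_uniq _ _ rec); rewrite -!map_comp.
have -> : [seq (rec \o (fst \o snd)) z | z <- zs] = [seq [set:: z.1]%SET | z <- zs].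
  apply/eq_in_map => z; rewrite mem_filter => /andP[/andP[/eqP E _] /(nthP ([::], (finset.set0, 0)))[q]].
  rewrite size_zip sz minnn => qs; rewrite nth_zip ?sz // => zE.
  have := hr q qs; move: E; rewrite -zE /= => E ri.
  have fI : faceI A B b ny%:Z [set:: nth [::] L q]%SET by apply/HL; apply: map_f; apply: mem_nth.
  have [h1 [y0 h2]] := Lfull fI ri.(ri_sub) (red_kerfree ri E) (fun i => red_sol ri).
  apply/setP => i; rewrite [LHS]inE -(red_vertex ri E); have [iI|iI] := boolP (i \in _).
    by rewrite h1 ?eqxx.
  by apply/eqP => e; have := h2 i iI; rewrite e hval0 ltxx.
apply: subseq_uniq uL; rewrite (map_comp (fun l => [set:: l]%SET) fst); apply: map_subseq.
by rewrite -[X in subseq _ X](@unzip1_zip _ _ L res) ?sz //; apply: map_subseq; exact: filter_subseq.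
Qed.

Hypothesis Hdim : has_dim (polyhedron (MM A B) b) (nx + ny)%N%:Z.
Hypothesis kfT : forall d : 'cV[R]_nx, (forall i, (A *m d) i 0 = 0) -> d = 0.

Lemma bsel_pt x y : x \in bsel A B b p res -> svec hs y = svec hs p ->
  polyhedron A (cy B b y) (xof (rsubmx x.2) y) /\ kerfree A (tg A (cy B b y) (xof (rsubmx x.2) y)).
Proof.
move=> /bselP[I [fI ri E ok]] sv.
have kf := red_kerfree ri E; have xs : Xs A B b x.1 (rsubmx x.2) by move=> i iP; exact: (red_sol ri iP).
have [h1 [y0 h2]] := Lfull fI ri.(ri_sub) kf xs.
split.
  by move=> i; have := key ri.(ri_sub) kf xs h1 h2 (esym sv) ok i; rewrite hX_val subr_le0.
move=> d hd; apply: kf => i iP; apply: hd; rewrite inE -subr_eq0 -hX_val.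
by rewrite (Xs_hX xs iP) hval0.
Qed.

(** The vertex lies on an n_y-dimensional face whose equalities determine x, and the base of that
    face passes the test at [p] because feasibility is constant on the cell. *)
Lemma vert_bsel y v : svec hs y = svec hs p -> polyhedron A (cy B b y) v -> kerfree A (tg A (cy B b y) v) ->
  exists2 x, x \in bsel A B b p res & v = xof (rsubmx x.2) y.
Proof.
move=> sv pv kv; have [z0 hz0] := full_interior Hdim.
have [J [JV kJ fJ]] := vertex_face hz0 pv kv.
have [x xr ri] := bsel_in fJ; have E := red_full ri kJ.
have kf := red_kerfree ri E; have xs : Xs A B b x.1 (rsubmx x.2) by move=> i iP; exact: (red_sol ri iP).
have vE : v = xof (rsubmx x.2) y.
  apply: (xof_unique kf xs) => i iP; apply: tgP; apply: (fintype.subsetP JV).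
  exact: (fintype.subsetP ri.(ri_sub)).
exists x => //; rewrite mem_filter xr andbT /okx E eqxx /=; apply/forallP => i; rewrite hrow_hX.
have [h1 [y0 h2]] := Lfull fJ ri.(ri_sub) kf xs.
by apply: (key ri.(ri_sub) kf xs h1 h2 sv) => j; rewrite hX_val -vE subr_le0.
Qed.

Lemma cell_vert y : svec hs y = svec hs p ->
  vert (polyhedron A (cy B b y)) = [set v | exists2 x, x \in bsel A B b p res & v = xof (rsubmx x.2) y].
Proof.
move=> sv; apply/seteqP; split => v /=.
  by move=> /vertP[pv kv]; apply: vert_bsel.
by move=> [x xb ->]; apply/vertP; apply: bsel_pt.
Qed.

(** Corresponding vertices have equal tight sets, since residuals vanish at y and y' simultaneously,
    and the tight sets of the vertices determine those of all points. *)
Lemma cell_type y y' : svec hs y = svec hs p -> svec hs y' = svec hs p ->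
  same_combinatorial_type (polyhedron A (cy B b y)) (polyhedron A (cy B b y')).
Proof.
have tr z z' : svec hs z = svec hs p -> svec hs z' = svec hs p ->
    forall v, polyhedron A (cy B b z) v -> kerfree A (tg A (cy B b z) v) ->
    exists2 v', polyhedron A (cy B b z') v' & tg A (cy B b z') v' = tg A (cy B b z) v.
  move=> sz sz' v pv kv; have [x xb vE] := vert_bsel sz pv kv.
  have [p' _] := bsel_pt xb sz'; exists (xof (rsubmx x.2) z') => //.
  have [I [fI ri E _]] := bselP xb.
  have kf := red_kerfree ri E; have xs : Xs A B b x.1 (rsubmx x.2) by move=> i iP; exact: (red_sol ri iP).
  have [h1 [y0 h2]] := Lfull fI ri.(ri_sub) kf xs.
  have szz : svec hs z = svec hs z' by rewrite sz sz'.
  have ok i : hval (hX (rsubmx x.2) i) z <= 0 by rewrite hX_val -vE subr_le0.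
  have ok' i : hval (hX (rsubmx x.2) i) z' <= 0 by rewrite hX_val subr_le0.
  have k1 := key0 ri.(ri_sub) kf xs h1 h2 szz ok.
  have k2 := key0 ri.(ri_sub) kf xs h1 h2 (esym szz) ok'.
  apply/setP => i; rewrite !inE -subr_eq0 -[RHS]subr_eq0 vE -!hX_val.
  by apply/eqP/eqP; [exact: k2|exact: k1].
by move=> sy sy'; apply: comb_type; apply: tg_transfer => //; apply: tr.
Qed.

End Chambers.

(** * Counting faces by their tight sets *)

Section Counting.
Variables (R : realType) (m nx ny : nat).
Variables (A : 'M[R]_(m, nx)) (B : 'M[R]_(m, ny)) (b : 'cV[R]_m).

Lemma size_le_nfaces d (Is : seq {set 'I_m}) : uniq Is -> (forall I, I \in Is -> faceI A B b d I) ->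
  (size Is <= nfaces (polyhedron (MM A B) b) d)%N.
Proof.
move=> u h; rewrite /nfaces; set S := [set F | _].
have fS : finite_set S by apply: sub_finite_set (faces_finite (MM A B) b) => F [].
pose T (F : set 'cV[R]_(nx + ny)) := [set i | `[< tightR A B b F i >]]%SET.
rewrite -(size_map T); apply: uniq_leq_size => // I /h[F [fF dF tF]].
apply/mapP; exists F; first by rewrite in_fset_set // inE.
apply/setP => i; rewrite inE; apply/idP/asboolP => [/tF|?]; [exact|exact/tF].
Qed.

End Counting.

(** * The algorithm is correct *)

Lemma bitlen_ge m nx ny (A : 'M[int]_(m, nx)) (B : 'M[rat]_(m, ny)) (b : 'cV[rat]_m) :
  (m * (nx + ny + 1) <= bitlen A B b)%N.
Proof.
have h p q (F : 'I_p -> 'I_q -> nat) : (forall i j, (1 <= F i j)%N) -> (p * q <= \sum_i \sum_j F i j)%N.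
  move=> hF; rewrite -[X in (X * q)%N]card_ord -sum_nat_const; apply: leq_sum => i _.
  by rewrite -[X in (X <= _)%N]card_ord -sum1_card; apply: leq_sum.
by rewrite /bitlen mulnDr mulnDr; do 2?apply: leq_add; apply: h.
Qed.

Lemma leq_expl a c n : (a <= c)%N -> (a ^ n <= c ^ n)%N.
Proof. by move=> ac; elim: n => // n IH; rewrite !expnS leq_mul. Qed.

Section Input.
Variables (R : realType) (m nx ny : nat).
Variables (A : 'M[int]_(m, nx)) (B : 'M[rat]_(m, ny)) (b : 'cV[rat]_m).
Notation AR := (intmx R A).
Notation BR := (ratmx R B).
Notation bR := (ratmx R b).

Lemma param_polyE : param_poly R A B b = polyhedron (MM AR BR) bR.
Proof.
apply/seteqP; split => z h i.
  by rewrite -[z]vsubmxK MM_col; exact: h.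
by move: (h i); rewrite -{1}[z]vsubmxK MM_col.
Qed.

Lemma tightE F i : tight A B b F i <-> tightR AR BR bR F i.
Proof.
have e z : (i \in tg (MM AR BR) bR z) = ((AR *m usubmx z) i 0 == cy BR bR (dsubmx z) i 0).
  by rewrite -{1}[z]vsubmxK MM_tg inE.
split => h z Fz; first by rewrite e; apply/eqP; exact: h.
by have := h z Fz; rewrite e => /eqP.
Qed.

Lemma lists_faceI d L : lists_faces R A B b d L ->
  forall I, I \in [seq [set:: l]%SET | l <- L] <-> faceI AR BR bR d I.
Proof.
move=> [_ _ h] I; split.
  move=> /h[F [f1 f2 f3]]; exists F; rewrite -param_polyE; split => // i.
  by split => [/f3/tightE|/tightE/f3].
move=> [F [f1 f2 f3]]; apply/h; exists F; rewrite param_polyE; split => // i.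
by split => [/f3/tightE|/tightE/f3].
Qed.

Lemma fiberE y : fiber (param_poly R A B b) y = polyhedron AR (cy BR bR y).
Proof. by rewrite param_polyE; apply/seteqP; split => x; rewrite /fiber /= => /MM_poly. Qed.

Lemma rat_intmx : rat_mx AR.
Proof. by move=> i j; rewrite mxE; exists (A i j)%:~R; rewrite ratr_int. Qed.

Lemma rat_ratmx p q (M : 'M[rat]_(p, q)) : rat_mx (ratmx R M).
Proof. by move=> i j; rewrite mxE; exact: is_ratr. Qed.

Lemma data_input L L' : data AR BR bR L L' (input_state R A B b L L').
Proof.
split => //= [i j|i j|i]; rewrite ?nth_mxseq //.
by have := nth_mxseq bR 0 i 0; rewrite muln1 addn0.
Qed.

Definition unrat (x : R) : rat := xget 0 [set q | x = ratr q].

Lemma unratK p q (M : 'M[R]_(p, q)) : rat_mx M -> ratmx R (map_mx unrat M) = M.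
Proof.
move=> h; apply/matrixP => i j; rewrite !mxE; have [q0 qE] := h i j.
have : exists q, [set q | M i j = ratr q] q by exists q0.
by move=> /(@xgetPex _ 0) /= {2}->.
Qed.

Lemma rat_rowsM (hs : seq 'rV[R]_(ny + 1)) v : (forall h, h \in hs -> rat_mx h) -> rat_mx (rowsM hs v).
Proof.
move=> h r k; rewrite mxE.
have ha : is_rat (alpha hs v r).
  by rewrite /alpha; case: ifP => _; case: ifP => _; first [exact: is_rat1 | by apply: is_ratN; exact: is_rat1].
apply: is_ratM => //.
have hr : rat_mx (nth 0 hs (jjf hs r)).
  have [lt|ge] := ltnP (jjf hs r) (size hs); first by apply: h; apply: mem_nth.
  by rewrite nth_default //; exact: rat_mx0.
apply: rat_row_mx => i j; first by rewrite mxE; exact: hr.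
by rewrite mxE; apply: is_ratN; rewrite mxE; exact: hr.
Qed.

Lemma param_vertexE I J V : red_inv AR (row_mx BR bR) I J V -> #|J| = nx ->
  param_vertex R A B b J = rsubmx V.
Proof.
move=> ri E; rewrite (red_vertex ri E); congr (_ *m _); apply/matrixP => r k.
rewrite (subrowsE E) -[k]fintype.splitK; case: (fintype.split k) => k' /=.
  by rewrite !row_mxEl (subrowsE E).
by rewrite !row_mxEr (subrowsE E).
Qed.

Lemma base_pointE I J V y : red_inv AR (row_mx BR bR) I J V -> #|J| = nx ->
  base_point A B b J y = rsubmx V *m col_mx y 1%:M.
Proof.
by move=> ri E; rewrite -(param_vertexE ri E) /param_vertex -mulmxA mul_row_col mulmx1 addrC.
Qed.

Notation res_t := (seq ({set 'I_m} * 'M[R]_(nx, nx + (ny + 1)))).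

Lemma cover_all (hs : seq 'rV[R]_(ny + 1)) (chs : seq ('cV[R]_ny * res_t)) :
  covers hs (minn ny (size hs)) ((3 * size hs) ^ minn ny (size hs)) chs ->
  forall y, svec hs y \in svs hs chs.
Proof.
move=> cv y; set D := minn ny (size hs) in cv.
have fl : flat [::] (row_mx 1%:M 0 : 'M[R]_(ny, ny + 1)).
  by split => // k Z _; rewrite row_mxKl mul1mx.
have [|||ds [sz ad hd]] := @smp_complete R ny hs D [::] _ y fl.
- by [].
- by rewrite /D; case: posnP => [->|]; rewrite ?minn0.
- have h1 V : (@nzcol R ny V <= ny)%N by apply: leq_trans (max_card _) _; rewrite card_ord.
  have h2 V : (nact hs V <= size hs)%N by apply: leq_trans (max_card _) _; rewrite card_ord.
  by rewrite /D; move: (h1 (row_mx 1%:M 0)) (h2 (row_mx 1%:M 0)); lia.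
pose f i := (nth (0, 0)%N ds i).1; pose g i := (nth (0, 0)%N ds i).2.
have dsE : [seq (f i, g i) | i <- iota 0 D] = ds.
  rewrite -[RHS](mkseq_nth (0, 0)%N) sz; apply: eq_map => i.
  by rewrite /f /g; case: (nth _ _ _).
have fg i : (i < D)%N -> (f i < size hs)%N /\ (g i < 3)%N.
  by move=> iD; have /(all_nthP (0, 0)%N)/(_ i) := ad; rewrite sz => /(_ iD)/andP[].
have [|p [sp pin]] := cv f g fg.
  by apply: valb_lt => i iD; have [? ?] := fg i iD; lia.
by rewrite dsE in sp; rewrite -(hd _ p fl sp).
Qed.

Record post (L L' : seq (seq 'I_m)) (s : state R) (hs : seq 'rV[R]_(ny + 1))
    (chs : seq ('cV[R]_ny * res_t)) : Prop := Post {
  po_ny : nmem s 0%N 2%N = ny;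
  po_hs : holds_hs hs s;
  po_size : (size hs <= size L')%N;
  po_rat : forall h, h \in hs -> rat_mx h;
  po_cov : forall I, faceI AR BR bR (ny%:Z - 1) I -> hyp_cover AR BR bR I hs;
  po_uniq : uniq (svs hs chs);
  po_reds : forall c, c \in chs -> reds AR BR bR L (size L) c.2;
  po_N : stores_at (nmem s 3%N) 1 (flatN AR BR bR hs chs);
  po_R : stores_at (rmem s 4%N) 0 (flatR AR BR bR hs chs);
  po_0 : nmem s 3%N 0%N = size chs;
  po_trie : exists nodes, trie (nmem s 56%N) nodes /\ leaf (nmem s 57%N) nodes (svs hs chs);
  po_all : forall y, svec hs y \in svs hs chs }.

Definition tbound (W H l l' N : nat) : nat :=
  (l' * (4500 * W ^ 3) + 60 + (3 * H) ^ minn ny H * (H.+1 * (4500 * W ^ 3) + 13)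
   + N * (H.+1 * (200 * W) + l * (4600 * W ^ 3) + 200) + 100 * W)%N.

Lemma algo_pos L L' : (0 < m)%N -> all uniq L -> lists_faces R A B b (ny%:Z - 1) L' ->
  ht Algo (input_state R A B b L L') (fun s t => exists hs chs, post L L' s hs chs /\
    (t <= tbound (dimW m nx ny) (size hs) (size L) (size L') (size chs))%N).
Proof.
move=> m0 uL lf'; have uL' : all uniq L' by case: lf'.
set s := input_state R A B b L L'; have d : data AR BR bR L L' s by exact: data_input.
apply: ht_if; rewrite /= m0; hseq.
have rA := rat_intmx; have rB : rat_mx (BB BR bR) by apply: rat_row_mx; exact: rat_ratmx.
have ho := hyps_ok uL' d rA rB.
apply: ht_mono ho => s1 t1 [fr tt1 [hs [hh szh rath cov]]].
have d1 : data AR BR bR L L' s1 by apply: (data_frame _ _ fr d).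
have z1 : [/\ nmem s1 56%N = (fun=> 0%N), nmem s1 57%N = (fun=> 0%N), nmem s1 52%N = (fun=> 0%N) & nmem s1 53%N = (fun=> 0%N)].
  by rewrite !fr.1.
have z2 : [/\ nmem s1 39%N 0%N = 0%N, nmem s1 38%N 0%N = 0%N & nmem s1 34%N 0%N = 0%N].
  by rewrite !fr.1.
have mo : ht Main s1 (fun s' t => [/\ data AR BR bR L L' s', holds_hs hs s' &
    exists chs, [/\ outstate AR BR bR L hs s' chs,
      covers hs (minn ny (size hs)) ((3 * size hs) ^ minn ny (size hs)) chs, nmem s' 3%N 0%N = size chs &
     (t <= (3 * size hs) ^ minn ny (size hs) * (cStep m nx hs + 13) + size chs * cCh nx L hs + 100 * dimW m nx ny)%N]]).
  by apply: main_ok.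
apply: ht_mono mo => s2 t2 [d2 hh2 [chs [os cv n0 tt2]]].
exists hs, chs; split; last first.
  by move: tt1 tt2; rewrite /tbound /cStep /cCh; move: ((3 * size hs) ^ _ * _)%N (size chs * _)%N; lia.
split => //.
- exact: d2.(d_ny).
- by move=> I /(lists_faceI lf')/mapP[l lL ->]; apply: cov.
- exact: os.(os_uniq).
- exact: os.(os_reds).
- exact: os.(os_N).
- exact: os.(os_R).
- by have [nodes [? _ ?]] := os.(os_trie); exists nodes.
- exact: cover_all.
Qed.

Lemma algo_zero L L' : m = 0%N -> \rank AR = nx -> lists_faces R A B b ny%:Z L ->
  ht Algo (input_state R A B b L L') (fun s t => exists hs chs, post L L' s hs chs /\
    size hs = 0%N /\ (t <= 60)%N).
Proof.
move=> m0 rk lf.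
have noI (i : 'I_m) : False by case: i => i; rewrite m0.
have nx0 : nx = 0%N by have := rank_leq_row AR; rewrite rk m0; lia.
have s0 (I : {set 'I_m}) : I = finset.set0 by apply/setP => i; case: (noI i).
(* The only set of indices is empty, and it is the tight set of the whole space. *)
have sL : size L = 1%N.
  have [_ u _] := lf.
  have : finset.set0 \in [seq [set:: l]%SET | l <- L].
    apply/(lists_faceI lf); apply: (@faceI_full _ _ _ _ _ _ _ _ 0 0).
    - by move=> d _; apply/colP => k; exfalso; have := ltn_ord k; lia.
    - by move=> i; case: (noI i).
    - by move=> i; case: (noI i).
  case: (L) u => [//|l1 [//|l2 l]] /=.
  by rewrite in_cons (s0 [set:: l1]%SET) (s0 [set:: l2]%SET) eqxx.
have m0' : (0 < m)%N = false by rewrite m0.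
apply: ht_if; rewrite /= m0'.
pose x : {set 'I_m} * 'M[R]_(nx, nx + (ny + 1)) := (finset.set0, row_mx 1%:M 0).
have bs : bsel AR BR bR 0 [:: x] = [:: x].
  rewrite /bsel /= /okx /= cards0; have -> : (0%N == nx) = true by rewrite nx0.
  by have -> : okb AR BR bR 0 (row_mx 1%:M 0) = true by apply/forallP => i; case: (noI i).
hseq; hset; hseq; hset; hseq; hset; hset.
exists [::], [:: (0, [:: x])]; split; last by [].
split => //.
- move=> I _; rewrite (s0 I); exists finset.set0, (row_mx 1%:M 0); split; first exact: red_inv0.
  by move=> _; right => i; case: (noI i).
- move=> c; rewrite inE => /eqP -> /=; rewrite sL; split => // q; rewrite ltnS leqn0 => /eqP ->.
  by rewrite (s0 [set:: _]%SET); exact: red_inv0.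
- have -> : flatN AR BR bR [::] [:: (0, [:: x])] = [:: 0%N; 1%N].
    transitivity (outN ([::] : seq 'rV[R]_(ny + 1)) (bsel AR BR bR 0 [:: x]) ++ [::]); first by [].
    by rewrite bs /outN /outB /= enum_set0.
  by move=> x0 [|[|//]].
- move=> x0 i; suff -> : size (flatR AR BR bR [::] [:: (0, [:: x])]) = 0%N by [].
  have -> : flatR AR BR bR [::] [:: (0, [:: x])] =
      outR [::] (svec [::] (0 : 'cV[R]_ny)) (bsel AR BR bR 0 [:: x]) ++ [::] by [].
  rewrite bs cats0 /outR size_cat size_mxseq; have -> : outV [:: x] = mxseq (rsubmx x.2) ++ [::] by [].
  by rewrite cats0 size_mxseq nx0.
- exists [:: [::]]; split; first exact: trie0.
  by split => // [[|k]].
Qed.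

Definition mkch (hs : seq 'rV[R]_(ny + 1)) (c : 'cV[R]_ny * res_t) : chamber m ny :=
  let M := rowsM hs (svec hs c.1) in
  Chamber (map_mx unrat (lsubmx M)) (map_mx unrat (rsubmx M)) [seq x.1 | x <- bsel AR BR bR c.1 c.2].

Lemma mkch_set hs c : (forall h, h \in hs -> rat_mx h) ->
  chamber_set R (mkch hs c) = cellc hs (svec hs c.1).
Proof.
move=> hr; rewrite /chamber_set /= !unratK ?poly_rows //;
  by move=> i j; rewrite mxE; exact: rat_rowsM.
Qed.

Lemma relint_mkch hs c y : (forall h, h \in hs -> rat_mx h) ->
  relint (chamber_set R (mkch hs c)) y <-> svec hs y = svec hs c.1.
Proof. by move=> hr; rewrite mkch_set //; exact: relint_cell. Qed.

Lemma map_enum_nth T U (F : T -> U) x0 (s : seq T) :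
  [seq F (nth x0 s (nat_of_ord i)) | i : 'I_(size s) <- enum 'I_(size s)] = [seq F x | x <- s].
Proof. by rewrite -[in RHS](mkseq_nth x0 s) /mkseq -val_enum_ord -!map_comp. Qed.

Section Post.
Variables (L L' : seq (seq 'I_m)) (s : state R) (hs : seq 'rV[R]_(ny + 1)).
Variable chs : seq ('cV[R]_ny * res_t).
Hypothesis po : post L L' s hs chs.
Let D (i : 'I_(size chs)) := mkch hs (nth (0, [::]) chs i).

Lemma post_reds (i : 'I_(size chs)) : reds AR BR bR L (size L) (nth (0, [::]) chs i).2.
Proof. by apply: po.(po_reds); apply: mem_nth. Qed.

Lemma post_query y : exists (s' : state R) (t' : nat) (i : 'I_(size chs)),
  [/\ exec Query (load_query s y) s' t', (t' <= (size hs).+1 * (200 * ny.+1))%N,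
      query_result s' = i & relint (chamber_set R (D i)) y].
Proof.
have yin := po.(po_all) y; have [nodes [tr lfn]] := po.(po_trie).
have [s' [t' [ex [tt qr]]]] : ht Query (load_query s y) (fun s' t =>
    (t <= (size hs).+1 * (200 * ny.+1))%N /\ nmem s' 4%N 0%N = index (svec hs y) (svs hs chs)).
  have q1 : nmem (load_query s y) 0%N 2%N = ny by exact: po.(po_ny).
  have q2 : holds_hs hs (load_query s y) by exact: po.(po_hs).
  have q3 : carr ny (rmem (load_query s y) 3%N) = y.
    by apply/colP => j; rewrite mxE /=; have := nth_mxseq y 0 j 0; rewrite muln1 addn0.
  have tr' : trie (nmem (load_query s y) 56%N) nodes by exact: tr.
  have lfn' : leaf (nmem (load_query s y) 57%N) nodes (svs hs chs) by exact: lfn.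
  exact: (query_ok q1 q2 tr' lfn' q3 yin).
have lt : (index (svec hs y) (svs hs chs) < size chs)%N.
  by rewrite -index_mem size_map in yin.
exists s', t', (Ordinal lt); split => //; apply/relint_mkch; first exact: po.(po_rat).
have := nth_index [::] yin; rewrite (nth_map (0, [::])) // => <- //.
Qed.

Lemma post_size f : (size L' <= f)%N -> (0 < f)%N -> (size chs <= 3 * f ^ ny)%N.
Proof.
move=> Lf f0; have := @count_svec R ny hs (svs hs chs) po.(po_uniq).
rewrite size_map => h; apply: leq_trans (h _) _.
  by move=> tau /mapP[c _ ->]; exists c.1.
(* Without hyperplanes there is a single cell; the bound 3 f^n on [Tc] starts at one hyperplane. *)
have [->|H0] := posnP (size hs); first by case: (ny) => [|k] /=; rewrite muln_gt0 expn_gt0 f0.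
apply: leq_trans (Tc_bound _ H0) _; apply: leq_mul => //.
by apply: leq_expl; exact: leq_trans po.(po_size) Lf.
Qed.

Hypothesis lf : lists_faces R A B b ny%:Z L.

Lemma post_outputs : outputs A B b s D.
Proof.
have [_ uL _] := lf; have HL := lists_faceI lf.
split.
- by move=> i; exact: (uniq_bases uL HL _ (post_reds i)).
- rewrite (map_enum_nth (fun c => [:: ch_size (mkch hs c), size (ch_bases (mkch hs c)) &
    flatten [seq map val (enum J) | J : {set 'I_m} <- ch_bases (mkch hs c)]])).
  move=> x0 [|i]; first by rewrite /= po.(po_0).
  move=> lt; have := po.(po_N); rewrite /stores_at => /(_ x0 i); rewrite add1n.
  have -> : flatN AR BR bR hs chs = flatten [seq [:: ch_size (mkch hs c), size (ch_bases (mkch hs c)) &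
    flatten [seq map val (enum J) | J : {set 'I_m} <- ch_bases (mkch hs c)]] | c <- chs].
    by congr flatten; apply: eq_map => c; rewrite /outN /outB /= size_map.
  by move=> h; apply: h.
rewrite (map_enum_nth (fun c => mxseq (row_mx (ratmx R (ch_G (mkch hs c))) (ratmx R (ch_g (mkch hs c)))) ++
    flatten [seq mxseq (param_vertex R A B b J) | J <- ch_bases (mkch hs c)])).
have <- : flatR AR BR bR hs chs = flatten [seq mxseq (row_mx (ratmx R (ch_G (mkch hs c))) (ratmx R (ch_g (mkch hs c)))) ++
    flatten [seq mxseq (param_vertex R A B b J) | J <- ch_bases (mkch hs c)] | c <- chs].
  congr flatten; apply/eq_in_map => c cin; rewrite /outR /=; congr (_ ++ _).
    rewrite !unratK ?hsubmxK // => i j; rewrite mxE; apply: rat_rowsM; exact: po.(po_rat).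
  rewrite /outV -map_comp; congr flatten; apply/eq_in_map => x xin /=.
  have [I [fI ri E _]] := bselP HL (po.(po_reds) cin) xin.
  by rewrite (param_vertexE ri E).
by move=> x0 i lt; have := po.(po_R); rewrite /stores_at => /(_ x0 i lt); rewrite add0n.
Qed.

Lemma post_decomposition : \rank AR = nx -> has_dim (param_poly R A B b) (nx + ny)%N%:Z ->
  chamber_decomposition A B b (fun i => chamber_set R (D i)) (fun i => chamber_base (D i)).
Proof.
move=> rk; rewrite param_polyE => dm; have HL := lists_faceI lf; have rt := po.(po_rat).
have kfT (d : 'cV[R]_nx) : (forall i, (AR *m d) i 0 = 0) -> d = 0.
  move=> h; have fr : row_free AR^T by rewrite /row_free mxrank_tr rk.
  apply: trmx_inj; rewrite trmx0; apply: (row_free_inj fr); rewrite mul0mx -trmx_mul.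
  by apply: trmx_inj; rewrite trmxK trmx0; apply/colP => i; rewrite h mxE.
split.
- by move=> i; exists (ch_size (D i)), (ch_G (D i)), (ch_g (D i)).
- move=> i j ij; apply/seteqP; split => y //= [/(relint_mkch _ _ rt) e1 /(relint_mkch _ _ rt) e2].
  move/eqP: ij; apply; apply: val_inj; apply/eqP.
  have sz (k : 'I_(size chs)) : (k < size (svs hs chs))%N by rewrite size_map.
  rewrite /= -(nth_uniq [::] (sz i) (sz j) po.(po_uniq)) !(nth_map (0, [::])) //.
  by rewrite -e1 -e2.
- move=> y _; have /mapP[c /(nthP (0, [::]))[q qs <-] e] := po.(po_all) y.
  by exists (Ordinal qs); apply/relint_mkch.
- move=> i y y' /(relint_mkch _ _ rt) e1 /(relint_mkch _ _ rt) e2; rewrite !fiberE.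
  exact: (cell_type po.(po_cov) HL (post_reds i) dm kfT e1 e2).
move=> i; split => [J|y /(relint_mkch _ _ rt) e].
  rewrite inE => /mapP[x xin ->]; have [I [fI ri E _]] := bselP HL (post_reds i) xin.
  by rewrite /is_base E eqxx (red_unit ri E).
rewrite fiberE (cell_vert po.(po_cov) HL (post_reds i) dm e); apply/seteqP; split => v /=.
  move=> [x xin ->]; exists x.1; first by rewrite inE; apply: map_f.
  by have [I [fI ri E _]] := bselP HL (post_reds i) xin; rewrite (base_pointE _ ri E).
move=> [J]; rewrite inE => /mapP[x xin ->] ->; exists x => //.
by have [I [fI ri E _]] := bselP HL (post_reds i) xin; rewrite (base_pointE _ ri E).
Qed.

End Post.

End Input.

(** The factor 3 in each digit is absorbed by doubling the exponent: 3H <= f^2 once H >= 3, while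
    for H <= 2 at most two digits in base at most 6 give 36. *)
Lemma digits_bound f H n : (0 < f)%N -> (H <= f)%N -> ((3 * H) ^ minn n H <= 36 * f ^ (2 * n))%N.
Proof.
move=> f0 Hf; have fp : (0 < f ^ (2 * n))%N by rewrite expn_gt0 f0.
have small_ c : (c <= 36)%N -> (c <= 36 * f ^ (2 * n))%N.
  by move=> c36; apply: leq_trans c36 _; rewrite leq_pmulr.
case: H Hf => [|[|[|H]]] Hf.
- by rewrite minn0; apply: small_.
- apply: small_; apply: (@leq_trans (3 ^ 1)); last by [].
  by apply: leq_pexp2l => //; exact: geq_minr.
- apply: small_; apply: (@leq_trans (6 ^ 2)); last by [].
  by apply: leq_pexp2l => //; exact: geq_minr.
apply: (@leq_trans (f ^ (2 * n))); last by rewrite leq_pmull.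
apply: (@leq_trans ((f ^ 2) ^ minn n H.+3)).
  have [->|h] := posnP (minn n H.+3); first by rewrite !expn0.
  rewrite leq_exp2r // (expnS f 1) expn1; apply: leq_mul => //.
  by apply: leq_trans Hf.
by rewrite -expnM; apply: leq_pexp2l => //; rewrite leq_mul2l geq_minl.
Qed.

(** Every term is compared with u = T (a F), the cost of treating the n_y-dimensional faces for each
    chamber, and v = T (a2 f), the cost of sampling all candidates. The factor 8 is the cube of the
    2 in W <= 2 S. *)
Lemma tbound_le ny W H l l' N f F S : (0 < f)%N -> (0 < W)%N -> (H <= l')%N -> (l' <= f)%N ->
  (l <= F)%N -> (N <= 3 * f ^ ny)%N -> (W <= 2 * S)%N ->
  (tbound ny W H l l' N <= 4000 * 1000 * S ^ 3 * (f ^ ny * F + f ^ (2 * ny) * f))%N.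
Proof.
move=> f0 W0 Hl lf lF Nf WS; rewrite /tbound.
have cb := digits_bound ny f0 (leq_trans Hl lf).
set cnt := ((3 * H) ^ _)%N in cb *.
set a := (f ^ ny)%N in Nf *; set a2 := (f ^ (2 * ny))%N in cb *.
have a0 : (0 < a)%N by rewrite expn_gt0 f0.
have a20 : (0 < a2)%N by rewrite expn_gt0 f0.
have aa : (a <= a2)%N by apply: leq_pexp2l => //; lia.
set T := (W ^ 3)%N; have T0 : (0 < T)%N by rewrite expn_gt0 W0.
have WT : (W <= T)%N by rewrite -{1}[W]expn1; apply: leq_pexp2l.
have TS : (T <= 8 * S ^ 3)%N by rewrite -[8%N]/(2 ^ 3)%N -expnMn; rewrite leq_exp2r.
have Hf : (H.+1 <= 2 * f)%N by lia.
pose u := (T * (a * F))%N; pose v := (T * (a2 * f))%N.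
have v0 : (1 <= v)%N := leq_mul T0 (leq_mul a20 f0).
have t1 : (l' * (4500 * T) <= 4500 * v)%N.
  rewrite mulnCA leq_mul2l /= mulnC leq_mul2l; apply/orP; right.
  by apply: leq_trans lf _; rewrite leq_pmull.
have t2 : (cnt * (H.+1 * (4500 * T) + 13) <= 36 * (9 * 1100) * v)%N.
  apply: (@leq_trans (36 * a2 * ((9 * 1100) * (f * T)))).
    apply: leq_mul => //; have := leq_mul Hf (leqnn T).
    have fT : (1 <= f * T)%N by rewrite muln_gt0 f0.
    by move: fT; rewrite mulnCA -mulnA; move: (H.+1 * T)%N (f * T)%N; lia.
  by rewrite /v; apply: eq_leq; ring.
have t3 : (N * (H.+1 * (200 * W) + l * (4600 * T) + 200) <= 3 * 600 * v + 3 * 4600 * u)%N.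
  apply: (@leq_trans (3 * a * (600 * (f * T) + 4600 * (F * T)))).
    apply: leq_mul => //; have h1 := leq_mul Hf WT; have h2 := leq_mul lF (leqnn T).
    have fT : (1 <= f * T)%N by rewrite muln_gt0 f0.
    move: fT h1 h2; rewrite mulnCA [(l * (4600 * T))%N]mulnCA -mulnA.
    by move: (H.+1 * W)%N (f * T)%N (l * T)%N (F * T)%N; lia.
  have h3 : (a * (f * T) <= v)%N by rewrite /v mulnA mulnC leq_mul2l leq_mul2r aa !orbT.
  have -> : (3 * a * (600 * (f * T) + 4600 * (F * T)) = 3 * 600 * (a * (f * T)) + 3 * 4600 * u)%N.
    by rewrite /u; ring.
  by rewrite leq_add2r leq_mul2l h3 orbT.
have t4 : (100 * W <= 100 * v)%N.
  by rewrite leq_mul2l /=; apply: leq_trans WT _; rewrite leq_pmulr // muln_gt0 a20 f0.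
have t5 : (u + v <= 8 * (S ^ 3 * (a * F + a2 * f)))%N.
  by rewrite /u /v -mulnDr mulnA leq_mul2r TS orbT.
rewrite -[X in (_ <= X)%N]mulnA.
move: t1 t2 t3 t4 t5 v0; move: (l' * _)%N (cnt * _)%N (N * _)%N (S ^ 3 * _)%N u v => *; lia.
Qed.

Theorem theorem4 (R : realType) :
  exists (algo query : cmd) (C K : nat),
  forall (m nx ny : nat) (A : 'M[int]_(m, nx)) (B : 'M[rat]_(m, ny))
    (b : 'cV[rat]_m) (L L' : seq (seq 'I_m)),
  let P := param_poly R A B b in
  let f_ny := nfaces P ny%:Z in
  let f_ny1 := maxn 1 (nfaces P (ny%:Z - 1)) in
  \rank (intmx R A) = nx ->
  has_dim P (nx + ny)%N%:Z ->
  lists_faces R A B b ny%:Z L ->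
  lists_faces R A B b (ny%:Z - 1) L' ->
  exists (s : state R) (t N : nat) (D : 'I_N -> chamber m ny),
  [/\ exec algo (input_state R A B b L L') s t
      /\ outputs A B b s D,
      (t <= C * (bitlen A B b).+1 ^ K *
             (f_ny1 ^ ny * f_ny + f_ny1 ^ (2 * ny) * (nu R A + f_ny1)))%N,
      chamber_decomposition A B b (fun i => chamber_set R (D i))
        (fun i => chamber_base (D i)),
      (N <= C * f_ny1 ^ (2 * ny))%N
      /\ (#|[pred i | `[< has_dim (chamber_set R (D i)) ny%:Z >]]|
          <= C * f_ny1 ^ ny)%N
    & forall y, proj_y P y ->
        exists (s' : state R) (t' : nat) (i : 'I_N),
        [/\ exec query (load_query s y) s' t',
            (t' <= C * (maxn 1 ny * f_ny1))%N,
            query_result s' = i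
          & relint (chamber_set R (D i)) y]].
Proof.
exists Algo, Query, (4000 * 1000)%N, 3%N => m nx ny A B b L L' P f_ny f_ny1 rk dm lf lf'.
have szL d l : lists_faces R A B b d l -> (size l <= nfaces P d)%N.
  move=> lfd; rewrite /P param_polyE -(size_map (fun x => [set:: x]%SET)).
  by apply: size_le_nfaces; [case: lfd|move=> I /(lists_faceI lfd)].
have f0 : (0 < f_ny1)%N by rewrite leq_maxl.
have L'f : (size L' <= f_ny1)%N by apply: leq_trans (szL _ _ lf') _; rewrite leq_maxr.
have [s [t [ex [hs [chs [po tt]]]]]] : ht Algo (input_state R A B b L L') (fun s t => exists hs chs,
    post A B b L L' s hs chs /\
    (t <= 4000 * 1000 * (bitlen A B b).+1 ^ 3 * (f_ny1 ^ ny * f_ny + f_ny1 ^ (2 * ny) * f_ny1))%N).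
  have [m0|m0] := posnP m.
    apply: ht_mono (algo_zero L' m0 rk lf) => s t [hs [chs [po [_ tt]]]]; exists hs, chs; split => //.
    apply: leq_trans tt _; apply: (@leq_trans (4000 * 1000 * (1 * 1))); first by lia.
    rewrite -[X in (_ <= X)%N]mulnA; apply: (leq_mul (leqnn (4000 * 1000))).
    apply: leq_mul; rewrite ?expn_gt0 //.
    by rewrite addn_gt0 !muln_gt0 !expn_gt0 f0 orbT.
  have uL : all uniq L by case: lf.
  apply: ht_mono (algo_pos m0 uL lf') => s t [hs [chs [po tt]]]; exists hs, chs; split => //.
  apply: leq_trans tt _; apply: tbound_le => //.
  - exact: dimW_gt0.
  - exact: po.(po_size).
  - exact: szL.
  - exact: (post_size po L'f f0).
  have := bitlen_ge A B b; rewrite /dimW; move: (bitlen A B b) => bl h.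
  (* The sum of two positive integers is at most their product plus one, and each entry of the data
     takes at least one bit. *)
  have : (m + (nx + ny + 1) <= m * (nx + ny + 1) + 1)%N by nia.
  by lia.
have Nf := post_size po L'f f0.
exists s, t, (size chs), (fun i => mkch A B b hs (nth (0, [::]) chs i)); split.
- by split => //; exact: (post_outputs po lf).
- apply: leq_trans tt _; rewrite leq_mul2l; apply/orP; right.
  by rewrite leq_add2l leq_mul2l leq_addl orbT.
- exact: (post_decomposition po lf rk dm).
(* Both counts follow from the bound 3 f^(n_y) on the number of all chambers. *)
- have h3 k : (3 * k <= 4000 * 1000 * k)%N by rewrite leq_mul2r; apply/orP; right; lia.
  split.
    apply: leq_trans Nf _; apply: leq_trans (h3 _) _; rewrite leq_mul2l; apply/orP; right.
    by apply: leq_pexp2l => //; lia.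
  apply: leq_trans (max_card _) _; rewrite card_ord; apply: leq_trans Nf _; exact: h3.
move=> y _; have [s' [t' [i [h1 h2 h3 h4]]]] := post_query po y.
exists s', t', i; split => //; apply: leq_trans h2 _.
have Hf : ((size hs).+1 <= 2 * f_ny1)%N by have := leq_trans po.(po_size) L'f; lia.
have Hn : (200 * ny.+1 <= 400 * maxn 1 ny)%N by lia.
apply: leq_trans (leq_mul Hf Hn) _.
have -> : (2 * f_ny1 * (400 * maxn 1 ny) = 800 * (maxn 1 ny * f_ny1))%N by ring.
by rewrite leq_mul2r; apply/orP; right; lia.
Qed.
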